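(* Let the integers $s(n)$ and $b(n)$ ($n \geq 1$) be defined by the $q$-expansions $$\psi(z) = \frac{\Delta(z)}{\Delta(2z)} = q^{-1} - 24 + \sum_{n=1}^\infty s(n) q^n, \qquad \phi(z) = \frac{1}{\psi(z)} = \sum_{n=1}^\infty b(n) q^n .$$ Then, as $n \to \infty$, $$|s(n)| \sim \frac{1}{2 n^{3/4}} e^{2\pi \sqrt{n}}, \qquad b(n) \sim \frac{2^{1/4}}{8192} \cdot \frac{1}{n^{3/4}} e^{2\pi \sqrt{2n}}.$$
   Context: Here $q = e^{2\pi i z}$ with $z$ in the complex upper half-plane, and $\Delta(z) = q \prod_{n=1}^\infty (1-q^n)^{24}$. The notation $f(n) \sim g(n)$ means $f(n)/g(n) \to 1$ as $n \to \infty$. *)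

(* Defs.v *)
From Stdlib Require Import Reals ZArith.
From Coquelicot Require Import Coquelicot.

Open Scope R_scope.

Definition Cexp (w : C) : C :=
  (exp (Re w) * cos (Im w), exp (Re w) * sin (Im w)).

(* Meaningful only when [u] converges; see [Clim_seq_correct]. *)
Definition Clim_seq (u : nat -> C) : C :=
  @lim C_CompleteNormedModule (filtermap u eventually).

Lemma Clim_seq_correct (u : nat -> C) (l : C) :
  filterlim u eventually (locally (T := C_NormedModule) l) -> Clim_seq u = l.
Proof.
intros Hu.
assert (PF : ProperFilter (filtermap u eventually)).
{ apply filtermap_proper_filter, eventually_filter. }
assert (Hc : cauchy (T := C_CompleteNormedModule) (filtermap u eventually)).
{ intros eps; exists l; apply Hu; exists eps; intros y Hy; exact Hy. }
apply (filterlim_locally_unique (K := C_AbsRing) (V := C_NormedModule)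
  (F := eventually) u); [| exact Hu].
intros P [eps HP].
apply (filter_imp (F := eventually)
  (fun n => ball (M := C_NormedModule) (Clim_seq u) eps (u n))).
- intros n Hn; exact (HP _ Hn).
- exact (complete_cauchy (T := C_CompleteNormedModule) _ PF Hc eps).
Qed.

Fixpoint Cprod1 (f : nat -> C) (N : nat) : C :=
  match N with
  | O => RtoC 1
  | S N' => Cmult (Cprod1 f N') (f (S N'))
  end.

Definition Cprod1_inf (f : nat -> C) : C := Clim_seq (Cprod1 f).

Definition upper_half_plane (z : C) : Prop := 0 < Im z.

Definition q (z : C) : C := Cexp (RtoC (2 * PI) * Ci * z)%C.

Definition Delta (z : C) : C :=
  (q z * Cprod1_inf (fun n => Cpow (RtoC 1 - Cpow (q z) n) 24))%C.

Definition psi (z : C) : C := (Delta z / Delta (RtoC 2 * z))%C.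

Definition phi (z : C) : C := (RtoC 1 / psi z)%C.

(* [is_qseries a z v]: the series a(1) q + a(2) q^2 + ... converges to [v] at
   the point [z]; the value [a 0] is not used. *)
Definition is_qseries (a : nat -> Z) (z v : C) : Prop :=
  is_series (K := C_AbsRing) (V := C_NormedModule)
    (fun k : nat => Cmult (RtoC (IZR (a (S k)))) (Cpow (q z) (S k))) v.

Definition asymp_equiv (f g : nat -> R) : Prop :=
  is_lim_seq (fun n => f n / g n) 1.

(* Main.v *)
Require Import Defs.
From Stdlib Require Import Reals ZArith.
From Coquelicot Require Import Coquelicot.
From Stdlib Require Import Lra Lia Psatz.

Open Scope R_scope.

(** No modularity is needed.  Cancelling factors,
    phi = q * prod (1 + q^n)^24 and psi = q^-1 * prod (1 - q^(2n-1))^24;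
    replacing q by -q in the second, both statements concern the coefficients
    of F(q) = prod_k (1 + q^(e k))^24 with e k = k or e k = 2k - 1.

    Put q = exp (-t + i x).  Then F(q) / F(exp (-t)) is the characteristic
    function of a sum of independent variables, each equal to e k with
    probability 1 / (1 + exp (e k * t)) and to 0 otherwise.  The saddle point
    is t = sqrt (A / n) with A = pi^2 (for psi) or 2 pi^2 (for phi).  On the
    scale x ~ t^(3/2) a Lyapunov estimate makes the characteristic function
    Gaussian; elsewhere it is O(t^3 / x^2) because sum r^m (1 - cos (m x)) has
    a closed form.  So the Cauchy integral reduces to a Gaussian integral.

    The only analytic input is sum_k ln (1 + exp (- e k * t)) = a / t + c + O(t),
    which is the trapezoid rule together with
    int_0^oo ln (1 + exp (-x)) dx = pi^2 / 12.  Mean and variance follow from it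
    without differentiation, by comparing tangents and chords of convex
    functions. *)

(** * Complex limits and infinite products *)

(** Since [F(exp (-t))] is close to [exp (A / t + 24 c)], the quantity to minimise is [n t + A / t];
    its least value [2 sqrt (A n)], at the saddle, is the exponential in both results. The width
    [t^(3/2)] of the Gaussian window gives [n^(-3/4)], and [exp (24 c)] is [1] for psi and [2^(-12)]
    for phi. Asymptotics of the coefficients, not just of their logarithms, require the error in
    [ln F] to vanish at the saddle; hence the need for the constant [c] and an error [O(t)].

    The decay [t^3 / x^2] is crude but just sufficient: integrated over [|x| >= M t^(3/2)] it gives
    [O(t^(3/2) / M)], the order of the main term with a constant that vanishes as [M] grows. So [M]
    is fixed first and [t] tends to 0 afterwards, which is why the estimates carry explicit
    constants.

    The index of the coefficient of [F] differs from [n] by one, because of the factor [q] or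
    [q^-1]. The saddle is still taken at [n]; this costs only a factor [exp (t)] or [exp (- t)],
    which tends to 1. *)

Lemma exp_le (x y : R) : x <= y -> exp x <= exp y.
Proof.
intros [H | ->]; [left; now apply exp_increasing | apply Rle_refl].
Qed.

Lemma exp_neg_le_1 (v : R) : 0 <= v -> exp (- v) <= 1.
Proof.
intros Hv; rewrite <- exp_0; apply exp_le; lra.
Qed.

(** Stated through a real sequence so that the real limit lemmas (squeezing, sums, products) apply
    directly. *)
Definition Cis_lim (u : nat -> C) (l : C) : Prop :=
  is_lim_seq (fun n => Cmod (u n - l)) 0.

Lemma Cis_lim_filterlim (u : nat -> C) (l : C) :
  Cis_lim u l <-> filterlim u eventually (locally (T := C_NormedModule) l).
Proof.
split; intros H.
- apply (filterlim_locally_ball_norm (K := C_AbsRing) (U := C_NormedModule)).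
  intros eps; apply is_lim_seq_Reals in H; destruct (H eps (cond_pos eps)) as [N HN].
  exists N; intros n Hn; specialize (HN n Hn).
  unfold R_dist in HN; rewrite Rminus_0_r, Rabs_pos_eq in HN by apply Cmod_ge_0.
  exact HN.
- apply is_lim_seq_Reals; intros eps He.
  destruct (proj1 (filterlim_locally_ball_norm (K := C_AbsRing)
    (U := C_NormedModule) u l) H (mkposreal eps He)) as [N HN].
  exists N; intros n Hn; specialize (HN n Hn).
  unfold R_dist; rewrite Rminus_0_r, Rabs_pos_eq by apply Cmod_ge_0.
  exact HN.
Qed.

Lemma Cis_lim_unique (u : nat -> C) (l1 l2 : C) :
  Cis_lim u l1 -> Cis_lim u l2 -> l1 = l2.
Proof.
intros H1 H2; apply Cis_lim_filterlim in H1; apply Cis_lim_filterlim in H2.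
exact (filterlim_locally_unique (K := C_AbsRing) (V := C_NormedModule) u l1 l2 H1 H2).
Qed.

Lemma Cis_lim_ext (u v : nat -> C) (l : C) :
  (forall n, u n = v n) -> Cis_lim u l -> Cis_lim v l.
Proof.
intros H; apply is_lim_seq_ext; intros n; now rewrite H.
Qed.

Lemma Cis_lim_const (l : C) : Cis_lim (fun _ => l) l.
Proof.
apply is_lim_seq_ext with (fun _ => 0); [intros n | apply is_lim_seq_const].
replace (l - l)%C with (RtoC 0) by ring; now rewrite Cmod_0.
Qed.

Lemma Cis_lim_subseq (u : nat -> C) (l : C) (phi : nat -> nat) :
  filterlim phi eventually eventually ->
  Cis_lim u l -> Cis_lim (fun n => u (phi n)) l.
Proof.
intros Hphi H.
exact (is_lim_seq_subseq (fun n => Cmod (u n - l)) 0 phi Hphi H).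
Qed.

Lemma Cis_lim_Cmod (u : nat -> C) (l : C) :
  Cis_lim u l -> is_lim_seq (fun n => Cmod (u n)) (Cmod l).
Proof.
intros H.
apply is_lim_seq_le_le with (fun n => Cmod l - Cmod (u n - l))
  (fun n => Cmod l + Cmod (u n - l)).
- intros n; split.
  + replace l with ((u n) + - (u n - l))%C at 1 by ring.
    generalize (Cmod_triangle (u n) (- (u n - l))); rewrite Cmod_opp; lra.
  + replace (u n) with (l + (u n - l))%C at 1 by ring; apply Cmod_triangle.
- replace (Finite (Cmod l)) with (Finite (Cmod l - 0)) by (f_equal; ring).
  apply is_lim_seq_minus'; [apply is_lim_seq_const | exact H].
- replace (Finite (Cmod l)) with (Finite (Cmod l + 0)) by (f_equal; ring).
  apply is_lim_seq_plus'; [apply is_lim_seq_const | exact H].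
Qed.

Lemma Cis_lim_mult (u v : nat -> C) (l m : C) :
  Cis_lim u l -> Cis_lim v m -> Cis_lim (fun n => u n * v n)%C (l * m)%C.
Proof.
intros Hu Hv; unfold Cis_lim.
apply is_lim_seq_le_le with (fun _ => 0)
  (fun n => Cmod (u n - l) * Cmod (v n) + Cmod l * Cmod (v n - m)).
- intros n; split; [apply Cmod_ge_0 | rewrite <- !Cmod_mult].
  replace (u n * v n - l * m)%C with ((u n - l) * v n + l * (v n - m))%C by ring.
  apply Cmod_triangle.
- apply is_lim_seq_const.
- replace (Finite 0) with (Finite (0 * Cmod m + Cmod l * 0)) by (f_equal; ring).
  apply is_lim_seq_plus'.
  + apply is_lim_seq_mult'; [exact Hu | now apply Cis_lim_Cmod].
  + apply is_lim_seq_mult'; [apply is_lim_seq_const | exact Hv].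
Qed.

Lemma Cis_lim_minus (u v : nat -> C) (l m : C) :
  Cis_lim u l -> Cis_lim v m -> Cis_lim (fun n => u n - v n)%C (l - m)%C.
Proof.
intros Hu Hv; unfold Cis_lim.
apply is_lim_seq_le_le with (fun _ => 0)
  (fun n => Cmod (u n - l) + Cmod (v n - m)).
- intros n; split; [apply Cmod_ge_0 |].
  rewrite <- (Cmod_opp (v n - m)).
  replace (u n - v n - (l - m))%C with ((u n - l) + - (v n - m))%C by ring.
  apply Cmod_triangle.
- apply is_lim_seq_const.
- replace (Finite 0) with (Finite (0 + 0)) by (f_equal; ring).
  now apply is_lim_seq_plus'.
Qed.

Lemma Cis_lim_pow (u : nat -> C) (l : C) (k : nat) :
  Cis_lim u l -> Cis_lim (fun n => Cpow (u n) k) (Cpow l k).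
Proof.
intros H; induction k as [|k IH].
- exact (Cis_lim_const 1).
- apply Cis_lim_ext with (fun n => u n * Cpow (u n) k)%C.
  + intros n; now rewrite Cpow_S.
  + rewrite Cpow_S; now apply Cis_lim_mult.
Qed.

Lemma Cis_lim_RtoC (u : nat -> R) (l : R) :
  is_lim_seq u l -> Cis_lim (fun n => RtoC (u n)) (RtoC l).
Proof.
intros H; unfold Cis_lim.
apply is_lim_seq_ext with (fun n => Rabs (u n - l)).
- intros n; now rewrite <- RtoC_minus, Cmod_R.
- replace (Finite 0) with (Rbar_abs (Finite (l - l)))
    by (simpl; f_equal; rewrite Rminus_diag; apply Rabs_R0).
  apply is_lim_seq_abs, is_lim_seq_minus'; [exact H | apply is_lim_seq_const].
Qed.

Lemma Cprod1_inf_eq (f : nat -> C) (l : C) :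
  Cis_lim (Cprod1 f) l -> Cprod1_inf f = l.
Proof.
intros H; apply Clim_seq_correct, Cis_lim_filterlim, H.
Qed.

Lemma Cprod1_ext (f g : nat -> C) (N : nat) :
  (forall n, f (S n) = g (S n)) -> Cprod1 f N = Cprod1 g N.
Proof.
intros H; induction N as [|N IH]; simpl; [reflexivity | now rewrite IH, H].
Qed.

Lemma Cprod1_mult (f g : nat -> C) (N : nat) :
  Cprod1 (fun n => f n * g n)%C N = (Cprod1 f N * Cprod1 g N)%C.
Proof.
induction N as [|N IH]; simpl; [ring | rewrite IH; ring].
Qed.

Lemma Cprod1_pow (f : nat -> C) (k N : nat) :
  Cprod1 (fun n => Cpow (f n) k) N = Cpow (Cprod1 f N) k.
Proof.
induction N as [|N IH].
- simpl; now rewrite Cpow_1_l.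
- change (Cprod1 (fun n => Cpow (f n) k) N * Cpow (f (S N)) k
          = Cpow (Cprod1 f N * f (S N)) k)%C.
  now rewrite IH, Cpow_mult_l.
Qed.

Lemma sum_n_le_Series (a : nat -> R) (N : nat) :
  (forall n, 0 <= a n) -> ex_series a -> sum_n a N <= Series a.
Proof.
intros Ha Hs.
apply (is_lim_seq_incr_compare (sum_n a)).
- exact (Series_correct a Hs).
- intros n; rewrite sum_Sn; unfold plus; simpl; specialize (Ha (S n)); lra.
Qed.

Lemma Cmod_Cprod1_le (f : nat -> C) (rho : nat -> R) (N : nat) :
  (forall n, Cmod (f (S n) - 1) <= rho n) ->
  Cmod (Cprod1 f (S N)) <= exp (sum_n rho N).
Proof.
intros Hf.
assert (Hb : forall n, Cmod (f (S n)) <= exp (rho n)).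
{ intros n; replace (f (S n)) with (1 + (f (S n) - 1))%C by ring.
  generalize (Cmod_triangle 1 (f (S n) - 1)) (Hf n) (exp_ineq1_le (rho n)).
  rewrite Cmod_1; lra. }
induction N as [|N IH].
- simpl; rewrite Cmult_1_l, sum_O; apply Hb.
- rewrite sum_Sn; unfold plus; simpl Cprod1; simpl; rewrite exp_plus.
  change (Cprod1 f N * f (S N))%C with (Cprod1 f (S N)).
  rewrite Cmod_mult.
  apply Rmult_le_compat; auto using Cmod_ge_0.
Qed.

(** The partial products are bounded by [M], so the increments [Cprod1 f n * (f (S n) - 1)] form an
    absolutely convergent series, whose partial sums telescope. *)
Lemma Cprod1_ex_lim (f : nat -> C) (rho : nat -> R) :
  (forall n, Cmod (f (S n) - 1) <= rho n) -> ex_series rho ->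
  exists l, Cis_lim (Cprod1 f) l.
Proof.
intros Hf Hs.
assert (Hr0 : forall n, 0 <= rho n)
  by (intros n; apply Rle_trans with (2 := Hf n), Cmod_ge_0).
set (M := Rmax 1 (exp (Series rho))).
assert (HM : forall N, Cmod (Cprod1 f N) <= M).
{ intros [|N].
  - simpl; rewrite Cmod_1; apply Rmax_l.
  - apply Rle_trans with (2 := Rmax_r _ _).
    apply Rle_trans with (1 := Cmod_Cprod1_le f rho N Hf).
    destruct (sum_n_le_Series rho N Hr0 Hs) as [Hlt | Heq].
    + left; now apply exp_increasing.
    + rewrite Heq; apply Rle_refl. }
assert (Hd : ex_series (K := C_AbsRing) (V := C_CompleteNormedModule)
  (fun n => Cprod1 f (S n) - Cprod1 f n)%C).
{ apply ex_series_le with (fun n => M * rho n).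
  - intros n; change (Cmod (Cprod1 f (S n) - Cprod1 f n) <= M * rho n).
    replace (Cprod1 f (S n) - Cprod1 f n)%C with (Cprod1 f n * (f (S n) - 1))%C
      by (simpl; ring).
    rewrite Cmod_mult; apply Rmult_le_compat; auto using Cmod_ge_0.
  - apply (ex_series_scal_l M rho Hs). }
destruct Hd as [l Hl].
exists (1 + l)%C; apply is_lim_seq_incr_1.
apply Cis_lim_filterlim in Hl.
apply is_lim_seq_ext with (2 := Hl); intros n; f_equal.
assert (E : sum_n (G := C_AbelianMonoid) (fun n => Cprod1 f (S n) - Cprod1 f n)%C n
  = (Cprod1 f (S n) - 1)%C).
{ clear; induction n as [|n IH].
  - rewrite sum_O; reflexivity.
  - rewrite sum_Sn, IH; unfold plus; simpl; ring. }
etransitivity; [apply (f_equal (fun x => (x - l)%C) E) | ring].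
Qed.

(** A limit of nonzero partial products can still vanish. Convergence of the reciprocals excludes
    this, since the two limits multiply to 1. *)
Lemma Cprod1_lim_neq_0 (f : nat -> C) (l l' : C) :
  (forall n, f (S n) <> 0) ->
  Cis_lim (Cprod1 f) l -> Cis_lim (Cprod1 (fun n => / f n)%C) l' -> l <> 0.
Proof.
intros Hf Hl Hl' E; subst l.
assert (H : Cis_lim (fun _ => RtoC 1) (0 * l')).
{ apply Cis_lim_ext with (fun N => Cprod1 f N * Cprod1 (fun n => / f n) N)%C.
  - intros N; induction N as [|N IH]; simpl; [ring |].
    transitivity ((Cprod1 f N * Cprod1 (fun n => / f n) N)
                  * (f (S N) * / f (S N)))%C; [ring |].
    rewrite IH; field; apply Hf.
  - now apply Cis_lim_mult. }
apply (Cis_lim_unique _ _ _ (Cis_lim_const 1)) in H.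
rewrite Cmult_0_l in H; apply C1_nz, H.
Qed.

Lemma ex_series_pow_S (r : R) : 0 <= r < 1 -> ex_series (fun n => r ^ S n).
Proof.
intros Hr; apply (ex_series_incr_1 (fun n => r ^ n)), ex_series_geom.
rewrite Rabs_pos_eq; lra.
Qed.

Lemma pow_le_pow (r : R) (n m : nat) :
  0 <= r <= 1 -> (n <= m)%nat -> r ^ m <= r ^ n.
Proof.
intros Hr H; replace m with (n + (m - n))%nat by lia.
rewrite pow_add; rewrite <- (Rmult_1_r (r ^ n)) at 2.
apply Rmult_le_compat_l; [apply pow_le; lra |].
rewrite <- (pow1 (m - n)); apply pow_incr; lra.
Qed.

(** [s] is used as a sign: [-1] for Euler's product, [1] for the products of [1 + w^(e n)]. *)
Lemma Cprod1_powers_ex_lim (w : C) (s : C) (e : nat -> nat) :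
  Cmod w < 1 -> Cmod s <= 1 -> (forall n, (S n <= e (S n))%nat) ->
  exists l, Cis_lim (Cprod1 (fun n => 1 + s * Cpow w (e n))%C) l.
Proof.
intros Hw Hs He; apply Cprod1_ex_lim with (fun n => Cmod w ^ S n).
- intros n.
  replace (1 + s * Cpow w (e (S n)) - 1)%C with (s * Cpow w (e (S n)))%C by ring.
  rewrite Cmod_mult, Cmod_pow, <- (Rmult_1_l (_ ^ S n)).
  apply Rmult_le_compat; auto using Cmod_ge_0, pow_le.
  apply pow_le_pow; [split; [apply Cmod_ge_0 | lra] | apply He].
- apply ex_series_pow_S; split; [apply Cmod_ge_0 | exact Hw].
Qed.

Lemma Cmod_one_minus_pow (w : C) (n : nat) :
  Cmod w < 1 -> 1 - Cmod w <= Cmod (1 - Cpow w (S n)).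
Proof.
intros Hw.
generalize (Cmod_triangle (1 - Cpow w (S n)) (Cpow w (S n))).
replace (1 - Cpow w (S n) + Cpow w (S n))%C with (RtoC 1) by ring.
rewrite Cmod_1, Cmod_pow.
assert (Cmod w ^ S n <= Cmod w ^ 1); [| simpl in *; lra].
apply pow_le_pow; [split; [apply Cmod_ge_0 | lra] | lia].
Qed.

Lemma Euler_product_ex_lim (w : C) :
  Cmod w < 1 ->
  exists P : C, P <> 0 /\ Cis_lim (Cprod1 (fun n => 1 - Cpow w n)%C) P.
Proof.
intros Hw.
destruct (Cprod1_powers_ex_lim w (- (1)) (fun n => n) Hw) as [P HP].
{ rewrite Cmod_opp, Cmod_1; lra. }
{ intros n; lia. }
assert (HP' : Cis_lim (Cprod1 (fun n => 1 - Cpow w n)%C) P).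
{ apply Cis_lim_ext with (2 := HP); intros N; apply Cprod1_ext; intros n; ring. }
exists P; split; [| exact HP'].
assert (Hnz : forall n, (1 - Cpow w (S n))%C <> 0).
{ intros n H; generalize (Cmod_one_minus_pow w n Hw); rewrite H, Cmod_0; lra. }
(* The reciprocal product converges too, because [1 / (1 - w^n) - 1 = w^n / (1 - w^n)] is at most
   [|w|^n / (1 - |w|)]. *)
destruct (Cprod1_ex_lim (fun n => / (1 - Cpow w n))%C
  (fun n => / (1 - Cmod w) * Cmod w ^ S n)) as [P' HP''].
- intros n.
  replace (/ (1 - Cpow w (S n)) - 1)%C
    with (/ (1 - Cpow w (S n)) * Cpow w (S n))%C by (field; apply Hnz).
  rewrite Cmod_mult, Cmod_pow, Cmod_inv by apply Hnz.
  apply Rmult_le_compat_r; [apply pow_le, Cmod_ge_0 |].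
  apply Rinv_le_contravar; [lra | now apply Cmod_one_minus_pow].
- apply (ex_series_scal_l (/ (1 - Cmod w)) (fun n => Cmod w ^ S n)).
  apply ex_series_pow_S; split; [apply Cmod_ge_0 | exact Hw].
- exact (Cprod1_lim_neq_0 _ P P' Hnz HP' HP'').
Qed.

(** * Polar coordinates and the variable [q] *)

Definition expi (x : R) : C := (cos x, sin x).

Lemma expi_plus (x y : R) : expi (x + y) = (expi x * expi y)%C.
Proof.
unfold expi, Cmult; simpl; rewrite cos_plus, sin_plus; f_equal; ring.
Qed.

Lemma expi_0 : expi 0 = 1.
Proof.
unfold expi; now rewrite cos_0, sin_0.
Qed.

Lemma Cmod_expi (x : R) : Cmod (expi x) = 1.
Proof.
unfold Cmod, expi; simpl fst; simpl snd; rewrite Rplus_comm.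
rewrite <- !Rsqr_pow2, sin2_cos2; apply sqrt_1.
Qed.

Lemma expi_pow (x : R) (n : nat) : Cpow (expi x) n = expi (INR n * x).
Proof.
induction n as [|n IH].
- simpl INR; rewrite Rmult_0_l, expi_0; reflexivity.
- rewrite Cpow_S, IH, <- expi_plus, S_INR; f_equal; ring.
Qed.

Definition polar (r x : R) : C := (RtoC r * expi x)%C.

Lemma Cmod_polar (r x : R) : 0 <= r -> Cmod (polar r x) = r.
Proof.
intros Hr; unfold polar; rewrite Cmod_mult, Cmod_expi, Cmod_R, Rabs_pos_eq by easy.
ring.
Qed.

Lemma polar_pow (r x : R) (n : nat) :
  Cpow (polar r x) n = polar (r ^ n) (INR n * x).
Proof.
unfold polar; now rewrite Cpow_mult_l, expi_pow, RtoC_pow.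
Qed.

Lemma q_eq_polar (z : C) : q z = polar (exp (- (2 * PI * Im z))) (2 * PI * Re z).
Proof.
destruct z as [x y]; unfold q, Cexp, polar, expi, Cmult; simpl.
f_equal; rewrite ?Rmult_0_l, ?Rmult_0_r, ?Rmult_1_r, ?Rminus_0_r, ?Rplus_0_l, ?Rplus_0_r;
f_equal; f_equal; ring.
Qed.

Lemma q_double (z : C) : q (RtoC 2 * z) = Cpow (q z) 2.
Proof.
rewrite !q_eq_polar, polar_pow, <- Rpower_pow by apply exp_pos.
unfold Rpower; rewrite ln_exp; destruct z as [x y]; simpl.
f_equal; [f_equal |]; ring.
Qed.

Lemma Cmod_q_bounds (z : C) : upper_half_plane z -> 0 < Cmod (q z) < 1.
Proof.
intros Hz; rewrite q_eq_polar, Cmod_polar by (left; apply exp_pos).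
split; [apply exp_pos |].
rewrite <- exp_0; apply exp_increasing.
assert (0 < 2 * PI * Im z); [| lra].
apply Rmult_lt_0_compat; [generalize PI_RGT_0; lra | exact Hz].
Qed.

(** * [phi] and [psi] as infinite products *)

Lemma Delta_eq (z P : C) :
  Cis_lim (Cprod1 (fun n => 1 - Cpow (q z) n)%C) P ->
  Defs.Delta z = (q z * Cpow P 24)%C.
Proof.
intros HP; unfold Defs.Delta; f_equal; apply Cprod1_inf_eq.
apply Cis_lim_ext with (fun N => Cpow (Cprod1 (fun n => 1 - Cpow (q z) n)%C N) 24).
- intros N; symmetry; apply Cprod1_pow.
- now apply Cis_lim_pow.
Qed.

(** Even exponents reproduce the product in [w^2], which is the one in [Delta (2 z)]; only the odd
    exponents survive in [psi]. *)
Lemma Cprod1_even_odd (w : C) (N : nat) :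
  Cprod1 (fun n => 1 - Cpow w n)%C (2 * N) =
  (Cprod1 (fun n => 1 - Cpow (Cpow w 2) n)%C N
   * Cprod1 (fun n => 1 - Cpow w (2 * n - 1))%C N)%C.
Proof.
induction N as [|N IH]; [simpl; ring |].
replace (2 * S N)%nat with (S (S (2 * N))) by lia.
change (Cprod1 (fun n => 1 - Cpow w n) (2 * N) * (1 - Cpow w (S (2 * N)))
        * (1 - Cpow w (S (S (2 * N))))
        = Cprod1 (fun n => 1 - Cpow (Cpow w 2) n) N * (1 - Cpow (Cpow w 2) (S N))
        * (Cprod1 (fun n => 1 - Cpow w (2 * n - 1)) N
           * (1 - Cpow w (2 * S N - 1))))%C.
rewrite IH, <- Cpow_mult_r.
replace (2 * S N - 1)%nat with (S (2 * N)) by lia.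
replace (2 * S N)%nat with (S (S (2 * N))) by lia; ring.
Qed.

(** Since [1 - w^(2n) = (1 - w^n) (1 + w^n)], the quotient [Delta (2 z) / Delta z] keeps only the
    factors [1 + w^n]. *)
Lemma Cprod1_square (w : C) (N : nat) :
  Cprod1 (fun n => 1 - Cpow (Cpow w 2) n)%C N =
  (Cprod1 (fun n => 1 - Cpow w n)%C N * Cprod1 (fun n => 1 + Cpow w n)%C N)%C.
Proof.
rewrite <- Cprod1_mult; apply Cprod1_ext; intros n.
rewrite <- Cpow_mult_r, Nat.mul_comm, Cpow_mult_r.
change (Cpow (Cpow w (S n)) 2) with (Cpow w (S n) * (Cpow w (S n) * 1))%C; ring.
Qed.

(** The exponent 24 stays outside: the product is studied with one factor per exponent, and the 24th
    power is taken at the end. *)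
Definition is_exp_prod (e : nat -> nat) (w l : C) : Prop :=
  Cis_lim (Cprod1 (fun n => 1 + Cpow w (e n))%C) l.

Lemma eventually_double : filterlim (fun n => (2 * n)%nat) eventually eventually.
Proof.
intros P [N HN]; exists N; intros n Hn; apply HN; lia.
Qed.

Lemma phi_eq_prod (z : C) : upper_half_plane z ->
  exists l, is_exp_prod (fun n => n) (q z) l /\ phi z = (q z * Cpow l 24)%C.
Proof.
intros Hz; pose proof (Cmod_q_bounds z Hz) as Hq.
destruct (Euler_product_ex_lim (q z)) as [P [HP0 HP]]; [lra |].
destruct (Euler_product_ex_lim (Cpow (q z) 2)) as [P2 [HP20 HP2]].
{ rewrite Cmod_pow; simpl; nra. }
destruct (Cprod1_powers_ex_lim (q z) 1 (fun n => n)) as [l Hl].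
{ lra. } { rewrite Cmod_1; lra. } { intros n; lia. }
assert (Hl' : is_exp_prod (fun n => n) (q z) l).
{ apply Cis_lim_ext with (2 := Hl); intros N; apply Cprod1_ext; intros n; ring. }
exists l; split; [exact Hl' |].
assert (E : P2 = (P * l)%C).
{ apply (Cis_lim_unique _ _ _ HP2).
  apply Cis_lim_ext with (2 := Cis_lim_mult _ _ _ _ HP Hl').
  intros N; symmetry; apply Cprod1_square. }
assert (Hq0 : q z <> 0) by (intros H; rewrite H, Cmod_0 in Hq; lra).
assert (Hl0 : l <> 0) by (intros H; apply HP20; rewrite E, H; ring).
unfold phi, psi.
rewrite (Delta_eq z P HP), (Delta_eq (2 * z) P2), q_double, E
  by now rewrite q_double.
rewrite Cpow_mult_l.
set (p := Cpow P 24); set (m := Cpow l 24).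
assert (Hp : p <> 0) by now apply Cpow_nz.
assert (Hm : m <> 0) by now apply Cpow_nz.
change (Cpow (q z) 2) with (q z * (q z * 1))%C; field; repeat split; assumption.
Qed.

(** The argument [- q z] turns [1 - q^(2n-1)] into [1 + (-q)^(2n-1)], so that [psi] and [phi] are
    governed by the same kind of product. *)
Lemma psi_eq_prod (z : C) : upper_half_plane z ->
  exists l, is_exp_prod (fun n => 2 * n - 1)%nat (- q z) l
    /\ psi z = (Cpow l 24 / q z)%C.
Proof.
intros Hz; pose proof (Cmod_q_bounds z Hz) as Hq.
destruct (Euler_product_ex_lim (q z)) as [P [HP0 HP]]; [lra |].
destruct (Euler_product_ex_lim (Cpow (q z) 2)) as [P2 [HP20 HP2]].
{ rewrite Cmod_pow; simpl; nra. }
destruct (Cprod1_powers_ex_lim (- q z) 1 (fun n => 2 * n - 1)%nat) as [l Hl].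
{ rewrite Cmod_opp; lra. } { rewrite Cmod_1; lra. } { intros n; lia. }
assert (Hl' : is_exp_prod (fun n => 2 * n - 1)%nat (- q z) l).
{ apply Cis_lim_ext with (2 := Hl); intros N; apply Cprod1_ext; intros n; ring. }
assert (Hodd : forall N, Cprod1 (fun n => 1 - Cpow (q z) (2 * n - 1))%C N
  = Cprod1 (fun n => 1 + Cpow (- q z) (2 * n - 1))%C N).
{ intros N; apply Cprod1_ext; intros n.
  replace (2 * S n - 1)%nat with (S (2 * n)) by lia.
  rewrite !Cpow_S, !Cpow_mult_r.
  replace (Cpow (- q z) 2) with (Cpow (q z) 2); [ring |].
  change (q z * (q z * 1) = - q z * (- q z * 1))%C; ring. }
exists l; split; [exact Hl' |].
assert (E : P = (P2 * l)%C).
(* [Cprod1_even_odd] concerns partial products of even length, so the limit is read off along that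
   subsequence. *)
{ apply (Cis_lim_unique _ _ _ (Cis_lim_subseq _ _ _ eventually_double HP)).
  apply Cis_lim_ext with (2 := Cis_lim_mult _ _ _ _ HP2 Hl').
  intros N; rewrite <- Hodd; symmetry; apply Cprod1_even_odd. }
assert (Hq0 : q z <> 0) by (intros H; rewrite H, Cmod_0 in Hq; lra).
unfold psi.
rewrite (Delta_eq z P HP), (Delta_eq (2 * z) P2), q_double, E
  by now rewrite q_double.
rewrite Cpow_mult_l.
set (p := Cpow P2 24); set (m := Cpow l 24).
assert (Hp : p <> 0) by now apply Cpow_nz.
change (Cpow (q z) 2) with (q z * (q z * 1))%C; field; repeat split; assumption.
Qed.

(** * Power series coefficients of the products *)

Definition is_Cpseries (c : nat -> R) (w l : C) : Prop :=
  is_series (K := C_AbsRing) (V := C_NormedModule)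
    (fun k => RtoC (c k) * Cpow w k)%C l.

(** This is all that the analysis uses about [phi] and [psi]. Having every radius in [(0, 1)] gives
    absolute convergence and lets the circle of integration move with [n]. *)
Definition prod_coeffs (e : nat -> nat) (c : nat -> R) : Prop :=
  forall r x, 0 < r < 1 -> exists l,
    is_exp_prod e (polar r x) l /\ is_Cpseries c (polar r x) (Cpow l 24).

Lemma polar_eq_q (r x : R) : 0 < r < 1 ->
  exists z, upper_half_plane z /\ q z = polar r x.
Proof.
intros Hr; exists (x / (2 * PI), - ln r / (2 * PI)); split.
- unfold upper_half_plane; simpl.
  apply Rdiv_lt_0_compat; [| generalize PI_RGT_0; lra].
  generalize (ln_increasing r 1); rewrite ln_1; lra.
- rewrite q_eq_polar; simpl; f_equal; [| field; apply PI_neq0].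
  replace (- (2 * PI * (- ln r / (2 * PI)))) with (ln r) by (field; apply PI_neq0).
  apply exp_ln; lra.
Qed.

(** Dividing by the extra factor [q z] shifts the index by one. *)
Lemma phi_coeffs (b : nat -> Z) :
  (forall z, upper_half_plane z -> is_qseries b z (phi z)) ->
  prod_coeffs (fun n => n) (fun n => IZR (b (S n))).
Proof.
intros hb r x Hr; destruct (polar_eq_q r x Hr) as [z [Hz Hqz]].
destruct (phi_eq_prod z Hz) as [l [Hl Hphi]].
exists l; rewrite <- Hqz; split; [exact Hl |].
specialize (hb z Hz); rewrite Hphi in hb.
pose proof (Cmod_q_bounds z Hz) as Hq.
assert (Hq0 : q z <> 0) by (intros H; rewrite H, Cmod_0 in Hq; lra).
apply (is_series_scal (K := C_AbsRing) (V := C_NormedModule) (/ q z)%C) in hb.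
change (scal (/ q z)%C (q z * Cpow l 24)%C)
  with (/ q z * (q z * Cpow l 24))%C in hb.
replace (/ q z * (q z * Cpow l 24))%C with (Cpow l 24) in hb
  by (generalize (Cpow l 24); intros; field; exact Hq0).
apply is_series_ext with (2 := hb); intros n.
change (/ q z * (RtoC (IZR (b (S n))) * (q z * Cpow (q z) n))
   = RtoC (IZR (b (S n))) * Cpow (q z) n)%C.
field; exact Hq0.
Qed.

(* The coefficients of [q psi], in the variable [- q]. *)
Definition psi_sign_coeffs (s : nat -> Z) (n : nat) : R :=
  match n with
  | O => 1
  | S O => 24
  | S (S k) => (-1) ^ k * IZR (s (S k))
  end.

Lemma psi_coeffs (s : nat -> Z) :
  (forall z, upper_half_plane z -> exists v, is_qseries s z v /\
      psi z = (/ q z - RtoC 24 + v)%C) ->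
  prod_coeffs (fun n => 2 * n - 1)%nat (psi_sign_coeffs s).
Proof.
(* The shift by [PI] makes the given point equal to [- q z], the argument of the product. *)
intros hs r x Hr; destruct (polar_eq_q r (x + PI) Hr) as [z [Hz Hqz]].
assert (Hp : polar r x = (- q z)%C).
{ rewrite Hqz; unfold polar, expi, Cmult, Copp; simpl.
  rewrite neg_cos, neg_sin; f_equal; ring. }
destruct (psi_eq_prod z Hz) as [l [Hl Hpsi]].
exists l; rewrite Hp; split; [exact Hl |].
destruct (hs z Hz) as [v [Hv Hvpsi]]; rewrite Hpsi in Hvpsi.
pose proof (Cmod_q_bounds z Hz) as Hq.
assert (Hq0 : q z <> 0) by (intros H; rewrite H, Cmod_0 in Hq; lra).
assert (E : Cpow l 24 = (1 - 24 * q z + q z * v)%C).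
{ replace (Cpow l 24) with (q z * (Cpow l 24 / q z))%C
    by (generalize (Cpow l 24); intros; field; exact Hq0).
  rewrite Hvpsi; field; exact Hq0. }
rewrite E.
apply (is_series_scal (K := C_AbsRing) (V := C_NormedModule) (q z)) in Hv.
(* The two terms set apart, [1] and [24 * (- q z)], come from [q^-1 - 24]; the rest starts at index
   2, where [(-1)^(n+2) = (-1)^n]. *)
apply is_series_decr_1, is_series_decr_1.
replace (plus (plus _ _) _) with (q z * v)%C.
- apply is_series_ext with (2 := Hv); intros n.
  change (q z * (RtoC (IZR (s (S n))) * Cpow (q z) (S n))
   = RtoC ((-1) ^ n * IZR (s (S n))) * Cpow (- q z) (S (S n)))%C.
  replace (- q z)%C with (RtoC (-1) * q z)%C by ring.
  rewrite Cpow_mult_l, <- RtoC_pow, !RtoC_mult, !Cpow_S.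
  replace ((-1) ^ S (S n)) with ((-1) ^ n) by (simpl; ring).
  assert (S1 : (RtoC ((-1) ^ n) * RtoC ((-1) ^ n) = 1)%C).
  { rewrite <- RtoC_mult, <- Rpow_mult_distr; f_equal.
    replace (-1 * -1) with 1 by ring; apply pow1. }
  transitivity ((RtoC ((-1) ^ n) * RtoC ((-1) ^ n)) *
    (q z * (RtoC (IZR (s (S n))) * (q z * Cpow (q z) n))))%C;
    [rewrite S1; ring | ring].
- change (q z * v = (1 - 24 * q z + q z * v) + - (RtoC 1 * 1)
    + - (RtoC 24 * (- q z * 1)))%C; ring.
Qed.

(** * Coefficients as circle integrals *)

Lemma is_Cpseries_Cis_lim (c : nat -> R) (w l : C) :
  is_Cpseries c w l ->
  Cis_lim (sum_n (G := C_AbelianMonoid) (fun k => RtoC (c k) * Cpow w k)%C) l.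
Proof.
intros H; apply Cis_lim_filterlim, H.
Qed.

Lemma Csum_n_Sn (a : nat -> C) (n : nat) :
  sum_n (G := C_AbelianMonoid) a (S n)
  = (sum_n (G := C_AbelianMonoid) a n + a (S n))%C.
Proof. exact (sum_Sn (G := C_AbelianMonoid) a n). Qed.

Lemma Rsum_n_Sn (a : nat -> R) (n : nat) :
  sum_n a (S n) = sum_n a n + a (S n).
Proof. exact (sum_Sn a n). Qed.

Lemma Cpseries_terms_lim_0 (c : nat -> R) (r : R) (l : C) : 0 <= r ->
  is_Cpseries c (polar r 0) l -> is_lim_seq (fun n => Rabs (c n) * r ^ n) 0.
Proof.
intros Hr H; apply is_Cpseries_Cis_lim in H.
apply is_lim_seq_incr_1.
assert (H1 := Cis_lim_minus _ _ _ _ (Cis_lim_subseq _ _ S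
  (eventually_subseq S (fun n => Nat.lt_succ_diag_r (S n))) H) H).
replace (l - l)%C with (RtoC 0) in H1 by ring.
apply Cis_lim_Cmod in H1; rewrite Cmod_0 in H1.
apply is_lim_seq_ext with (2 := H1); intros n.
rewrite Csum_n_Sn.
match goal with |- Cmod (?a + ?b - ?a) = _ =>
  replace (a + b - a)%C with b by ring end.
rewrite Cmod_mult, Cmod_R, Cmod_pow, Cmod_polar; easy.
Qed.

(** Abel's lemma: the terms are bounded at the larger radius [r'], hence dominated at [r] by a
    geometric series of ratio [r / r']. *)
Lemma Cpseries_abs_conv (c : nat -> R) :
  (forall r, 0 < r < 1 -> exists l, is_Cpseries c (polar r 0) l) ->
  forall r, 0 < r < 1 -> ex_series (fun n => Rabs (c n) * r ^ n).
Proof.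
intros Hc r Hr; set (r' := (1 + r) / 2).
destruct (Hc r') as [l Hl]; [unfold r'; lra |].
apply Cpseries_terms_lim_0 in Hl; [| unfold r'; lra].
apply is_lim_seq_Reals in Hl; destruct (Hl 1 Rlt_0_1) as [N HN].
apply ex_series_incr_n with (n := N).
apply (ex_series_le (K := R_AbsRing) (V := R_CompleteNormedModule))
  with (fun n => (r / r') ^ (N + n)).
- intros n; change (Rabs (Rabs (c (N + n)%nat) * r ^ (N + n)) <= (r / r') ^ (N + n)).
  specialize (HN (N + n)%nat (Nat.le_add_r _ _)); unfold R_dist in HN.
  rewrite Rminus_0_r in HN.
  assert (Hpr : 0 < r' ^ (N + n)) by (apply pow_lt; unfold r'; lra).
  assert (Hpr' : 0 < r ^ (N + n)) by (apply pow_lt; lra).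
  rewrite Rabs_pos_eq in HN |- *
    by (apply Rmult_le_pos; [apply Rabs_pos | now left]).
  unfold Rdiv; rewrite Rpow_mult_distr, pow_inv.
  rewrite Rmult_comm; apply Rmult_le_compat_l; [now left |].
  apply Rmult_le_reg_r with (1 := Hpr); rewrite Rinv_l; lra.
- apply ex_series_incr_n with (a := fun n => (r / r') ^ n), ex_series_geom.
  rewrite Rabs_pos_eq by (apply Rdiv_le_0_compat; unfold r'; lra).
  apply (Rdiv_lt_1 r r'); unfold r'; lra.
Qed.

Lemma is_RInt_cos_shift (k N : nat) :
  is_RInt (fun x => cos ((INR k - INR N) * x)) (- PI) PI
    (if Nat.eq_dec k N then 2 * PI else 0).
Proof.
destruct (Nat.eq_dec k N) as [<- | Hk].
- apply is_RInt_ext with (fun _ => 1).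
  + intros x _; rewrite Rminus_diag, Rmult_0_l, cos_0; reflexivity.
  + replace (2 * PI) with (scal (PI - - PI) 1)
      by (unfold scal; simpl; unfold mult; simpl; ring).
    apply (is_RInt_const (V := R_NormedModule)).
- assert (Hd : INR k - INR N <> 0)
    by (intros H; apply Hk, INR_eq; lra).
  set (d := INR k - INR N) in *.
  assert (Hs : sin (d * PI) = 0).
  { unfold d; rewrite Rmult_minus_distr_r, sin_minus.
    assert (Hn : forall n, sin (INR n * PI) = 0).
    { intros n; apply sin_eq_0_1; exists (Z.of_nat n); now rewrite <- INR_IZR_INZ. }
    rewrite !Hn; ring. }
  replace 0 with (minus (sin (d * PI) / d) (sin (d * - PI) / d)).
  + apply (is_RInt_derive (V := R_CompleteNormedModule) (fun x => sin (d * x) / d)).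
    * intros x _; auto_derive; [easy | field; exact Hd].
    * intros x _; apply (ex_derive_continuous (V := R_NormedModule)).
      auto_derive; easy.
  + replace (d * - PI) with (- (d * PI)) by ring.
    rewrite sin_neg, Hs; unfold minus, plus, opp; simpl; field; exact Hd.
Qed.

Lemma Re_sum_n_shift (c : nat -> R) (r x : R) (N K : nat) :
  Re (sum_n (G := C_AbelianMonoid) (fun k => RtoC (c k) * Cpow (polar r x) k)%C K
      * expi (- (INR N * x)))
  = sum_n (fun k => c k * r ^ k * cos ((INR k - INR N) * x)) K.
Proof.
assert (Ht : forall k, Re (RtoC (c k) * Cpow (polar r x) k * expi (- (INR N * x)))
  = c k * r ^ k * cos ((INR k - INR N) * x)).
{ intros k; rewrite polar_pow; unfold polar.
  replace (RtoC (c k) * (RtoC (r ^ k) * expi (INR k * x)) * expi (- (INR N * x)))%C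
    with (RtoC (c k * r ^ k) * expi ((INR k - INR N) * x))%C.
  - simpl; ring.
  - replace ((INR k - INR N) * x) with (INR k * x + - (INR N * x)) by ring.
    rewrite expi_plus, RtoC_mult; ring. }
induction K as [|K IH].
- rewrite !sum_O; apply Ht.
- rewrite Csum_n_Sn, sum_Sn, <- IH, <- Ht.
  rewrite Cmult_plus_distr_r; reflexivity.
Qed.

Lemma is_RInt_trig_sum (a : nat -> R) (N K : nat) :
  is_RInt (fun x => sum_n (fun k => a k * cos ((INR k - INR N) * x)) K) (- PI) PI
    (sum_n (fun k => a k * (if Nat.eq_dec k N then 2 * PI else 0)) K).
Proof.
induction K as [|K IH].
- rewrite sum_O; apply is_RInt_ext with (fun x => scal (a O) (cos ((INR 0 - INR N) * x))).
  + intros x _; now rewrite sum_O.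
  + apply (is_RInt_scal (V := R_NormedModule)), is_RInt_cos_shift.
- rewrite Rsum_n_Sn.
  apply is_RInt_ext with
    (fun x => plus (sum_n (fun k => a k * cos ((INR k - INR N) * x)) K)
      (scal (a (S K)) (cos ((INR (S K) - INR N) * x)))).
  + intros x _; now rewrite Rsum_n_Sn.
  + apply (is_RInt_plus (V := R_NormedModule)); [exact IH |].
    apply (is_RInt_scal (V := R_NormedModule)), is_RInt_cos_shift.
Qed.

Lemma trig_sum_lim (a : nat -> R) (N : nat) :
  is_lim_seq (sum_n (fun k => a k * (if Nat.eq_dec k N then 2 * PI else 0)))
    (2 * PI * a N).
Proof.
apply is_lim_seq_ext_loc with (fun _ => 2 * PI * a N); [| apply is_lim_seq_const].
assert (H0 : forall K, (K < N)%nat ->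
  sum_n (fun k => a k * (if Nat.eq_dec k N then 2 * PI else 0)) K = 0).
{ intros K; induction K as [|K IH]; intros HK; rewrite ?sum_O, ?Rsum_n_Sn.
  - destruct (Nat.eq_dec 0 N); [lia | apply Rmult_0_r].
  - rewrite IH by lia; destruct (Nat.eq_dec (S K) N); [lia |]; rewrite Rmult_0_r; apply Rplus_0_l. }
exists N; intros K HK; induction HK as [|K HK IH].
- destruct N as [|N].
  + rewrite sum_O; simpl; apply Rmult_comm.
  + rewrite Rsum_n_Sn, H0 by lia; destruct (Nat.eq_dec (S N) (S N)); [| easy].
    rewrite Rplus_0_l; apply Rmult_comm.
- rewrite Rsum_n_Sn, <- IH; destruct (Nat.eq_dec (S K) N); [lia |].
  rewrite Rmult_0_r; symmetry; apply Rplus_0_r.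
Qed.

(** The bound does not involve the angle [x]: this is the uniform convergence that allows termwise
    integration over the circle. *)
Lemma Cpseries_tail (c : nat -> R) (r x : R) (l : C) (K : nat) :
  0 <= r -> ex_series (fun n => Rabs (c n) * r ^ n) ->
  is_Cpseries c (polar r x) l ->
  Cmod (sum_n (G := C_AbelianMonoid) (fun k => RtoC (c k) * Cpow (polar r x) k)%C K - l)
  <= Series (fun n => Rabs (c n) * r ^ n) - sum_n (fun n => Rabs (c n) * r ^ n) K.
Proof.
intros Hr Hs Hl; apply is_Cpseries_Cis_lim in Hl.
set (u := sum_n (G := C_AbelianMonoid) _) in *.
set (v := sum_n (fun n => Rabs (c n) * r ^ n)).
assert (Hd : forall m, Cmod (u K - u (m + K)%nat) <= v (m + K)%nat - v K).
{ induction m as [|m IH].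
  - simpl; replace (u K - u K)%C with (RtoC 0) by ring; rewrite Cmod_0; lra.
  - change (S m + K)%nat with (S (m + K)).
    unfold u at 2, v at 1; rewrite Csum_n_Sn, Rsum_n_Sn; fold u v.
    match goal with |- Cmod (?a - (?b + ?d)) <= _ =>
      replace (a - (b + d))%C with ((a - b) + - d)%C by ring;
      apply Rle_trans with (1 := Cmod_triangle (a - b) (- d)) end.
    rewrite Cmod_opp, Cmod_mult, Cmod_R, Cmod_pow, Cmod_polar by easy.
    lra. }
apply (is_lim_seq_le (fun m => Cmod (u K - u (m + K)%nat)) (fun m => v (m + K)%nat - v K)
  (Cmod (u K - l)) (Series (fun n => Rabs (c n) * r ^ n) - v K) Hd).
- apply Cis_lim_Cmod, Cis_lim_minus; [apply Cis_lim_const |].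
  apply (is_lim_seq_incr_n (fun n => Cmod (u n - l)) K), Hl.
- apply is_lim_seq_minus'; [| apply is_lim_seq_const].
  apply (is_lim_seq_incr_n v K), (Series_correct _ Hs).
Qed.

(** Orthogonality of the cosines singles out one term after termwise integration. Since [c] is real,
    taking real parts loses nothing and real integrals suffice. *)
Lemma Cauchy_coefficient (c : nat -> R) (F : R -> C) (r : R) (N : nat) :
  0 <= r -> ex_series (fun n => Rabs (c n) * r ^ n) ->
  (forall x, is_Cpseries c (polar r x) (F x)) ->
  is_RInt (fun x => Re (F x * expi (- (INR N * x)))) (- PI) PI
    (2 * PI * (c N * r ^ N)).
Proof.
intros Hr Hs HF.
set (a := fun k => c k * r ^ k).
destruct (filterlim_RInt (V := R_CompleteNormedModule)
  (fun K x => sum_n (fun k => a k * cos ((INR k - INR N) * x)) K) (- PI) PI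
  eventually _ (fun x => Re (F x * expi (- (INR N * x))))
  (sum_n (fun k => a k * (if Nat.eq_dec k N then 2 * PI else 0))))
  as [If [H1 H2]].
- intros K; apply is_RInt_trig_sum.
- apply filterlim_locally; intros eps.
  destruct (proj1 (is_lim_seq_Reals _ _) (Series_correct _ Hs) eps (cond_pos eps))
    as [K0 HK0].
  exists K0; intros K HK x.
  change (Rabs (sum_n (fun k => a k * cos ((INR k - INR N) * x)) K
     - Re (F x * expi (- (INR N * x)))) < eps).
  unfold a; rewrite <- Re_sum_n_shift.
  match goal with |- Rabs (Re ?y - Re ?z) < _ =>
    replace (Re y - Re z) with (Re (y - z)) by (simpl; ring) end.
  apply Rle_lt_trans with (1 := re_le_Cmod _).
  match goal with |- Cmod (?y * ?e - ?z * ?e) < _ =>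
    replace (y * e - z * e)%C with ((y - z) * e)%C by ring end.
  rewrite Cmod_mult, Cmod_expi, Rmult_1_r.
  apply Rle_lt_trans with (1 := Cpseries_tail c r x (F x) K Hr Hs (HF x)).
  specialize (HK0 K HK); unfold R_dist in HK0.
  rewrite Rabs_minus_sym in HK0; apply Rle_lt_trans with (2 := HK0), Rle_abs.
- replace (2 * PI * (c N * r ^ N)) with If; [exact H2 |].
  apply (filterlim_locally_unique (K := R_AbsRing) (V := R_NormedModule) _ _ _ H1).
  exact (trig_sum_lim a N).
Qed.

(** * Characteristic functions of Bernoulli variables *)

Lemma nonneg_of_deriv (f df : R -> R) (x : R) :
  (forall y, 0 <= y -> is_derive f y (df y)) ->
  (forall y, 0 <= y -> 0 <= df y) -> f 0 = 0 -> 0 <= x -> 0 <= f x.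
Proof.
intros Hd Hdf H0 Hx.
destruct (MVT_gen f 0 x df) as [c [Hc E]];
  rewrite ?Rmin_left, ?Rmax_right in * by lra.
- intros y Hy; apply Hd; lra.
- intros y Hy; apply continuity_pt_filterlim.
  apply (ex_derive_continuous (V := R_NormedModule) f); eexists; apply Hd; lra.
- assert (0 <= df c) by (apply Hdf; lra); rewrite H0 in E; nra.
Qed.

(** Repeated integration: each inequality is the derivative of the next, starting from
    [1 - cos y >= 0]. *)
Lemma sin_Taylor_pos (x : R) : 0 <= x -> x - x ^ 3 / 6 <= sin x <= x.
Proof.
intros Hx.
assert (H1 : forall y, 0 <= y -> 0 <= y - sin y).
{ intros y Hy; apply (nonneg_of_deriv (fun y => y - sin y) (fun y => 1 - cos y));
    [intros; auto_derive; [easy | ring] | intros z _; generalize (COS_bound z); lra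
    | rewrite sin_0; ring | exact Hy]. }
assert (H2 : forall y, 0 <= y -> 0 <= cos y - 1 + y ^ 2 / 2).
{ intros y Hy; apply (nonneg_of_deriv (fun y => cos y - 1 + y ^ 2 / 2) (fun y => y - sin y));
    [intros; auto_derive; [easy | field] | exact H1 | rewrite cos_0; field | exact Hy]. }
assert (H3 : 0 <= sin x - x + x ^ 3 / 6).
{ apply (nonneg_of_deriv (fun y => sin y - y + y ^ 3 / 6) (fun y => cos y - 1 + y ^ 2 / 2));
    [intros; auto_derive; [easy | field] | exact H2 | rewrite sin_0; field | exact Hx]. }
specialize (H1 x Hx); lra.
Qed.

Lemma cos_Taylor_pos (x : R) : 0 <= x ->
  1 - x ^ 2 / 2 <= cos x <= 1 - x ^ 2 / 2 + x ^ 3 / 6.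
Proof.
intros Hx.
assert (H2 : forall y, 0 <= y -> 0 <= cos y - 1 + y ^ 2 / 2).
{ intros y Hy; apply (nonneg_of_deriv (fun y => cos y - 1 + y ^ 2 / 2) (fun y => y - sin y));
    [intros; auto_derive; [easy | field] | | rewrite cos_0; field | exact Hy].
  intros z Hz; generalize (sin_Taylor_pos z Hz); lra. }
assert (H3 : forall y, 0 <= y -> 0 <= sin y - y + y ^ 2 / 2).
{ intros y Hy; apply (nonneg_of_deriv (fun y => sin y - y + y ^ 2 / 2) (fun y => cos y - 1 + y));
    [intros; auto_derive; [easy | field] | | rewrite sin_0; field | exact Hy].
  intros z Hz; apply (nonneg_of_deriv (fun y => cos y - 1 + y) (fun y => 1 - sin y));
    [intros; auto_derive; [easy | field] | | rewrite cos_0; field | exact Hz].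
  intros y' _; generalize (SIN_bound y'); lra. }
assert (H4 : 0 <= 1 - x ^ 2 / 2 + x ^ 3 / 6 - cos x).
{ apply (nonneg_of_deriv (fun x => 1 - x ^ 2 / 2 + x ^ 3 / 6 - cos x)
    (fun y => sin y - y + y ^ 2 / 2));
    [intros; auto_derive; [easy | field] | exact H3 | rewrite cos_0; field | exact Hx]. }
specialize (H2 x Hx); lra.
Qed.

Lemma Cmod_le_Rabs (z : C) : Cmod z <= Rabs (Re z) + Rabs (Im z).
Proof.
destruct z as [x y]; unfold Re, Im, fst, snd.
replace (x, y) with (RtoC x + RtoC y * Ci)%C
  by (unfold RtoC, Ci, Cplus, Cmult; simpl; f_equal; ring).
apply Rle_trans with (1 := Cmod_triangle _ _).
rewrite Cmod_mult, Cmod_Ci, !Cmod_R; lra.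
Qed.

Lemma expi_Taylor2 (x : R) :
  Cmod (expi x - (1 - x ^ 2 / 2, x)) <= Rabs x ^ 3 / 3.
Proof.
apply Rle_trans with (1 := Cmod_le_Rabs _).
unfold expi; simpl fst; simpl snd; unfold Re, Im, fst, snd, Cminus, Cplus, Copp; simpl fst; simpl snd.
assert (Hpos : forall y, 0 <= y ->
  Rabs (cos y + - (1 - y ^ 2 / 2)) + Rabs (sin y + - y) <= y ^ 3 / 3).
{ intros y Hy; generalize (sin_Taylor_pos y Hy) (cos_Taylor_pos y Hy); intros Hs Hc.
  rewrite (Rabs_pos_eq (cos y + _)), Rabs_left1 by lra; lra. }
destruct (Rle_dec 0 x) as [Hx | Hx].
- rewrite (Rabs_pos_eq x) by exact Hx; apply (Hpos x Hx).
- assert (Hx' : 0 <= - x) by lra.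
  generalize (Hpos (- x) Hx'); rewrite cos_neg, sin_neg, (Rabs_left1 x) by lra.
  replace (- sin x + - - x) with (- (sin x + - x)) by ring; rewrite Rabs_Ropp.
  replace ((- x) ^ 2) with (x ^ 2) by ring; easy.
Qed.

Lemma Cmod_expi_minus_1 (x : R) : Cmod (expi x - 1) <= 2 * Rabs x.
Proof.
apply Rle_trans with (1 := Cmod_le_Rabs _).
unfold expi, Re, Im, fst, snd, Cminus, Cplus, Copp, RtoC; simpl fst; simpl snd.
assert (Hpos : forall y, 0 <= y -> Rabs (cos y + - (1)) + Rabs (sin y + - 0) <= 2 * y).
{ intros y Hy.
  assert (H1 : 0 <= y - 1 + cos y).
  { apply (nonneg_of_deriv (fun y => y - 1 + cos y) (fun y => 1 - sin y));
      [intros; auto_derive; [easy | field] | intros z _; generalize (SIN_bound z); lra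
      | rewrite cos_0; field | exact Hy]. }
  assert (H2 : 0 <= y + sin y).
  { apply (nonneg_of_deriv (fun y => y + sin y) (fun y => 1 + cos y));
      [intros; auto_derive; [easy | field] | intros z _; generalize (COS_bound z); lra
      | rewrite sin_0; field | exact Hy]. }
  generalize (sin_Taylor_pos y Hy) (COS_bound y); intros Hs Hc.
  rewrite (Rabs_left1 (cos y + _)) by lra.
  assert (Rabs (sin y + - 0) <= y); [apply Rabs_le; lra | lra]. }
destruct (Rle_dec 0 x) as [Hx | Hx].
- rewrite (Rabs_pos_eq x) by exact Hx; apply (Hpos x Hx).
- assert (Hx' : 0 <= - x) by lra.
  generalize (Hpos (- x) Hx'); rewrite cos_neg, sin_neg, (Rabs_left1 x) by lra.
  replace (- sin x + - 0) with (- (sin x + - 0)) by ring; now rewrite Rabs_Ropp.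
Qed.

Lemma Cmod_triang_inv (x y z : C) : Cmod (x - z) <= Cmod (x - y) + Cmod (y - z).
Proof.
replace (x - z)%C with ((x - y) + (y - z))%C by ring; apply Cmod_triangle.
Qed.

(** The quadratic bound comes from [exp (- v) <= 1 / (1 + v)]; the linear one is better once
    [v > 1]. *)
Lemma exp_neg_Taylor1 (v : R) : 0 <= v -> 0 <= exp (- v) - 1 + v <= Rmin v (v ^ 2).
Proof.
intros Hv; generalize (exp_ineq1_le (- v)); intros H1; split; [lra |].
assert (H2 : exp (- v) <= 1) by (rewrite <- exp_0; apply exp_le; lra).
apply Rmin_glb; [lra |].
assert (H3 : exp (- v) * (1 + v) <= 1).
{ replace 1 with (exp (- v) * exp v) at 2
    by (rewrite <- exp_plus, Rplus_opp_l; apply exp_0).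
  apply Rmult_le_compat_l; [left; apply exp_pos | apply exp_ineq1_le]. }
nra.
Qed.

(** After centring, the variable takes the values [1 - p] and [- p] and has mean 0, so its
    characteristic function and the Gaussian of equal variance both differ from [1 - v] by at most
    [p |a|^3]. Keeping the factor [p] matters: for [p = fermi (m t)] it makes the errors summable
    over the exponents. *)
Lemma bernoulli_char_estimate (p a : R) : 0 <= p <= 1 ->
  Cmod ((1 + RtoC p * (expi a - 1)) * expi (- (p * a))
        - RtoC (exp (- (p * (1 - p) * a ^ 2 / 2)))) <= 2 * (p * Rabs a ^ 3).
Proof.
intros Hp.
set (v := p * (1 - p) * a ^ 2 / 2).
assert (Ha : 0 <= Rabs a) by apply Rabs_pos.
assert (E : ((1 + RtoC p * (expi a - 1)) * expi (- (p * a)))%C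
  = (RtoC (1 - p) * expi (- (p * a)) + RtoC p * expi ((1 - p) * a))%C).
{ replace ((1 - p) * a) with (a + - (p * a)) by ring.
  rewrite expi_plus, RtoC_minus; ring. }
rewrite E; clear E.
set (T := (fun x => (1 - x ^ 2 / 2, x)) : R -> C).
assert (E : (RtoC (1 - p) * T (- (p * a))%R + RtoC p * T ((1 - p) * a)%R)%C = RtoC (1 - v)).
{ unfold T, v, RtoC, Cplus, Cmult; simpl; f_equal; field. }
apply Rle_trans with (1 := Cmod_triang_inv _ (RtoC (1 - v)) _).
apply Rle_trans with (p * Rabs a ^ 3 + p * Rabs a ^ 3); [apply Rplus_le_compat | lra].
- rewrite <- E.
  replace (RtoC (1 - p) * expi (- (p * a)) + RtoC p * expi ((1 - p) * a)
    - (RtoC (1 - p) * T (- (p * a))%R + RtoC p * T ((1 - p) * a)%R))%C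
    with (RtoC (1 - p) * (expi (- (p * a)) - T (- (p * a))%R)
          + RtoC p * (expi ((1 - p) * a) - T ((1 - p) * a)%R))%C by ring.
  apply Rle_trans with (1 := Cmod_triangle _ _).
  rewrite !Cmod_mult, !Cmod_R, (Rabs_pos_eq p), (Rabs_pos_eq (1 - p)) by lra.
  generalize (expi_Taylor2 (- (p * a))) (expi_Taylor2 ((1 - p) * a)).
  rewrite Rabs_Ropp, !Rabs_mult, (Rabs_pos_eq p), (Rabs_pos_eq (1 - p)) by lra.
  fold (T (- (p * a))) (T ((1 - p) * a)).
  set (b := Rabs a) in *; intros H1 H2.
  apply Rle_trans with ((1 - p) * ((p * b) ^ 3 / 3) + p * (((1 - p) * b) ^ 3 / 3)).
  { apply Rplus_le_compat; apply Rmult_le_compat_l; lra. }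
  replace ((1 - p) * ((p * b) ^ 3 / 3) + p * (((1 - p) * b) ^ 3 / 3))
    with ((p * b ^ 3) * ((1 - p) * (p ^ 2 + (1 - p) ^ 2) / 3)) by field.
  rewrite <- (Rmult_1_r (p * b ^ 3)) at 2.
  apply Rmult_le_compat_l; [apply Rmult_le_pos; [lra | now apply pow_le] |].
  assert (p ^ 2 + (1 - p) ^ 2 <= 1) by nra; nra.
- rewrite <- RtoC_minus, Cmod_R.
  assert (Hv : 0 <= v).
  { unfold v; assert (0 <= p * (1 - p)) by nra.
    assert (0 <= p * (1 - p) * a ^ 2) by (apply Rmult_le_pos; nra); lra. }
  generalize (exp_neg_Taylor1 v Hv); intros [H1 H2].
  rewrite Rabs_minus_sym, Rabs_pos_eq by lra.
  replace (exp (- v) - (1 - v)) with (exp (- v) - 1 + v) by ring.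
  apply Rle_trans with (1 := H2).
  assert (Hvb : v <= p * Rabs a ^ 2).
  { unfold v; rewrite pow2_abs; assert (0 <= a ^ 2) by nra.
    assert (0 <= p * a ^ 2) by nra.
    assert (0 <= p * (p * a ^ 2)) by nra; lra. }
  set (b := Rabs a) in *.
  (* For [b <= 1] the quadratic bound gives [p^2 b^4 <= p b^3]; otherwise the linear one gives
     [p b^2 <= p b^3]. *)
  destruct (Rle_dec b 1) as [Hb | Hb].
  + apply Rle_trans with (1 := Rmin_r _ _).
    apply Rle_trans with ((p * b ^ 2) ^ 2); [apply pow_incr; lra |].
    replace ((p * b ^ 2) ^ 2) with ((p * b ^ 3) * (p * b)) by ring.
    rewrite <- (Rmult_1_r (p * b ^ 3)) at 2.
    apply Rmult_le_compat_l; [apply Rmult_le_pos; [lra | now apply pow_le] | nra].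
  + apply Rle_trans with (1 := Rmin_l _ _), Rle_trans with (1 := Hvb).
    apply Rmult_le_compat_l; [lra |]; simpl; nra.
Qed.

(** The squared modulus is [1 - 2 p (1 - p) (1 - cos a)] with [p = y / (1 + y)], and
    [p (1 - p) = y / (1 + y)^2 >= y / 4] because [y <= 1]. *)
Lemma bernoulli_char_modulus (y a : R) : 0 < y <= 1 ->
  Cmod (1 + RtoC (y / (1 + y)) * (expi a - 1)) <= exp (- (y * (1 - cos a) / 4)).
Proof.
intros Hy; set (p := y / (1 + y)).
assert (Hp : p * (1 + y) = y) by (unfold p; field; lra).
assert (Hp1 : p * (1 - p) = y / (1 + y) ^ 2) by (unfold p; field; lra).
assert (Hp2 : y / 4 <= p * (1 - p)).
{ rewrite Hp1; apply Rmult_le_compat_l; [lra |].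
  apply Rinv_le_contravar; [apply pow_lt; lra | nra]. }
assert (Hc := COS_bound a).
apply Rsqr_incr_0_var; [| left; apply exp_pos].
rewrite !Rsqr_pow2, Cmod2_alt.
replace (exp (- (y * (1 - cos a) / 4)) ^ 2) with (exp (- (y * (1 - cos a) / 2)))
  by (simpl; rewrite Rmult_1_r, <- exp_plus; f_equal; field).
unfold expi, RtoC, Cminus, Cplus, Cmult, Copp; simpl Re; simpl Im; unfold Re, Im, fst, snd.
apply Rle_trans with (2 := exp_ineq1_le _).
assert (Hs : sin a ^ 2 = 1 - cos a ^ 2)
  by (generalize (sin2_cos2 a); unfold Rsqr; simpl; lra).
match goal with |- ?X <= _ => replace X with (1 - 2 * (p * (1 - p)) * (1 - cos a)) end.
- nra.
- transitivity ((1 + p * (cos a - 1)) ^ 2 + p ^ 2 * sin a ^ 2); [rewrite Hs |]; ring.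
Qed.

(** The factors are replaced one at a time; as they lie in the unit disc, no error is amplified. *)
Lemma Cprod1_diff_le (f g : nat -> C) (N : nat) :
  (forall n, Cmod (f (S n)) <= 1) -> (forall n, Cmod (g (S n)) <= 1) ->
  Cmod (Cprod1 f (S N) - Cprod1 g (S N))
  <= sum_n (fun n => Cmod (f (S n) - g (S n))) N.
Proof.
intros Hf Hg.
assert (Hpf : forall n, Cmod (Cprod1 g n) <= 1).
{ intros n; induction n as [|n IH]; simpl; [rewrite Cmod_1; lra |].
  rewrite Cmod_mult, <- (Rmult_1_r 1).
  apply Rmult_le_compat; auto using Cmod_ge_0. }
induction N as [|N IH].
- rewrite sum_O; simpl; rewrite !Cmult_1_l; apply Rle_refl.
- rewrite Rsum_n_Sn.
  change (Cprod1 f (S (S N))) with (Cprod1 f (S N) * f (S (S N)))%C.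
  change (Cprod1 g (S (S N))) with (Cprod1 g (S N) * g (S (S N)))%C.
  set (F := Cprod1 f (S N)) in *; set (G := Cprod1 g (S N)) in *.
  replace (F * f (S (S N)) - G * g (S (S N)))%C
    with ((F - G) * f (S (S N)) + G * (f (S (S N)) - g (S (S N))))%C by ring.
  apply Rle_trans with (1 := Cmod_triangle _ _).
  rewrite !Cmod_mult; apply Rplus_le_compat.
  + rewrite <- (Rmult_1_r (sum_n _ _)).
    apply Rmult_le_compat; auto using Cmod_ge_0.
  + rewrite <- (Rmult_1_l (Cmod (f _ - _))) at 2.
    apply Rmult_le_compat_r; [apply Cmod_ge_0 | apply Hpf].
Qed.

(** * Central limit theorem for the tilted product *)

(* [fermi] is minus the derivative of [softplus], [fermi_var] minus that of
   [fermi]; [fermi x * (1 - fermi x)] is the variance of a Bernoulli variable of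
   parameter [fermi x]. *)
Definition softplus (x : R) : R := ln (1 + exp (- x)).
Definition fermi (x : R) : R := / (1 + exp x).
Definition fermi_var (x : R) : R := exp x / (1 + exp x) ^ 2.

(** [log_prod] is the logarithm of the product on the positive axis; [mean] and [variance] are those
    of the sum of the Bernoulli variables. The shift [S k] is due to [Cprod1] starting with factor
    1. *)
Definition log_prod (e : nat -> nat) (t : R) : R :=
  Series (fun k => softplus (INR (e (S k)) * t)).
Definition mean (e : nat -> nat) (t : R) : R :=
  Series (fun k => INR (e (S k)) * fermi (INR (e (S k)) * t)).
Definition variance (e : nat -> nat) (t : R) : R :=
  Series (fun k => INR (e (S k)) ^ 2 * fermi_var (INR (e (S k)) * t)).
(** Multiplying the bounds of [bernoulli_char_modulus], with [y = exp (- e k t)], bounds the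
    characteristic function by [exp (- dispersion / 4)]. *)
Definition dispersion (e : nat -> nat) (t x : R) : R :=
  Series (fun k => exp (- (INR (e (S k)) * t)) * (1 - cos (INR (e (S k)) * x))).

(** A growth condition, satisfied by every increasing enumeration of distinct positive exponents; it
    lets geometric series dominate the sums over exponents. *)
Definition distinct_exponents (e : nat -> nat) : Prop :=
  forall n, (S n <= e (S n))%nat.

Lemma softplus_bounds (x : R) : 0 <= softplus x <= exp (- x).
Proof.
unfold softplus; assert (H := exp_pos (- x)); split.
- rewrite <- ln_1; apply ln_le; lra.
- rewrite <- (ln_exp (exp (- x))) at 2; apply ln_le; [lra | apply exp_ineq1_le].
Qed.

Lemma fermi_bounds (x : R) : 0 <= fermi x <= exp (- x).
Proof.
unfold fermi; assert (H := exp_pos x); rewrite exp_Ropp; split.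
- left; apply Rinv_0_lt_compat; lra.
- apply Rinv_le_contravar; lra.
Qed.

Lemma fermi_exp_neg (x : R) : fermi x = exp (- x) / (1 + exp (- x)).
Proof.
unfold fermi; rewrite exp_Ropp; assert (H := exp_pos x); field; lra.
Qed.

Lemma fermi_var_eq (x : R) : fermi_var x = fermi x * (1 - fermi x).
Proof.
unfold fermi_var, fermi; assert (H := exp_pos x); field; lra.
Qed.

Lemma fermi_var_bounds (x : R) : 0 <= fermi_var x <= exp (- x).
Proof.
rewrite fermi_var_eq; generalize (fermi_bounds x).
assert (fermi x <= 1); [| intros; split; nra].
unfold fermi; rewrite <- Rinv_1; apply Rinv_le_contravar; [lra |].
generalize (exp_pos x); lra.
Qed.

Lemma cube_exp_le (y : R) : 0 <= y -> y ^ 3 * exp (- y) <= 27.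
Proof.
intros Hy; replace (exp (- y)) with (/ (exp (y / 3) ^ 3)).
- assert (H : y / 3 <= exp (y / 3)) by (generalize (exp_ineq1_le (y / 3)); lra).
  assert (H3 : (y / 3) ^ 3 <= exp (y / 3) ^ 3) by (apply pow_incr; lra).
  assert (Hp : 0 < exp (y / 3) ^ 3) by (apply pow_lt, exp_pos).
  apply Rle_div_l; [exact Hp |].
  replace (y ^ 3) with (27 * (y / 3) ^ 3) by field; lra.
- rewrite exp_Ropp; f_equal; simpl; rewrite Rmult_1_r, <- !exp_plus; f_equal; field.
Qed.

Section Exponents.

Variables (e : nat -> nat) (t : R).
Hypothesis He : distinct_exponents e.
Hypothesis Ht : 0 < t.

Lemma exponent_ge_1 (k : nat) : 1 <= INR (e (S k)).
Proof. apply (le_INR 1); generalize (He k); lia. Qed.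

(** Half of the exponential absorbs the cube through [cube_exp_le], with [216 = 8 * 27]; the other
    half gives the geometric term. *)
Lemma third_moment_term (k : nat) :
  INR (e (S k)) ^ 3 * exp (- (INR (e (S k)) * t))
  <= 216 / t ^ 3 * exp (- (t / 2)) ^ S k.
Proof.
assert (Hk : INR (S k) <= INR (e (S k))) by apply le_INR, He.
set (m := INR (e (S k))) in *.
assert (H0 : 0 < INR (S k)) by (apply lt_0_INR; lia).
set (y := m * t / 2).
assert (Hy : 0 <= y) by (unfold y; nra).
replace (m ^ 3) with (8 * y ^ 3 / t ^ 3) by (unfold y; field; lra).
replace (exp (- (m * t))) with (exp (- y) * exp (- y))
  by (rewrite <- exp_plus; f_equal; unfold y; field).
replace (8 * y ^ 3 / t ^ 3 * (exp (- y) * exp (- y)))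
  with (8 / t ^ 3 * (y ^ 3 * exp (- y) * exp (- y))) by (field; lra).
replace (216 / t ^ 3 * exp (- (t / 2)) ^ S k)
  with (8 / t ^ 3 * (27 * exp (- (t / 2)) ^ S k)) by (field; lra).
apply Rmult_le_compat_l.
- apply Rdiv_le_0_compat; [lra | now apply pow_lt].
- apply Rmult_le_compat; [| left; apply exp_pos | now apply cube_exp_le |].
  + apply Rmult_le_pos; [now apply pow_le | left; apply exp_pos].
  + rewrite <- Rpower_pow by apply exp_pos; unfold Rpower; rewrite ln_exp.
    apply exp_le; unfold y; nra.
Qed.

Lemma ex_series_third_moment :
  ex_series (fun k => INR (e (S k)) ^ 3 * exp (- (INR (e (S k)) * t))).
Proof.
apply (ex_series_le (K := R_AbsRing) (V := R_CompleteNormedModule))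
  with (fun k => 216 / t ^ 3 * exp (- (t / 2)) ^ S k).
- intros k; change (Rabs (INR (e (S k)) ^ 3 * exp (- (INR (e (S k)) * t)))
    <= 216 / t ^ 3 * exp (- (t / 2)) ^ S k).
  rewrite Rabs_pos_eq; [apply third_moment_term |].
  apply Rmult_le_pos; [apply pow_le, pos_INR | left; apply exp_pos].
- apply (ex_series_scal_l (K := R_AbsRing) (V := R_NormedModule)), ex_series_pow_S.
  split; [left; apply exp_pos | rewrite <- exp_0; apply exp_increasing; lra].
Qed.

Lemma third_moment_le :
  Series (fun k => INR (e (S k)) ^ 3 * exp (- (INR (e (S k)) * t))) <= 432 / t ^ 4.
Proof.
set (r := exp (- (t / 2))).
assert (Hr : 0 < r < 1)
  by (split; [apply exp_pos | unfold r; rewrite <- exp_0; apply exp_increasing; lra]).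
apply Rle_trans with (Series (fun k => 216 / t ^ 3 * r ^ S k)).
- apply Series_le.
  + intros k; split; [| apply third_moment_term].
    apply Rmult_le_pos; [apply pow_le, pos_INR | left; apply exp_pos].
  + apply (ex_series_scal_l (K := R_AbsRing) (V := R_NormedModule)), ex_series_pow_S; lra.
- rewrite Series_scal_l, (Series_ext (fun k => r ^ S k) (fun k => r * r ^ k)) by reflexivity.
  rewrite Series_scal_l, Series_geom by (rewrite Rabs_pos_eq; lra).
  replace (432 / t ^ 4) with (216 / t ^ 3 * (2 / t)) by (field; lra).
  apply Rmult_le_compat_l; [apply Rdiv_le_0_compat; [lra | now apply pow_lt] |].
  apply Rle_div_l; [lra |].
  (* From [exp (t / 2) >= 1 + t / 2] follows [r / (1 - r) <= 2 / t], the last factor in [t^-4]. *)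
  assert (H : exp (t / 2) * r = 1)
    by (unfold r; rewrite <- exp_plus, Rplus_opp_r; apply exp_0).
  generalize (exp_ineq1_le (t / 2)); intros H2.
  assert (r * (t / 2) <= 1 - r) by nra.
  apply Rmult_le_reg_r with (t / 2); [lra |].
  replace (2 / t * (1 - r) * (t / 2)) with (1 - r) by (field; lra); lra.
Qed.

Lemma ex_series_moment (a : nat -> R) :
  (forall k, Rabs (a k) <= INR (e (S k)) ^ 3 * exp (- (INR (e (S k)) * t))) ->
  ex_series a.
Proof.
intros Ha; apply (ex_series_le (K := R_AbsRing) (V := R_CompleteNormedModule)) with (1 := Ha).
apply ex_series_third_moment.
Qed.

(** Exponents are at least 1, so the third moment dominates the lower ones and one summability
    result serves [log_prod], [mean] and [variance]. *)
Lemma moment_term_le (j k : nat) (u : R) : (j <= 3)%nat ->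
  0 <= u <= exp (- (INR (e (S k)) * t)) ->
  Rabs (INR (e (S k)) ^ j * u) <= INR (e (S k)) ^ 3 * exp (- (INR (e (S k)) * t)).
Proof.
intros Hj Hu; rewrite Rabs_pos_eq
  by (apply Rmult_le_pos; [apply pow_le, pos_INR | lra]).
apply Rmult_le_compat; [apply pow_le, pos_INR | lra | | lra].
apply Rle_pow; [apply exponent_ge_1 | exact Hj].
Qed.

Lemma ex_series_log_prod : ex_series (fun k => softplus (INR (e (S k)) * t)).
Proof.
apply ex_series_moment; intros k; rewrite <- (Rmult_1_l (softplus _)).
apply (moment_term_le 0); [lia | apply softplus_bounds].
Qed.

Lemma ex_series_mean :
  ex_series (fun k => INR (e (S k)) * fermi (INR (e (S k)) * t)).
Proof.
apply ex_series_moment; intros k; rewrite <- (pow_1 (INR (e (S k)))) at 1.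
apply moment_term_le; [lia | apply fermi_bounds].
Qed.

Lemma ex_series_variance :
  ex_series (fun k => INR (e (S k)) ^ 2 * fermi_var (INR (e (S k)) * t)).
Proof.
apply ex_series_moment; intros k; apply moment_term_le; [lia | apply fermi_var_bounds].
Qed.

Lemma ex_series_dispersion (x : R) :
  ex_series (fun k => exp (- (INR (e (S k)) * t)) * (1 - cos (INR (e (S k)) * x))).
Proof.
apply (ex_series_le (K := R_AbsRing) (V := R_CompleteNormedModule))
  with (fun k => 2 * (INR (e (S k)) ^ 3 * exp (- (INR (e (S k)) * t)))).
- intros k; change (Rabs (exp (- (INR (e (S k)) * t)) * (1 - cos (INR (e (S k)) * x)))
    <= 2 * (INR (e (S k)) ^ 3 * exp (- (INR (e (S k)) * t)))).
  set (m := INR (e (S k))).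
  assert (Hc := COS_bound (m * x)); assert (Hexp := exp_pos (- (m * t))).
  assert (Hm : 1 <= m ^ 3) by (apply pow_R1_Rle, exponent_ge_1).
  rewrite Rabs_pos_eq by nra.
  apply Rle_trans with (2 * exp (- (m * t))); nra.
- apply (ex_series_scal_l (K := R_AbsRing) (V := R_NormedModule)), ex_series_third_moment.
Qed.

Let m (n : nat) : R := INR (e n).
Let rho (x : R) (n : nat) : C := (1 + RtoC (fermi (m n * t)) * (expi (m n * x) - 1))%C.

(** With [y = exp (- m t)], [p = y / (1 + y)] and [u = expi (m x)], each factor is
    [1 + y u = (1 + y) (1 + p (u - 1))]: its value on the positive axis times a Bernoulli
    characteristic function. *)
Lemma Cprod1_polar_eq (x : R) (N : nat) :
  Cprod1 (fun n => 1 + Cpow (polar (exp (- t)) x) (e n))%C (S N)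
  = (RtoC (exp (sum_n (fun k => softplus (m (S k) * t)) N)) * Cprod1 (rho x) (S N))%C.
Proof.
assert (Hf : forall n, (1 + Cpow (polar (exp (- t)) x) (e n))%C
  = (RtoC (exp (softplus (m n * t))) * rho x n)%C).
{ intros n; rewrite polar_pow; unfold rho, polar; fold (m n).
  replace (exp (- t) ^ e n) with (exp (- (m n * t))).
  - rewrite fermi_exp_neg; unfold softplus; assert (Hp := exp_pos (- (m n * t))).
    set (y := exp (- (m n * t))) in *; rewrite exp_ln by lra.
    rewrite RtoC_div, RtoC_plus by lra; field.
    change (RtoC 1 + RtoC y <> 0)%C; rewrite <- RtoC_plus; intros H; apply RtoC_inj in H; lra.
  - rewrite <- Rpower_pow by apply exp_pos; unfold Rpower, m; rewrite ln_exp.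
    f_equal; ring. }
induction N as [|N IH].
- rewrite sum_O; simpl; rewrite Hf; ring.
- rewrite Rsum_n_Sn, exp_plus, RtoC_mult.
  change (Cprod1 (fun n => 1 + Cpow (polar (exp (- t)) x) (e n)) (S N)
     * (1 + Cpow (polar (exp (- t)) x) (e (S (S N))))
   = RtoC (exp (sum_n (fun k => softplus (m (S k) * t)) N))
     * RtoC (exp (softplus (m (S (S N)) * t)))
     * (Cprod1 (rho x) (S N) * rho x (S (S N))))%C.
  rewrite IH, Hf; ring.
Qed.

Lemma Cmod_rho_le (x : R) (n : nat) :
  Cmod (rho x n) <= exp (- (exp (- (m n * t)) * (1 - cos (m n * x)) / 4)).
Proof.
unfold rho; rewrite fermi_exp_neg; apply bernoulli_char_modulus.
split; [apply exp_pos | apply exp_neg_le_1].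
assert (0 <= m n) by apply pos_INR; nra.
Qed.

Lemma Cmod_rho_le_1 (x : R) (n : nat) : Cmod (rho x n) <= 1.
Proof.
apply Rle_trans with (1 := Cmod_rho_le x n); apply exp_neg_le_1.
assert (H := exp_pos (- (m n * t))); assert (H' := COS_bound (m n * x)).
assert (0 <= exp (- (m n * t)) * (1 - cos (m n * x)))
  by (apply Rmult_le_pos; lra); lra.
Qed.

Lemma Cmod_Cprod1_rho_le (x : R) (N : nat) :
  Cmod (Cprod1 (rho x) (S N))
  <= exp (- (sum_n (fun k => exp (- (m (S k) * t)) * (1 - cos (m (S k) * x))) N / 4)).
Proof.
induction N as [|N IH].
- rewrite sum_O; simpl; rewrite Cmult_1_l; apply Cmod_rho_le.
- rewrite Rsum_n_Sn.
  change (Cprod1 (rho x) (S (S N))) with (Cprod1 (rho x) (S N) * rho x (S (S N)))%C.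
  rewrite Cmod_mult, Rdiv_plus_distr, Ropp_plus_distr, exp_plus.
  apply Rmult_le_compat; auto using Cmod_ge_0, Cmod_rho_le.
Qed.

(** The sum of [bernoulli_char_estimate] over the exponents, with [864 = 2 * 432] from
    [third_moment_le]. For [x] of order [t^(3/2)] the error is of order [sqrt t]. *)
Lemma Cprod1_rho_CLT (x : R) (N : nat) :
  Cmod (Cprod1 (rho x) (S N)
        * expi (- (x * sum_n (fun k => m (S k) * fermi (m (S k) * t)) N))
        - RtoC (exp (- (x ^ 2 / 2 * sum_n (fun k => m (S k) ^ 2 * fermi_var (m (S k) * t)) N))))
  <= 864 * (Rabs x ^ 3 / t ^ 4).
Proof.
set (f := fun n => (rho x n * expi (- (fermi (m n * t) * (m n * x))))%C).
set (g := fun n => RtoC (exp (- (fermi (m n * t) * (1 - fermi (m n * t)) * (m n * x) ^ 2 / 2)))).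
assert (Ef : forall N, Cmult (Cprod1 (rho x) (S N))
  (expi (- (x * sum_n (fun k => m (S k) * fermi (m (S k) * t)) N))) = Cprod1 f (S N)).
{ clear N; intros N; induction N as [|N IH].
  - rewrite sum_O; unfold f; simpl; rewrite !Cmult_1_l; do 3 f_equal; ring.
  - rewrite Rsum_n_Sn.
    change (Cprod1 f (S (S N))) with (Cprod1 f (S N) * f (S (S N)))%C.
    rewrite <- IH; unfold f.
    change (Cprod1 (rho x) (S (S N))) with (Cprod1 (rho x) (S N) * rho x (S (S N)))%C.
    match goal with |- (_ * expi (- (x * (?a + ?b))))%C = _ =>
      replace (- (x * (a + b))) with (- (x * a) + - (x * b)) by ring end.
    rewrite expi_plus.
    replace (x * (m (S (S N)) * fermi (m (S (S N)) * t)))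
      with (fermi (m (S (S N)) * t) * (m (S (S N)) * x)) by ring.
    ring. }
assert (Eg : forall N, RtoC (exp (- (x ^ 2 / 2
  * sum_n (fun k => m (S k) ^ 2 * fermi_var (m (S k) * t)) N))) = Cprod1 g (S N)).
{ clear N; intros N; induction N as [|N IH].
  - rewrite sum_O; unfold g; simpl Cprod1; rewrite Cmult_1_l, fermi_var_eq.
    do 3 f_equal; field.
  - rewrite Rsum_n_Sn.
    change (Cprod1 g (S (S N))) with (Cprod1 g (S N) * g (S (S N)))%C.
    rewrite <- IH; unfold g; rewrite fermi_var_eq, <- RtoC_mult, <- exp_plus.
    do 2 f_equal; field. }
rewrite Ef, Eg.
assert (Hfer : forall n, 0 <= fermi (m n * t) <= 1).
{ intros n; generalize (fermi_bounds (m n * t)); intros H; split; [lra |].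
  apply Rle_trans with (1 := proj2 H); apply exp_neg_le_1.
  assert (0 <= m n) by apply pos_INR; nra. }
assert (Hf1 : forall n, Cmod (f (S n)) <= 1).
{ intros n; unfold f; rewrite Cmod_mult, Cmod_expi, Rmult_1_r; apply Cmod_rho_le_1. }
assert (Hg1 : forall n, Cmod (g (S n)) <= 1).
{ intros n; unfold g; rewrite Cmod_R, Rabs_pos_eq by (left; apply exp_pos).
  apply exp_neg_le_1; generalize (Hfer (S n)); intros Hp.
  apply Rdiv_le_0_compat; [| lra].
  apply Rmult_le_pos; [nra | apply pow2_ge_0]. }
apply Rle_trans with (1 := Cprod1_diff_le f g N Hf1 Hg1).
apply Rle_trans with (sum_n (fun k => 2 * Rabs x ^ 3
  * (m (S k) ^ 3 * exp (- (m (S k) * t)))) N).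
- apply sum_n_m_le; intros k.
  apply Rle_trans with (1 := bernoulli_char_estimate _ _ (Hfer (S k))).
  rewrite Rabs_mult, (Rabs_pos_eq (m (S k))) by apply pos_INR.
  rewrite Rpow_mult_distr.
  replace (2 * (fermi (m (S k) * t) * (m (S k) ^ 3 * Rabs x ^ 3)))
    with (2 * Rabs x ^ 3 * (m (S k) ^ 3 * fermi (m (S k) * t))) by ring.
  apply Rmult_le_compat_l.
  + apply Rmult_le_pos; [lra | apply pow_le, Rabs_pos].
  + apply Rmult_le_compat_l; [apply pow_le, pos_INR | apply fermi_bounds].
- assert (Hx3 : 0 <= 2 * Rabs x ^ 3) by (apply Rmult_le_pos; [lra | apply pow_le, Rabs_pos]).
  eapply Rle_trans.
  { apply sum_n_le_Series.
    - intros k; apply Rmult_le_pos; [exact Hx3 |].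
      apply Rmult_le_pos; [apply pow_le, pos_INR | left; apply exp_pos].
    - apply (ex_series_scal_l (K := R_AbsRing) (V := R_NormedModule)), ex_series_third_moment. }
  rewrite Series_scal_l.
  replace (864 * (Rabs x ^ 3 / t ^ 4)) with (2 * Rabs x ^ 3 * (432 / t ^ 4)) by (field; lra).
  apply Rmult_le_compat_l; [exact Hx3 | apply third_moment_le].
Qed.

Lemma Cis_lim_expi (u : nat -> R) (l : R) :
  is_lim_seq u l -> Cis_lim (fun n => expi (u n)) (expi l).
Proof.
intros H; unfold Cis_lim.
apply is_lim_seq_le_le with (fun _ => 0) (fun n => 2 * Rabs (u n - l)).
- intros n; split; [apply Cmod_ge_0 |].
  replace (expi (u n) - expi l)%C with (expi l * (expi (u n - l) - 1))%C.
  + rewrite Cmod_mult, Cmod_expi, Rmult_1_l; apply Cmod_expi_minus_1.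
  + replace (u n) with (l + (u n - l)) at 2 by ring; rewrite expi_plus; ring.
- apply is_lim_seq_const.
- replace (Finite 0) with (Rbar_mult 2 (Rbar_abs (Finite (l - l))))
    by (simpl; rewrite Rminus_diag, Rabs_R0; f_equal; ring).
  apply is_lim_seq_scal_l, is_lim_seq_abs, is_lim_seq_minus'; [exact H | apply is_lim_seq_const].
Qed.

Lemma is_lim_seq_exp (u : nat -> R) (l : R) :
  is_lim_seq u l -> is_lim_seq (fun n => exp (u n)) (exp l).
Proof.
apply is_lim_seq_continuous, derivable_continuous_pt, derivable_pt_exp.
Qed.

(** [D] is the characteristic function of the infinite sum of variables; both bounds pass to the
    limit from the finite products. *)
Lemma exp_prod_CLT (x : R) (l : C) :
  is_exp_prod e (polar (exp (- t)) x) l ->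
  exists D, l = (RtoC (exp (log_prod e t)) * D)%C
    /\ Cmod D <= exp (- (dispersion e t x / 4))
    /\ Cmod (D * expi (- (x * mean e t))
             - RtoC (exp (- (x ^ 2 / 2 * variance e t)))) <= 864 * (Rabs x ^ 3 / t ^ 4).
Proof.
intros Hl; unfold is_exp_prod, Cis_lim in Hl; apply is_lim_seq_incr_1 in Hl.
set (D := (RtoC (exp (- log_prod e t)) * l)%C).
assert (H0 : is_lim_seq (sum_n (fun k => softplus (m (S k) * t))) (log_prod e t))
  by exact (Series_correct _ ex_series_log_prod).
assert (HD : Cis_lim (fun N => Cprod1 (rho x) (S N)) D).
{ apply Cis_lim_ext with (fun N =>
    RtoC (exp (- sum_n (fun k => softplus (m (S k) * t)) N))
    * Cprod1 (fun n => 1 + Cpow (polar (exp (- t)) x) (e n)) (S N))%C.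
  - intros N; rewrite Cprod1_polar_eq, Cmult_assoc, <- RtoC_mult, <- exp_plus.
    rewrite Rplus_opp_l, exp_0; ring.
  - apply Cis_lim_mult; [| exact Hl].
    apply Cis_lim_RtoC, is_lim_seq_exp.
    apply (is_lim_seq_opp _ (log_prod e t)), H0. }
exists D; split; [| split].
- unfold D; rewrite Cmult_assoc, <- RtoC_mult, <- exp_plus, Rplus_opp_r, exp_0; ring.
- apply (is_lim_seq_le _ _ (Cmod D) (exp (- (dispersion e t x / 4)))
    (Cmod_Cprod1_rho_le x) (Cis_lim_Cmod _ _ HD)).
  apply (is_lim_seq_exp _ (- (dispersion e t x / 4))).
  apply (is_lim_seq_opp _ (dispersion e t x / 4)).
  apply (is_lim_seq_mult' _ _ (dispersion e t x) (/ 4)).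
  + exact (Series_correct _ (ex_series_dispersion x)).
  + apply is_lim_seq_const.
- refine (is_lim_seq_le _ (fun _ => 864 * (Rabs x ^ 3 / t ^ 4)) (Cmod _)
    (864 * (Rabs x ^ 3 / t ^ 4)) (Cprod1_rho_CLT x) _ _);
    [| apply is_lim_seq_const].
  apply Cis_lim_Cmod, Cis_lim_minus; [apply Cis_lim_mult; [exact HD |] |].
  + apply Cis_lim_expi, (is_lim_seq_opp _ (x * mean e t)).
    apply (is_lim_seq_scal_l _ x (mean e t)).
    exact (Series_correct _ ex_series_mean).
  + apply Cis_lim_RtoC, is_lim_seq_exp, (is_lim_seq_opp _ (x ^ 2 / 2 * variance e t)).
    apply (is_lim_seq_scal_l _ (x ^ 2 / 2) (variance e t)).
    exact (Series_correct _ ex_series_variance).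
Qed.

End Exponents.

(** * The Basel sum *)

Definition cos_int (n : nat) : R := RInt (fun x => cos x ^ (2 * n)) 0 (PI / 2).
Definition sq_cos_int (n : nat) : R :=
  RInt (fun x => x ^ 2 * cos x ^ (2 * n)) 0 (PI / 2).

Lemma ex_RInt_derivable (f : R -> R) (a b : R) :
  (forall x, ex_derive f x) -> ex_RInt f a b.
Proof.
intros Hf; apply (ex_RInt_continuous (V := R_CompleteNormedModule)); intros x _.
apply (ex_derive_continuous (V := R_NormedModule)), Hf.
Qed.

Lemma is_RInt_cos_int (n : nat) :
  is_RInt (fun x => cos x ^ (2 * n)) 0 (PI / 2) (cos_int n).
Proof.
apply (RInt_correct (V := R_CompleteNormedModule)), ex_RInt_derivable.
intros x; auto_derive; easy.
Qed.

Lemma is_RInt_sq_cos_int (n : nat) :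
  is_RInt (fun x => x ^ 2 * cos x ^ (2 * n)) 0 (PI / 2) (sq_cos_int n).
Proof.
apply (RInt_correct (V := R_CompleteNormedModule)), ex_RInt_derivable.
intros x; auto_derive; easy.
Qed.

Lemma cos_int_S (n : nat) :
  (2 * INR n + 2) * cos_int (S n) = (2 * INR n + 1) * cos_int n.
Proof.
assert (H : is_RInt (fun x => minus (scal (2 * INR n + 2) (cos x ^ (2 * S n)))
    (scal (2 * INR n + 1) (cos x ^ (2 * n)))) 0 (PI / 2)
  (minus (scal (2 * INR n + 2) (cos_int (S n))) (scal (2 * INR n + 1) (cos_int n)))).
{ apply (is_RInt_minus (V := R_NormedModule)); apply (is_RInt_scal (V := R_NormedModule));
    apply is_RInt_cos_int. }
assert (H' : is_RInt (fun x => minus (scal (2 * INR n + 2) (cos x ^ (2 * S n)))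
    (scal (2 * INR n + 1) (cos x ^ (2 * n)))) 0 (PI / 2)
  (minus (sin (PI / 2) * cos (PI / 2) ^ (2 * n + 1)) (sin 0 * cos 0 ^ (2 * n + 1)))).
{ apply (is_RInt_derive (V := R_CompleteNormedModule) (fun x => sin x * cos x ^ (2 * n + 1))).
  - intros x _; auto_derive; [easy |].
    unfold minus, plus, opp, scal; simpl; unfold mult; simpl.
    replace (n + (n + 0) + 1)%nat with (S (2 * n)) by lia.
    replace (n + S (n + 0))%nat with (S (2 * n)) by lia.
    replace (n + (n + 0))%nat with (2 * n)%nat by lia.
    assert (Ej : INR (2 * n) = 2 * INR n) by (rewrite mult_INR; reflexivity).
    revert Ej; generalize (2 * n)%nat; intros j Ej.
    rewrite S_INR, Ej; simpl pow; simpl Nat.pred.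
    assert (Hs : sin x * sin x = 1 - cos x * cos x)
      by (generalize (sin2_cos2 x); unfold Rsqr; lra).
    match goal with |- ?X = _ => replace X with
      (cos x * cos x * cos x ^ j - (2 * INR n + 1) * (sin x * sin x) * cos x ^ j)
      by ring end.
    rewrite Hs; ring.
  - intros x _; apply (ex_derive_continuous (V := R_NormedModule)).
    unfold minus, plus, opp, scal; simpl; unfold mult; simpl; auto_derive; easy. }
generalize (is_RInt_unique _ _ _ _ H); rewrite (is_RInt_unique _ _ _ _ H').
rewrite cos_PI2, sin_0, pow_add; unfold minus, plus, opp, scal; simpl; unfold mult; simpl.
intros E; lra.
Qed.

(** Two integrations by parts of [cos x ^ (2 n + 2)] merged into one antiderivative [F]: the terms
    in [x sin x] cancel in its derivative, and it vanishes at both endpoints. *)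
Lemma sq_cos_int_S (n : nat) :
  cos_int (S n) + (INR n + 1) * (2 * INR n + 2) * sq_cos_int (S n)
  = (INR n + 1) * (2 * INR n + 1) * sq_cos_int n.
Proof.
set (c1 := (INR n + 1) * (2 * INR n + 2)); set (c2 := (INR n + 1) * (2 * INR n + 1)).
set (f := fun x => minus (plus (cos x ^ (2 * S n)) (scal c1 (x ^ 2 * cos x ^ (2 * S n))))
    (scal c2 (x ^ 2 * cos x ^ (2 * n))) : R).
assert (H : is_RInt f 0 (PI / 2)
  (minus (plus (cos_int (S n)) (scal c1 (sq_cos_int (S n)))) (scal c2 (sq_cos_int n)))).
{ apply (is_RInt_minus (V := R_NormedModule)); [apply (is_RInt_plus (V := R_NormedModule)) |].
  - apply is_RInt_cos_int.
  - apply (is_RInt_scal (V := R_NormedModule)), is_RInt_sq_cos_int.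
  - apply (is_RInt_scal (V := R_NormedModule)), is_RInt_sq_cos_int. }
set (F := fun x => x * cos x ^ (2 * n + 2) + (INR n + 1) * x ^ 2 * sin x * cos x ^ (2 * n + 1)).
assert (H' : is_RInt f 0 (PI / 2) (minus (F (PI / 2)) (F 0))).
{ apply (is_RInt_derive (V := R_CompleteNormedModule) F).
  - intros x _; unfold F, f; auto_derive; [easy |].
    unfold c1, c2, minus, plus, opp, scal; simpl; unfold mult; simpl.
    replace (n + (n + 0) + 1)%nat with (S (2 * n)) by lia.
    replace (n + (n + 0) + 2)%nat with (S (S (2 * n))) by lia.
    replace (n + S (n + 0))%nat with (S (2 * n)) by lia.
    replace (n + (n + 0))%nat with (2 * n)%nat by lia.
    assert (Ej : INR (2 * n) = 2 * INR n) by (rewrite mult_INR; reflexivity).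
    revert Ej; generalize (2 * n)%nat; intros j Ej.
    rewrite !S_INR, Ej; simpl pow; simpl Nat.pred.
    assert (Hs : sin x * sin x = 1 - cos x * cos x)
      by (generalize (sin2_cos2 x); unfold Rsqr; lra).
    set (k := cos x ^ j).
    match goal with |- ?X = _ => replace X with
      (cos x * cos x * k + (INR n + 1) * x ^ 2 * (cos x * cos x * k)
       - (INR n + 1) * (2 * INR n + 1) * x ^ 2 * (sin x * sin x) * k)
      by ring end.
    rewrite Hs; ring.
  - intros x _; apply (ex_derive_continuous (V := R_NormedModule)); unfold f.
    unfold minus, plus, opp, scal; simpl; unfold mult; simpl; auto_derive; easy. }
generalize (is_RInt_unique _ _ _ _ H); rewrite (is_RInt_unique _ _ _ _ H').
unfold F; rewrite cos_PI2, sin_0, !pow_add; unfold minus, plus, opp, scal; simpl; unfold mult; simpl.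
intros E; lra.
Qed.

Lemma cos_int_0 : cos_int 0 = PI / 2.
Proof.
unfold cos_int; rewrite (RInt_ext _ (fun _ => 1)) by reflexivity.
rewrite RInt_const; unfold scal; simpl; unfold mult; simpl; ring.
Qed.

Lemma sq_cos_int_0 : sq_cos_int 0 = PI ^ 3 / 24.
Proof.
apply is_RInt_unique; simpl.
replace (PI * (PI * (PI * 1)) / 24) with (minus ((PI / 2) ^ 3 / 3) (0 ^ 3 / 3))
  by (unfold minus, plus, opp; simpl; field).
apply (is_RInt_derive (V := R_CompleteNormedModule) (fun x => x ^ 3 / 3)).
- intros x _; auto_derive; [easy | field].
- intros x _; apply (ex_derive_continuous (V := R_NormedModule)); auto_derive; easy.
Qed.

Lemma cos_int_pos (n : nat) : 0 < cos_int n.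
Proof.
induction n as [|n IH].
- rewrite cos_int_0; generalize PI_RGT_0; lra.
- generalize (cos_int_S n) (pos_INR n); intros E Hn; nra.
Qed.

(** On [[0, PI / 2]], [x cos x <= sin x], so [x^2 cos^(2n+2) x <= sin^2 x cos^(2n) x]. *)
Lemma sq_cos_int_bounds (n : nat) :
  0 <= sq_cos_int (S n) <= cos_int n - cos_int (S n).
Proof.
assert (HPI := PI_RGT_0); split.
- apply RInt_ge_0; [lra | eexists; apply is_RInt_sq_cos_int |].
  intros x _; apply Rmult_le_pos; [apply pow2_ge_0 |].
  rewrite pow_mult; apply pow_le, pow2_ge_0.
- assert (H := is_RInt_minus (V := R_NormedModule) _ _ _ _ _ _
    (is_RInt_cos_int n) (is_RInt_cos_int (S n))).
  apply Rle_trans with (2 := Req_le _ _ (is_RInt_unique _ _ _ _ H)).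
  apply RInt_le; [lra | eexists; apply is_RInt_sq_cos_int | eexists; apply H |].
  intros x Hx.
  change (x ^ 2 * cos x ^ (2 * S n) <= cos x ^ (2 * n) - cos x ^ (2 * S n)).
  assert (Hxs : 0 <= x * cos x <= sin x).
  { split; [apply Rmult_le_pos; [lra | apply cos_ge_0; lra] |].
    assert (Hd : forall y, is_derive (fun x => sin x - x * cos x) y (y * sin y))
      by (intros y; auto_derive; [easy | ring]).
    destruct (MVT_gen (fun x => sin x - x * cos x) 0 x (fun y => y * sin y)) as [c [Hc E]].
    - intros y _; apply Hd.
    - intros y _; apply continuity_pt_filterlim.
      apply (ex_derive_continuous (V := R_NormedModule) (fun x => sin x - x * cos x)).
      eexists; apply Hd.
    - rewrite Rmin_left, Rmax_right in Hc by lra; rewrite sin_0 in E.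
      assert (0 <= sin c) by (apply sin_ge_0; lra).
      assert (0 <= c * sin c * (x - 0))
        by (apply Rmult_le_pos; [apply Rmult_le_pos |]; lra).
      lra. }
  assert (Hsq : (x * cos x) ^ 2 <= sin x ^ 2) by (apply pow_incr; exact Hxs).
  assert (Hs : sin x ^ 2 = 1 - cos x ^ 2)
    by (generalize (sin2_cos2 x); unfold Rsqr; simpl; lra).
  replace (2 * S n)%nat with (2 + 2 * n)%nat by lia.
  rewrite pow_add.
  assert (Hk : 0 <= cos x ^ (2 * n)) by (rewrite pow_mult; apply pow_le, pow2_ge_0).
  rewrite Rpow_mult_distr in Hsq; nra.
Qed.

Definition inv_sq_sum (N : nat) : R := sum_n (fun k => / (INR k + 1) ^ 2) N.

(* Daners: integrating [cos x ^ (2 n)] by parts twice makes each [1 / n^2] a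
   difference of consecutive quotients. *)
Lemma inv_sq_sum_eq (N : nat) :
  inv_sq_sum N = PI ^ 2 / 6 - 2 * (sq_cos_int (S N) / cos_int (S N)).
Proof.
assert (Hstep : forall n, / (INR n + 1) ^ 2
  = 2 * (sq_cos_int n / cos_int n) - 2 * (sq_cos_int (S n) / cos_int (S n))).
{ intros n; assert (E1 := cos_int_S n); assert (E2 := sq_cos_int_S n).
  assert (P1 := cos_int_pos n); assert (P2 := cos_int_pos (S n)).
  assert (Hn := pos_INR n).
  apply (Rmult_eq_reg_r ((INR n + 1) * (2 * INR n + 2) * cos_int (S n)));
    [| apply Rgt_not_eq, Rmult_lt_0_compat; nra].
  replace ((2 * (sq_cos_int n / cos_int n) - 2 * (sq_cos_int (S n) / cos_int (S n)))
    * ((INR n + 1) * (2 * INR n + 2) * cos_int (S n)))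
    with (2 * (INR n + 1) * sq_cos_int n / cos_int n * ((2 * INR n + 2) * cos_int (S n))
      - 2 * ((INR n + 1) * (2 * INR n + 2) * sq_cos_int (S n))) by (field; lra).
  rewrite E1.
  replace ((INR n + 1) * (2 * INR n + 2) * sq_cos_int (S n))
    with ((INR n + 1) * (2 * INR n + 1) * sq_cos_int n - cos_int (S n)) by lra.
  field; lra. }
unfold inv_sq_sum; induction N as [|N IH].
- rewrite sum_O, Hstep, sq_cos_int_0, cos_int_0; field; split;
    [apply Rgt_not_eq, cos_int_pos | apply PI_neq0].
- rewrite Rsum_n_Sn, IH, Hstep; ring.
Qed.

(** By [cos_int_S], [cos_int N - cos_int (S N) = cos_int (S N) / (2 N + 1)], so the remainder in
    [inv_sq_sum_eq] is [O(1 / N)]. *)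
Lemma Basel : is_lim_seq inv_sq_sum (PI ^ 2 / 6).
Proof.
apply is_lim_seq_le_le with (fun N => PI ^ 2 / 6 - 2 * / (INR N + 1)) (fun _ => PI ^ 2 / 6).
- intros N; rewrite inv_sq_sum_eq.
  assert (E1 := cos_int_S N); assert (P1 := cos_int_pos N); assert (P2 := cos_int_pos (S N)).
  assert (Hn := pos_INR N); assert (B := sq_cos_int_bounds N).
  assert (0 <= sq_cos_int (S N) / cos_int (S N)) by (apply Rdiv_le_0_compat; lra).
  assert (sq_cos_int (S N) / cos_int (S N) <= / (INR N + 1)); [| lra].
  apply Rle_div_l; [exact P2 |].
  apply Rmult_le_reg_l with (INR N + 1); [lra |].
  rewrite <- Rmult_assoc, Rinv_r, Rmult_1_l by lra; nra.
- replace (Finite (PI ^ 2 / 6)) with (Finite (PI ^ 2 / 6 - 2 * 0)) by (f_equal; ring).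
  apply is_lim_seq_minus'; [apply is_lim_seq_const |].
  apply (is_lim_seq_scal_l _ 2 0).
  replace (Finite 0) with (Rbar_inv p_infty) by reflexivity.
  apply is_lim_seq_inv; [| easy].
  apply is_lim_seq_ext with (fun n => INR (S n)); [intros n; apply S_INR |].
  apply -> is_lim_seq_incr_1; apply is_lim_seq_INR.
- apply is_lim_seq_const.
Qed.

Definition alt_inv_sq_sum (N : nat) : R := sum_n (fun k => (-1) ^ k / (INR k + 1) ^ 2) N.

(** Terms with even denominator change sign, and twice the sum of [1 / (2 j)^2] is half the sum of
    [1 / j^2]. *)
Lemma alt_inv_sq_sum_eq (N : nat) :
  alt_inv_sq_sum (S (2 * N)) = inv_sq_sum (S (2 * N)) - / 2 * inv_sq_sum N.
Proof.
unfold alt_inv_sq_sum, inv_sq_sum; induction N as [|N IH].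
- change (2 * 0)%nat with 0%nat; rewrite !Rsum_n_Sn, !sum_O; simpl; field.
- replace (S (2 * S N)) with (S (S (S (2 * N)))) by lia.
  rewrite !(Rsum_n_Sn _ (S (S (2 * N)))), !(Rsum_n_Sn _ (S (2 * N))), IH, (Rsum_n_Sn _ N).
  change ((-1) ^ S (S (2 * N))) with (-1 * (-1 * (-1) ^ (2 * N))).
  change ((-1) ^ S (S (S (2 * N)))) with (-1 * (-1 * (-1 * (-1) ^ (2 * N)))).
  rewrite pow_mult; replace ((-1) ^ 2) with 1 by ring; rewrite pow1.
  rewrite !S_INR, mult_INR; change (INR 2) with 2.
  assert (Hn := pos_INR N); field; lra.
Qed.

Lemma alt_Basel : is_lim_seq (fun N => alt_inv_sq_sum (S (2 * N))) (PI ^ 2 / 12).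
Proof.
apply is_lim_seq_ext with (fun N => inv_sq_sum (S (2 * N)) - / 2 * inv_sq_sum N).
{ intros N; symmetry; apply alt_inv_sq_sum_eq. }
replace (Finite (PI ^ 2 / 12)) with (Finite (PI ^ 2 / 6 - / 2 * (PI ^ 2 / 6)))
  by (f_equal; field).
apply is_lim_seq_minus'.
- apply (is_lim_seq_subseq inv_sq_sum (PI ^ 2 / 6) (fun N => S (2 * N))); [| apply Basel].
  apply eventually_subseq; intros n; lia.
- apply (is_lim_seq_scal_l _ (/ 2) (PI ^ 2 / 6)), Basel.
Qed.

(** * The integral of ln (1 + exp (- x)) *)

Lemma is_derive_softplus (x : R) : is_derive softplus x (- fermi x).
Proof.
unfold softplus, fermi; assert (H := exp_pos (- x)); assert (H' := exp_pos x).
auto_derive; [lra |].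
rewrite exp_Ropp; field; split; [lra |].
apply Rgt_not_eq; lra.
Qed.

Lemma is_derive_fermi (x : R) : is_derive fermi x (- fermi_var x).
Proof.
unfold fermi_var, fermi; assert (H' := exp_pos x).
auto_derive; [lra |]; field; lra.
Qed.

Lemma fermi_decr (x y : R) : x <= y -> fermi y <= fermi x.
Proof.
intros H; unfold fermi; assert (Hx := exp_pos x); assert (Hy := exp_le x y H).
apply Rinv_le_contravar; lra.
Qed.

(** [p (1 - p)] increases for [p <= 1 / 2], and [fermi] is at most [1 / 2] on the nonnegative
    axis. *)
Lemma fermi_var_decr (x y : R) : 0 <= x <= y -> fermi_var y <= fermi_var x.
Proof.
intros H; rewrite !fermi_var_eq; assert (Hd := fermi_decr x y (proj2 H)).
assert (fermi x <= / 2).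
{ unfold fermi; apply Rinv_le_contravar; [lra |].
  generalize (exp_ineq1_le x); lra. }
nra.
Qed.

Lemma continuity_pt_of_is_derive (f : R -> R) (x d : R) :
  is_derive f x d -> continuity_pt f x.
Proof.
intros H; apply continuity_pt_filterlim.
apply (ex_derive_continuous (V := R_NormedModule) f); now exists d.
Qed.

(* [ring] and [field] do not see through Coquelicot's carriers of R. *)
Ltac eq_in_R := match goal with |- @eq _ ?a ?b => change (@eq R a b) end.

Lemma deriv_bounds (f df : R -> R) (a b : R) : a <= b ->
  (forall x, a <= x <= b -> is_derive f x (df x)) ->
  (forall x y, a <= x -> x <= y -> y <= b -> df x <= df y) ->
  df a * (b - a) <= f b - f a <= df b * (b - a).
Proof.
intros Hab Hd Hm.
destruct (MVT_gen f a b df) as [c [Hc E]]; rewrite ?Rmin_left, ?Rmax_right in * by lra.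
- intros x Hx; apply Hd; lra.
- intros x Hx; apply continuity_pt_of_is_derive with (df x), Hd; lra.
- rewrite E; split; apply Rmult_le_compat_r; try lra; apply Hm; lra.
Qed.

Lemma ex_RInt_softplus (a b : R) : ex_RInt softplus a b.
Proof.
apply ex_RInt_derivable; intros x; eexists; apply is_derive_softplus.
Qed.

Lemma softplus_tangents (x y : R) : x <= y ->
  fermi y * (y - x) <= softplus x - softplus y <= fermi x * (y - x).
Proof.
intros Hxy.
assert (H := deriv_bounds softplus (fun x => - fermi x) x y Hxy
  (fun z _ => is_derive_softplus z)).
assert (H' : forall u v, x <= u -> u <= v -> v <= y -> - fermi u <= - fermi v)
  by (intros u v _ Huv _; apply Ropp_le_contravar, fermi_decr, Huv).
specialize (H H'); lra.
Qed.

(** At each endpoint, the lines with slopes [- fermi a] and [- fermi b] enclose [softplus], one of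
    them being the tangent. Averaging the bounds from the two endpoints leaves an error proportional
    to a difference of [fermi], which telescopes under summation. *)
Lemma softplus_trapezoid (a h : R) : 0 <= h ->
  Rabs (RInt softplus a (a + h) - h * (softplus a + softplus (a + h)) / 2)
  <= h ^ 2 / 4 * (fermi a - fermi (a + h)).
Proof.
intros Hh; set (b := a + h).
assert (Haff : forall c d, is_RInt (fun x => c + d * (x - a)) a b (c * h + d * h ^ 2 / 2)).
{ intros c d.
  replace (c * h + d * h ^ 2 / 2) with
    (minus (c * (b - a) + d * (b - a) ^ 2 / 2) (c * (a - a) + d * (a - a) ^ 2 / 2))
    by (unfold minus, plus, opp, b; simpl; field).
  apply (is_RInt_derive (V := R_CompleteNormedModule)
    (fun x => c * (x - a) + d * (x - a) ^ 2 / 2)).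
  - intros x _; auto_derive; [easy | field].
  - intros x _; apply (ex_derive_continuous (V := R_NormedModule)); auto_derive; easy. }
assert (Hlow : forall c d, (forall x, a <= x <= b -> c + d * (x - a) <= softplus x) ->
  c * h + d * h ^ 2 / 2 <= RInt softplus a b).
{ intros c d Hx; rewrite <- (is_RInt_unique _ _ _ _ (Haff c d)).
  apply RInt_le; [unfold b; lra | eexists; apply Haff | apply ex_RInt_softplus |].
  intros x Hx'; apply Hx; lra. }
assert (Hup : forall c d, (forall x, a <= x <= b -> softplus x <= c + d * (x - a)) ->
  RInt softplus a b <= c * h + d * h ^ 2 / 2).
{ intros c d Hx; rewrite <- (is_RInt_unique _ _ _ _ (Haff c d)).
  apply RInt_le; [unfold b; lra | apply ex_RInt_softplus | eexists; apply Haff |].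
  intros x Hx'; apply Hx; lra. }
assert (Hm : forall x, a <= x <= b -> fermi b <= fermi x <= fermi a)
  by (intros x Hx; split; apply fermi_decr; lra).
assert (L1 := Hlow (softplus a) (- fermi a)).
assert (L2 := Hlow (softplus b + fermi b * h) (- fermi b)).
assert (U1 := Hup (softplus a) (- fermi b)).
assert (U2 := Hup (softplus b + fermi a * h) (- fermi a)).
assert (L1' : softplus a * h - fermi a * h ^ 2 / 2 <= RInt softplus a b).
{ apply Rle_trans with (2 := L1 ltac:(intros x Hx;
    generalize (softplus_tangents a x (proj1 Hx)); lra)); lra. }
assert (L2' : softplus b * h + fermi b * h ^ 2 / 2 <= RInt softplus a b).
{ apply Rle_trans with (2 := L2 ltac:(intros x Hx;
    generalize (softplus_tangents x b (proj2 Hx)); unfold b in *; lra)); lra. }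
assert (U1' : RInt softplus a b <= softplus a * h - fermi b * h ^ 2 / 2).
{ apply Rle_trans with (1 := U1 ltac:(intros x Hx;
    generalize (softplus_tangents a x (proj1 Hx)) (Hm x Hx); nra)); lra. }
assert (U2' : RInt softplus a b <= softplus b * h + fermi a * h ^ 2 / 2).
{ apply Rle_trans with (1 := U2 ltac:(intros x Hx;
    generalize (softplus_tangents x b (proj2 Hx)) (Hm x Hx); unfold b in *; nra)); lra. }
apply Rabs_le; split; lra.
Qed.

(** The telescoped error is [O(t^2)] uniformly in [N], so it survives the limit to the infinite
    interval. *)
Lemma softplus_trapezoid_sum (t : R) (N : nat) : 0 <= t ->
  Rabs (RInt softplus 0 (INR (S N) * t)
        - t * sum_n (fun k => softplus (INR (S k) * t)) N
        - t * (softplus 0 - softplus (INR (S N) * t)) / 2)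
  <= t ^ 2 / 4 * (fermi 0 - fermi (INR (S N) * t)).
Proof.
intros Ht; induction N as [|N IH].
- rewrite sum_O; replace (INR 1 * t) with (0 + t) by (simpl; ring).
  generalize (softplus_trapezoid 0 t Ht).
  match goal with |- Rabs ?x <= _ -> Rabs ?y <= _ => replace y with x by field end; easy.
- rewrite Rsum_n_Sn.
  replace (INR (S (S N)) * t) with (INR (S N) * t + t) by (rewrite (S_INR (S N)); ring).
  set (a := INR (S N) * t) in *.
  rewrite <- (RInt_Chasles (V := R_CompleteNormedModule) softplus 0 a (a + t))
    by apply ex_RInt_softplus.
  unfold plus; simpl AbelianMonoid.plus.
  generalize (softplus_trapezoid a t Ht); intros H.
  set (I := RInt softplus 0 a) in *; set (J := RInt softplus a (a + t)) in *.
  set (s := sum_n _ N) in *.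
  apply Rabs_le_between in H; apply Rabs_le_between in IH; apply Rabs_le_between.
  change (RInt softplus 0 a) with I in IH.
  lra.
Qed.

Lemma is_derive_monomial (c z : R) (n : nat) :
  is_derive (fun y => c * y ^ S n / (INR n + 1)) z (c * z ^ n).
Proof.
auto_derive; [easy |].
change (match n with 0%nat => 1 | S _ => INR n + 1 end) with (INR (S n)).
rewrite S_INR; assert (Hn := pos_INR n); field; lra.
Qed.

(** The derivative of the remainder is [(- z)^(J+1) / (1 + z)], at most [z^(J+1)] in absolute value.
    The estimate includes [y = 1], reached by [exp (- x)] at [x = 0]. *)
Lemma log1p_Taylor (J : nat) (y : R) : 0 <= y ->
  Rabs (ln (1 + y) - sum_n (fun j => (-1) ^ j * y ^ S j / (INR j + 1)) J)
  <= y ^ S (S J) / (INR J + 2).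
Proof.
intros Hy.
set (P := fun y => sum_n (fun j => (-1) ^ j * y ^ S j / (INR j + 1)) J).
assert (HdP : forall z, 0 <= z -> is_derive P z ((1 - (- z) ^ S J) / (1 + z))).
{ intros z Hz; unfold P; clear - Hz; induction J as [|J IH].
  - apply is_derive_ext with (fun y => y).
    + intros u; rewrite sum_O; simpl; eq_in_R; lra.
    + auto_derive; [easy | simpl; eq_in_R; field; lra].
  - apply is_derive_ext with (fun y =>
      sum_n (fun j => (-1) ^ j * y ^ S j / (INR j + 1)) J
      + (-1) ^ S J * y ^ S (S J) / (INR (S J) + 1)).
    + intros u; now rewrite Rsum_n_Sn.
    + replace ((1 - (- z) ^ S (S J)) / (1 + z))
        with ((1 - (- z) ^ S J) / (1 + z) + (-1) ^ S J * z ^ S J).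
      * apply @is_derive_plus; [exact IH | apply is_derive_monomial].
      * replace (- z) with (-1 * z) by ring; rewrite !Rpow_mult_distr; simpl; field; lra. }
assert (HdE : forall z, 0 <= z ->
  is_derive (fun z => ln (1 + z) - P z) z ((- z) ^ S J / (1 + z))).
{ intros z Hz.
  replace ((- z) ^ S J / (1 + z)) with (/ (1 + z) - (1 - (- z) ^ S J) / (1 + z))
    by (field; lra).
  apply @is_derive_minus; [auto_derive; [lra | field; lra] | now apply HdP]. }
assert (HdR : forall z, is_derive (fun z => z ^ S (S J) / (INR J + 2)) z (z ^ S J)).
{ intros z; replace (z ^ S J) with (1 * z ^ S J) by ring.
  apply is_derive_ext with (2 := is_derive_monomial 1 z (S J)).
  intros u; rewrite S_INR; apply f_equal2; [apply Rmult_1_l | ring]. }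
assert (Hb : forall z, 0 <= z -> Rabs ((- z) ^ S J / (1 + z)) <= z ^ S J).
{ intros z Hz; unfold Rdiv.
  rewrite Rabs_mult, <- RPow_abs, Rabs_Ropp, (Rabs_pos_eq z) by exact Hz.
  rewrite (Rabs_pos_eq (/ (1 + z))) by (left; apply Rinv_0_lt_compat; lra).
  apply Rle_div_l; [lra |]; assert (0 <= z ^ S J) by now apply pow_le.
  nra. }
assert (HP0 : P 0 = 0).
{ unfold P; clear; induction J as [|J IH].
  - rewrite sum_O; simpl; eq_in_R; field.
  - rewrite Rsum_n_Sn, IH, (pow_i (S (S J))) by lia; unfold Rdiv.
    rewrite Rmult_0_r, Rmult_0_l; apply Rplus_0_l. }
apply Rabs_le_between; split.
- assert (0 <= (ln (1 + y) - P y) + y ^ S (S J) / (INR J + 2)); [| fold (P y); lra].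
  apply (nonneg_of_deriv (fun y => (ln (1 + y) - P y) + y ^ S (S J) / (INR J + 2))
    (fun z => (- z) ^ S J / (1 + z) + z ^ S J)).
  + intros z Hz; apply @is_derive_plus; [now apply HdE | apply HdR].
  + intros z Hz; specialize (Hb z Hz); apply Rabs_le_between in Hb; lra.
  + rewrite HP0, Rplus_0_r, ln_1, (pow_i (S (S J))) by lia; unfold Rdiv; ring.
  + exact Hy.
- assert (0 <= y ^ S (S J) / (INR J + 2) - (ln (1 + y) - P y)); [| fold (P y); lra].
  apply (nonneg_of_deriv (fun y => y ^ S (S J) / (INR J + 2) - (ln (1 + y) - P y))
    (fun z => z ^ S J - (- z) ^ S J / (1 + z))).
  + intros z Hz; apply @is_derive_minus; [apply HdR | now apply HdE].
  + intros z Hz; specialize (Hb z Hz); apply Rabs_le_between in Hb; lra.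
  + rewrite HP0, Rplus_0_r, ln_1, (pow_i (S (S J))) by lia; unfold Rdiv; ring.
  + exact Hy.
Qed.

(** * Behaviour of the product near the unit circle *)

Lemma is_derive_dilog_term (c x : R) (n : nat) :
  is_derive (fun x => c * (1 - exp (- x) ^ S n) / (INR n + 1) ^ 2) x
    (c * exp (- x) ^ S n / (INR n + 1)).
Proof.
auto_derive; [easy |].
change (match n with 0%nat => 1 | S _ => INR n + 1 end) with (INR (S n)).
rewrite S_INR; assert (Hn := pos_INR n); simpl; field; lra.
Qed.

(** Integrating a Taylor polynomial in [exp (- x)] avoids interchanging a series with an improper
    integral. The first error is the integrated Taylor remainder; the second bounds each of the
    [J + 1] boundary terms at [X] by [exp (- X)]. *)
Lemma RInt_softplus_bound (J : nat) (X : R) : 0 <= X ->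
  Rabs (RInt softplus 0 X - alt_inv_sq_sum J)
  <= / (INR J + 2) ^ 2 + (INR J + 1) * exp (- X).
Proof.
intros HX.
set (H := fun x => sum_n (fun j => (-1) ^ j * (1 - exp (- x) ^ S j) / (INR j + 1) ^ 2) J).
set (P := fun x => sum_n (fun j => (-1) ^ j * exp (- x) ^ S j / (INR j + 1)) J).
assert (HdH : forall x, is_derive H x (P x)).
{ intros x; unfold H, P; clear; induction J as [|J IH].
  - rewrite sum_O; apply is_derive_ext with (2 := is_derive_dilog_term ((-1) ^ 0) x 0).
    intros u; now rewrite sum_O.
  - rewrite Rsum_n_Sn.
    apply is_derive_ext with (fun x =>
      sum_n (fun j => (-1) ^ j * (1 - exp (- x) ^ S j) / (INR j + 1) ^ 2) J
      + (-1) ^ S J * (1 - exp (- x) ^ S (S J)) / (INR (S J) + 1) ^ 2).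
    + intros u; now rewrite Rsum_n_Sn.
    + apply @is_derive_plus; [exact IH | apply is_derive_dilog_term]. }
assert (HdI : forall x, is_derive (fun x => RInt softplus 0 x - H x) x (softplus x - P x)).
{ intros x; apply @is_derive_minus; [| apply HdH].
  apply (is_derive_RInt (V := R_NormedModule) softplus (RInt softplus 0) 0 x).
  - apply filter_forall; intros b.
    apply (RInt_correct (V := R_CompleteNormedModule)), ex_RInt_softplus.
  - apply (ex_derive_continuous (V := R_NormedModule)).
    eexists; apply is_derive_softplus. }
assert (HdR : forall x, is_derive (fun x => (1 - exp (- x) ^ S (S J)) / (INR J + 2) ^ 2) x
  (exp (- x) ^ S (S J) / (INR J + 2))).
{ intros x; assert (E : INR J + 2 = INR (S J) + 1) by (rewrite S_INR; ring).
  rewrite E; replace (exp (- x) ^ S (S J) / (INR (S J) + 1))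
    with (1 * exp (- x) ^ S (S J) / (INR (S J) + 1)) by (unfold Rdiv; ring).
  apply is_derive_ext with (2 := is_derive_dilog_term 1 x (S J)).
  intros u; apply f_equal2; [apply Rmult_1_l | reflexivity]. }
assert (Hb : forall x, Rabs (softplus x - P x) <= exp (- x) ^ S (S J) / (INR J + 2))
  by (intros x; apply log1p_Taylor; left; apply exp_pos).
assert (HH0 : H 0 = 0).
{ unfold H; clear; induction J as [|J IH].
  - rewrite sum_O, Ropp_0, exp_0; simpl; eq_in_R; field.
  - rewrite Rsum_n_Sn, IH, Ropp_0, exp_0, pow1; unfold Rdiv.
    rewrite Rminus_diag, Rmult_0_r, Rmult_0_l; apply Rplus_0_l. }
assert (HI0 : RInt softplus 0 0 = 0) by (rewrite RInt_point; reflexivity).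
assert (HJ := pos_INR J).
assert (HR : (1 - exp (- X) ^ S (S J)) / (INR J + 2) ^ 2 <= / (INR J + 2) ^ 2).
{ unfold Rdiv; rewrite <- (Rmult_1_l (/ _)) at 2; apply Rmult_le_compat_r.
  - left; apply Rinv_0_lt_compat, pow_lt; lra.
  - assert (0 <= exp (- X) ^ S (S J)) by (apply pow_le; left; apply exp_pos); lra. }
assert (HIH : Rabs (RInt softplus 0 X - H X) <= / (INR J + 2) ^ 2).
{ apply Rabs_le_between; split.
  - assert (0 <= (RInt softplus 0 X - H X) + (1 - exp (- X) ^ S (S J)) / (INR J + 2) ^ 2);
      [| lra].
    apply (nonneg_of_deriv (fun x => (RInt softplus 0 x - H x)
        + (1 - exp (- x) ^ S (S J)) / (INR J + 2) ^ 2)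
      (fun x => (softplus x - P x) + exp (- x) ^ S (S J) / (INR J + 2))).
    + intros x _; apply @is_derive_plus; [apply HdI | apply HdR].
    + intros x _; specialize (Hb x); apply Rabs_le_between in Hb; lra.
    + rewrite HI0, HH0, Ropp_0, exp_0, pow1; unfold Rdiv; ring.
    + exact HX.
  - assert (0 <= (1 - exp (- X) ^ S (S J)) / (INR J + 2) ^ 2 - (RInt softplus 0 X - H X));
      [| lra].
    apply (nonneg_of_deriv (fun x => (1 - exp (- x) ^ S (S J)) / (INR J + 2) ^ 2
        - (RInt softplus 0 x - H x))
      (fun x => exp (- x) ^ S (S J) / (INR J + 2) - (softplus x - P x))).
    + intros x _; apply @is_derive_minus; [apply HdR | apply HdI].
    + intros x _; specialize (Hb x); apply Rabs_le_between in Hb; lra.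
    + rewrite HI0, HH0, Ropp_0, exp_0, pow1; unfold Rdiv; ring.
    + exact HX. }
assert (HHa : Rabs (H X - alt_inv_sq_sum J) <= (INR J + 1) * exp (- X)).
{ unfold H, alt_inv_sq_sum; clear - HX.
  assert (Hterm : forall j,
    Rabs ((-1) ^ j * (1 - exp (- X) ^ S j) / (INR j + 1) ^ 2 - (-1) ^ j / (INR j + 1) ^ 2)
    <= exp (- X)).
  { intros j; assert (Hj := pos_INR j).
    replace ((-1) ^ j * (1 - exp (- X) ^ S j) / (INR j + 1) ^ 2 - (-1) ^ j / (INR j + 1) ^ 2)
      with (- ((-1) ^ j * (exp (- X) ^ S j / (INR j + 1) ^ 2))) by (field; lra).
    rewrite Rabs_Ropp, Rabs_mult, pow_1_abs, Rmult_1_l.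
    assert (He : 0 < exp (- X) <= 1) by (split; [apply exp_pos | now apply exp_neg_le_1]).
    assert (Hp : 0 <= exp (- X) ^ S j <= exp (- X) ^ 1)
      by (split; [apply pow_le | apply pow_le_pow; [| lia]]; lra).
    rewrite pow_1 in Hp.
    assert (H1 : 1 <= (INR j + 1) ^ 2) by (apply pow_R1_Rle; lra).
    rewrite Rabs_pos_eq by (apply Rdiv_le_0_compat; lra).
    apply Rle_div_l; nra. }
  induction J as [|J IH].
  - rewrite !sum_O; specialize (Hterm 0%nat).
    replace ((INR 0 + 1) * exp (- X)) with (exp (- X)) by (simpl; ring); exact Hterm.
  - rewrite !Rsum_n_Sn.
    match goal with |- Rabs (?a + ?b - (?c + ?d)) <= _ =>
      replace (a + b - (c + d)) with ((a - c) + (b - d)) by ring end.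
    apply Rle_trans with (1 := Rabs_triang _ _).
    specialize (Hterm (S J)); rewrite (S_INR J) in *; lra. }
replace (RInt softplus 0 X - alt_inv_sq_sum J)
  with ((RInt softplus 0 X - H X) + (H X - alt_inv_sq_sum J)) by ring.
apply Rle_trans with (1 := Rabs_triang _ _); lra.
Qed.

Lemma is_lim_seq_inv_S (c : R) : is_lim_seq (fun N => c * / INR (S N)) 0.
Proof.
replace (Finite 0) with (Rbar_mult c (Rbar_inv p_infty)) by (simpl; f_equal; ring).
apply is_lim_seq_scal_l, is_lim_seq_inv; [| easy].
apply -> is_lim_seq_incr_1; apply is_lim_seq_INR.
Qed.

Lemma RInt_softplus_lim (t : R) : 0 < t ->
  is_lim_seq (fun N => RInt softplus 0 (INR (S N) * t)) (PI ^ 2 / 12).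
Proof.
intros Ht.
set (d := fun N => RInt softplus 0 (INR (S N) * t) - alt_inv_sq_sum (S (2 * N))).
assert (Hd : is_lim_seq d 0).
{ apply is_lim_seq_abs_0.
  (* The degree [J = 2 N + 1] grows with [X = (N + 1) t], so that both errors are [O(1 / N)];
     [54 = 2 * 27] with 27 from [cube_exp_le]. *)
  apply is_lim_seq_le_le with (fun _ => 0) (fun N => (1 + 54 / t ^ 3) * / INR (S N)).
  - intros N; split; [apply Rabs_pos |].
    set (y := INR (S N)); assert (Hy : 1 <= y) by (apply (le_INR 1); lia).
    apply Rle_trans with (1 := RInt_softplus_bound (S (2 * N)) (y * t) ltac:(nra)).
    assert (E : INR (S (2 * N)) + 1 = 2 * y)
      by (unfold y; rewrite !S_INR, mult_INR; simpl; ring).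
    replace (INR (S (2 * N)) + 2) with (2 * y + 1) by lra; rewrite E.
    rewrite Rmult_plus_distr_r, Rmult_1_l; apply Rplus_le_compat.
    + apply Rinv_le_contravar; nra.
    + assert (Hc := cube_exp_le (y * t) ltac:(nra)).
      assert (Hexp := exp_pos (- (y * t))).
      rewrite Rpow_mult_distr in Hc.
      assert (Ht3 : 0 < t ^ 3) by now apply pow_lt.
      apply Rmult_le_reg_r with (y * t ^ 3); [nra |].
      replace (54 / t ^ 3 * / y * (y * t ^ 3)) with 54 by (field; lra).
      apply Rle_trans with (2 * (y ^ 3 * t ^ 3 * exp (- (y * t)))); [| lra].
      replace (2 * y * exp (- (y * t)) * (y * t ^ 3))
        with (2 * (y ^ 2 * t ^ 3 * exp (- (y * t)))) by ring.
      apply Rmult_le_compat_l; [lra |].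
      apply Rmult_le_compat_r; [lra |].
      apply Rmult_le_compat_r; [lra |]; simpl; nra.
  - apply is_lim_seq_const.
  - apply is_lim_seq_inv_S. }
apply is_lim_seq_ext with (fun N => d N + alt_inv_sq_sum (S (2 * N))).
{ intros N; unfold d; ring. }
replace (Finite (PI ^ 2 / 12)) with (Finite (0 + PI ^ 2 / 12)) by (f_equal; ring).
apply is_lim_seq_plus'; [exact Hd | apply alt_Basel].
Qed.

(** The explicit bound for every [t > 0] can be used at [2 t] and at [t + h], [t - h] with [h]
    depending on [t]. *)
Definition log_prod_asymp (e : nat -> nat) (a c B : R) : Prop :=
  forall t, 0 < t -> Rabs (log_prod e t - (a / t + c)) <= B * t.

Lemma distinct_exponents_id : distinct_exponents (fun n => n).
Proof. intros n; apply Nat.le_refl. Qed.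

Lemma distinct_exponents_odd : distinct_exponents (fun n => 2 * n - 1)%nat.
Proof. intros n; lia. Qed.

Lemma softplus_0 : softplus 0 = ln 2.
Proof. unfold softplus; rewrite Ropp_0, exp_0; f_equal; ring. Qed.

(** The trapezoid sum gives half weight to the endpoint 0, where [softplus] is [ln 2]: hence
    [- ln 2 / 2]. The constant [1 / 8] is [fermi 0 / 4]. *)
Lemma log_prod_asymp_id :
  log_prod_asymp (fun n => n) (PI ^ 2 / 12) (- ln 2 / 2) (1 / 8).
Proof.
intros t Ht; set (L := log_prod (fun n => n) t).
assert (HL : is_lim_seq (sum_n (fun k => softplus (INR (S k) * t))) L)
  by exact (Series_correct _ (ex_series_log_prod _ t distinct_exponents_id Ht)).
assert (H0 : is_lim_seq (fun N => softplus (INR (S N) * t)) 0).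
{ apply (is_lim_seq_incr_1 (fun N => softplus (INR N * t))).
  apply is_lim_seq_incr_1.
  apply ex_series_lim_0 with (a := fun k => softplus (INR (S k) * t)); exists L; exact HL. }
assert (Hb : Rabs (PI ^ 2 / 12 - t * L - t * (ln 2 - 0) / 2) <= t ^ 2 / 8).
{ refine (is_lim_seq_le _ (fun _ => t ^ 2 / 8) (Rabs _) (t ^ 2 / 8)
    (fun N => Rle_trans _ _ _ (softplus_trapezoid_sum t N (Rlt_le _ _ Ht)) _) _ _).
  - assert (H1 : fermi 0 = / 2) by (unfold fermi; rewrite exp_0; f_equal; ring).
    assert (H2 := proj1 (fermi_bounds (INR (S N) * t))).
    rewrite H1; assert (0 <= t ^ 2) by nra; nra.
  - apply (is_lim_seq_abs _ (PI ^ 2 / 12 - t * L - t * (ln 2 - 0) / 2)).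
    apply is_lim_seq_minus'; [apply is_lim_seq_minus' |].
    + now apply RInt_softplus_lim.
    + apply (is_lim_seq_scal_l _ t L), HL.
    + apply (is_lim_seq_mult' _ _ (t * (ln 2 - 0)) (/ 2)); [| apply is_lim_seq_const].
      apply (is_lim_seq_scal_l _ t (ln 2 - 0)).
      rewrite softplus_0; apply is_lim_seq_minus'; [apply is_lim_seq_const | exact H0].
  - apply is_lim_seq_const. }
replace (L - (PI ^ 2 / 12 / t + - ln 2 / 2))
  with (- / t * (PI ^ 2 / 12 - t * L - t * (ln 2 - 0) / 2)) by (field; lra).
rewrite Rabs_mult, Rabs_Ropp, Rabs_pos_eq by (left; now apply Rinv_0_lt_compat).
apply Rle_trans with (/ t * (t ^ 2 / 8)).
- apply Rmult_le_compat_l; [left; now apply Rinv_0_lt_compat | exact Hb].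
- right; field; lra.
Qed.

(** The even exponents at [t] are all exponents at [2 t]. In the expansion this halves [a] and
    cancels the constant term. *)
Lemma log_prod_odd (t : R) : 0 < t ->
  log_prod (fun n => 2 * n - 1)%nat t
  = log_prod (fun n => n) t - log_prod (fun n => n) (2 * t).
Proof.
intros Ht.
assert (H1 : is_lim_seq (sum_n (fun k => softplus (INR (S k) * t))) (log_prod (fun n => n) t))
  by exact (Series_correct _ (ex_series_log_prod _ t distinct_exponents_id Ht)).
assert (H2 : is_lim_seq (sum_n (fun k => softplus (INR (S k) * (2 * t))))
  (log_prod (fun n => n) (2 * t)))
  by exact (Series_correct _ (ex_series_log_prod _ (2 * t) distinct_exponents_id ltac:(lra))).
assert (E : forall N, sum_n (fun k => softplus (INR (S k) * t)) (S (2 * N))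
  - sum_n (fun k => softplus (INR (S k) * (2 * t))) N
  = sum_n (fun k => softplus (INR (2 * S k - 1) * t)) N).
{ intros N; induction N as [|N IH].
  - change (S (2 * 0)) with 1%nat; rewrite Rsum_n_Sn, !sum_O; simpl.
    replace (1 * (2 * t)) with ((1 + 1) * t) by ring; eq_in_R; ring.
  - replace (S (2 * S N)) with (S (S (S (2 * N)))) by lia.
    rewrite !(Rsum_n_Sn _ (S (S (2 * N)))), !(Rsum_n_Sn _ (S (2 * N))),
      !(Rsum_n_Sn _ N), <- IH.
    replace (2 * S (S N) - 1)%nat with (S (S (S (2 * N)))) by lia.
    replace (INR (S (S N)) * (2 * t)) with (INR (S (S (S (S (2 * N))))) * t)
      by (rewrite !S_INR, mult_INR; simpl; ring).
    ring. }
apply is_series_unique.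
apply (is_lim_seq_ext (fun N => sum_n (fun k => softplus (INR (S k) * t)) (S (2 * N))
  - sum_n (fun k => softplus (INR (S k) * (2 * t))) N) _
  (log_prod (fun n => n) t - log_prod (fun n => n) (2 * t)) E).
apply is_lim_seq_minus'; [| exact H2].
apply (is_lim_seq_subseq (sum_n (fun k => softplus (INR (S k) * t))) _ (fun N => S (2 * N)));
  [apply eventually_subseq; intros n; lia | exact H1].
Qed.

(** [3 / 8 = 1 / 8 + 2 / 8], the errors at [t] and at [2 t]. *)
Lemma log_prod_asymp_odd :
  log_prod_asymp (fun n => 2 * n - 1)%nat (PI ^ 2 / 24) 0 (3 / 8).
Proof.
intros t Ht; rewrite log_prod_odd by exact Ht.
generalize (log_prod_asymp_id t Ht) (log_prod_asymp_id (2 * t) ltac:(lra)).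
intros H1 H2.
set (u := log_prod _ t) in *; set (v := log_prod _ (2 * t)) in *.
replace (u - v - (PI ^ 2 / 24 / t + 0))
  with ((u - (PI ^ 2 / 12 / t + - ln 2 / 2)) + - (v - (PI ^ 2 / 12 / (2 * t) + - ln 2 / 2)))
  by (field; lra).
apply Rle_trans with (1 := Rabs_triang _ _); rewrite Rabs_Ropp; lra.
Qed.

(** * The Gaussian integral *)

Lemma ex_RInt_exp_sq (c a b : R) : ex_RInt (fun u => exp (- (c * u ^ 2))) a b.
Proof.
apply (ex_RInt_continuous (V := R_CompleteNormedModule)); intros u _.
apply (ex_derive_continuous (V := R_NormedModule)); auto_derive; easy.
Qed.

Lemma is_derive_gauss_aux (x : R) :
  is_derive (fun x => RInt (fun v => exp (- (x ^ 2 * (1 + v ^ 2))) / (1 + v ^ 2)) 0 1) x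
    (RInt (fun v => - (2 * x * exp (- (x ^ 2 * (1 + v ^ 2))))) 0 1).
Proof.
set (f := fun x v => exp (- (x ^ 2 * (1 + v ^ 2))) / (1 + v ^ 2)).
assert (Hp : forall v, 1 + v ^ 2 <> 0) by (intros v; nra).
assert (Hd : forall y v, is_derive (fun z => f z v) y
  (- (2 * y * exp (- (y ^ 2 * (1 + v ^ 2)))))).
{ intros y v; unfold f; auto_derive; [easy |].
  replace (1 + v * (v * 1)) with (1 + v ^ 2) by ring.
  replace (y * (y * 1)) with (y ^ 2) by ring.
  field; apply Hp. }
replace (RInt (fun v => - (2 * x * exp (- (x ^ 2 * (1 + v ^ 2))))) 0 1)
  with (RInt (fun v => Derive (fun u => f u v) x) 0 1)
  by (apply RInt_ext; intros v _; apply is_derive_unique, Hd).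
apply (is_derive_RInt_param f 0 1 x).
- apply filter_forall; intros y v _; eexists; apply Hd.
- intros v _.
  apply continuity_2d_pt_ext with
    (fun u v => - (2 * u * exp (- (u ^ 2 * (1 + v ^ 2))))).
  { intros u w; symmetry; apply is_derive_unique, Hd. }
  apply continuity_2d_pt_opp, continuity_2d_pt_mult.
  + apply continuity_2d_pt_mult; [apply continuity_2d_pt_const | apply continuity_2d_pt_id1].
  + apply (continuity_1d_2d_pt_comp exp).
    * apply derivable_continuous_pt, derivable_pt_exp.
    * apply continuity_2d_pt_opp, continuity_2d_pt_mult.
      -- simpl; apply continuity_2d_pt_mult; [apply continuity_2d_pt_id1 |].
         apply continuity_2d_pt_mult; [apply continuity_2d_pt_id1 | apply continuity_2d_pt_const].
      -- apply continuity_2d_pt_plus; [apply continuity_2d_pt_const |].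
         simpl; apply continuity_2d_pt_mult; [apply continuity_2d_pt_id2 |].
         apply continuity_2d_pt_mult; [apply continuity_2d_pt_id2 | apply continuity_2d_pt_const].
- apply filter_forall; intros y.
  apply (ex_RInt_continuous (V := R_CompleteNormedModule)); intros v _.
  apply (ex_derive_continuous (V := R_NormedModule)); unfold f; auto_derive.
  replace (1 + v * (v * 1)) with (1 + v ^ 2) by ring; apply Hp.
Qed.

(** The sum has derivative 0: the substitution [u = x v] turns the derivative of the second integral
    into minus that of the square. At [x = 0] the second integral is [atan 1]. *)
Lemma gauss_identity (x : R) :
  (RInt (fun u => exp (- (1 * u ^ 2))) 0 x) ^ 2
  + RInt (fun v => exp (- (x ^ 2 * (1 + v ^ 2))) / (1 + v ^ 2)) 0 1 = PI / 4.
Proof.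
set (F := (fun x => RInt (fun u => exp (- (1 * u ^ 2))) 0 x) : R -> R).
set (G := (fun x => RInt (fun v => exp (- (x ^ 2 * (1 + v ^ 2))) / (1 + v ^ 2)) 0 1) : R -> R).
assert (HF : forall y, is_derive F y (exp (- (1 * y ^ 2)))).
{ intros y; apply (is_derive_RInt (V := R_NormedModule) (fun u => exp (- (1 * u ^ 2))) F 0 y).
  - apply filter_forall; intros b.
    apply (RInt_correct (V := R_CompleteNormedModule)), ex_RInt_exp_sq.
  - apply (ex_derive_continuous (V := R_NormedModule)); auto_derive; easy. }
assert (HG : forall y, is_derive G y (- (2 * exp (- (1 * y ^ 2)) * F y))).
{ intros y.
  replace (- (2 * exp (- (1 * y ^ 2)) * F y))
    with (RInt (fun v => - (2 * y * exp (- (y ^ 2 * (1 + v ^ 2))))) 0 1);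
    [apply is_derive_gauss_aux |].
  replace (F y) with (RInt (fun u => exp (- (1 * u ^ 2))) (y * 0 + 0) (y * 1 + 0))
    by (unfold F; f_equal; ring).
  rewrite <- (RInt_comp_lin (V := R_CompleteNormedModule)) by apply ex_RInt_exp_sq.
  set (I := RInt _ 0 1 : R) at 2.
  replace (- (2 * exp (- (1 * y ^ 2)) * I)) with (scal (- (2 * exp (- (1 * y ^ 2)))) I)
    by (change (- (2 * exp (- (1 * y ^ 2))) * I = - (2 * exp (- (1 * y ^ 2)) * I)); ring).
  unfold I; rewrite <- (RInt_scal (V := R_CompleteNormedModule)).
  - apply RInt_ext; intros v _; unfold scal; simpl; unfold mult; simpl.
    replace (- (y * (y * 1) * (1 + v * (v * 1))))
      with (- (1 * (y * (y * 1))) + - (1 * ((y * v + 0) * ((y * v + 0) * 1)))) by ring.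
    rewrite exp_plus; ring.
  - apply (ex_RInt_continuous (V := R_CompleteNormedModule)); intros v _.
    apply (ex_derive_continuous (V := R_NormedModule)).
    unfold scal; simpl; unfold mult; simpl; auto_derive; easy. }
assert (HH : forall y, is_derive (fun y => F y ^ 2 + G y) y 0).
{ intros y; evar_last.
  - apply @is_derive_plus; [apply is_derive_pow, HF | apply HG].
  - unfold plus; simpl; ring. }
assert (E : F x ^ 2 + G x = F 0 ^ 2 + G 0).
{ destruct (MVT_gen (fun y => F y ^ 2 + G y) 0 x (fun _ => 0)) as [c [_ Hc]].
  - intros y _; apply HH.
  - intros y _; apply continuity_pt_filterlim.
    apply (ex_derive_continuous (V := R_NormedModule) (fun y => F y ^ 2 + G y)).
    eexists; apply HH.
  - lra. }
unfold F, G in E |- *; rewrite E, RInt_point; unfold zero; simpl.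
rewrite Rmult_0_l, Rplus_0_l.
replace (PI / 4) with (minus (atan 1) (atan 0))
  by (rewrite atan_1, atan_0; unfold minus, plus, opp; simpl; ring).
apply is_RInt_unique.
apply is_RInt_ext with (fun v => / (1 + v ^ 2)).
- intros v _; rewrite !Rmult_0_l, Ropp_0, exp_0; simpl; unfold Rdiv; ring.
- apply (is_RInt_derive (V := R_CompleteNormedModule) atan).
  + intros v _; replace (/ (1 + v ^ 2)) with (/ (1 + v²))
      by (f_equal; unfold Rsqr; ring).
    apply is_derive_atan.
  + intros v _; apply (ex_derive_continuous (V := R_NormedModule)); auto_derive.
    nra.
Qed.

Lemma exp_neg_le_inv (y : R) : 0 < y -> exp (- y) <= / y.
Proof.
intros Hy; rewrite exp_Ropp; apply Rinv_le_contravar; [exact Hy |].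
generalize (exp_ineq1_le y); lra.
Qed.

(** The second integral [G] is at most [1 / x^2], and [F - sqrt PI / 2 = - G / (F + sqrt PI / 2)]
    with a denominator of at least [1 / 2]. *)
Lemma gauss_half_bound (x : R) : 0 < x ->
  Rabs (RInt (fun u => exp (- (1 * u ^ 2))) 0 x - sqrt PI / 2) <= 2 / x ^ 2.
Proof.
intros Hx; generalize (gauss_identity x).
set (F := RInt (fun u => exp (- (1 * u ^ 2))) 0 x : R).
set (G := RInt _ 0 1 : R).
assert (Hp : forall v, 0 < 1 + v ^ 2) by (intros v; nra).
assert (HG : 0 <= G <= / x ^ 2).
{ assert (Hex : ex_RInt (fun v => exp (- (x ^ 2 * (1 + v ^ 2))) / (1 + v ^ 2)) 0 1).
  { apply (ex_RInt_continuous (V := R_CompleteNormedModule)); intros v _.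
    apply (ex_derive_continuous (V := R_NormedModule)); auto_derive.
    replace (1 + v * (v * 1)) with (1 + v ^ 2) by ring; apply Rgt_not_eq, Hp. }
  split.
  - apply RInt_ge_0; [lra | exact Hex |].
    intros v _; apply Rdiv_le_0_compat; [left; apply exp_pos | apply Hp].
  - replace (/ x ^ 2) with (RInt (fun _ => / x ^ 2) 0 1)
      by (rewrite RInt_const; unfold scal; simpl; unfold mult; simpl; ring).
    apply RInt_le; [lra | exact Hex | apply ex_RInt_const |].
    intros v _; rewrite <- (Rmult_1_r (/ x ^ 2)).
    apply Rmult_le_compat; [left; apply exp_pos | left; apply Rinv_0_lt_compat, Hp | |].
    + apply Rle_trans with (exp (- x ^ 2)); [| apply exp_neg_le_inv; nra].
      apply exp_le; nra.
    + rewrite <- Rinv_1; apply Rinv_le_contravar; nra. }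
intros E.
assert (HF : 0 <= F).
{ apply RInt_ge_0; [lra | apply ex_RInt_exp_sq | intros; left; apply exp_pos]. }
assert (Hs := sqrt_sqrt PI (Rlt_le _ _ PI_RGT_0)).
assert (Hs1 : 1 <= sqrt PI).
{ rewrite <- sqrt_1; apply sqrt_le_1_alt; generalize PI2_1; lra. }
set (p := sqrt PI) in *.
assert (E2 : (F - p / 2) * (F + p / 2) = - G) by (rewrite <- Hs in E; nra).
apply Rle_trans with (2 * G); [| unfold Rdiv; lra].
apply Rabs_le; split; nra.
Qed.

(** Rescaling by [sqrt A]; the condition [1 <= A] makes the bound independent of [A]. *)
Lemma gauss_bound (A M : R) : 1 <= A -> 0 < M ->
  Rabs (RInt (fun u => exp (- (A * u ^ 2))) (- M) M - sqrt (PI / A)) <= 4 / M ^ 2.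
Proof.
intros HA HM.
set (k := sqrt A).
assert (Hk : k * k = A) by (apply sqrt_sqrt; lra).
assert (Hk1 : 1 <= k) by (unfold k; rewrite <- sqrt_1; now apply sqrt_le_1_alt).
set (F := RInt (fun u => exp (- (1 * u ^ 2))) 0 (k * M) : R).
assert (E : RInt (fun u => exp (- (A * u ^ 2))) (- M) M = 2 * F / k).
{ assert (E1 : RInt (fun u => exp (- (A * u ^ 2))) 0 M = F / k).
  { apply (Rmult_eq_reg_l k); [| lra].
    replace (k * (F / k)) with F by (field; lra).
    change (k * RInt (fun u => exp (- (A * u ^ 2))) 0 M)
      with (scal k (RInt (fun u => exp (- (A * u ^ 2))) 0 M)).
    rewrite <- (RInt_scal (V := R_CompleteNormedModule)) by apply ex_RInt_exp_sq.
    replace F with (RInt (fun u => exp (- (1 * u ^ 2))) (k * 0 + 0) (k * M + 0))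
      by (unfold F; f_equal; ring).
    rewrite <- (RInt_comp_lin (V := R_CompleteNormedModule)) by apply ex_RInt_exp_sq.
    apply RInt_ext; intros u _; rewrite <- Hk; do 3 f_equal; ring. }
  assert (E2 : RInt (fun u => exp (- (A * u ^ 2))) (- M) 0
    = RInt (fun u => exp (- (A * u ^ 2))) 0 M).
  { rewrite <- (opp_RInt_swap (V := R_CompleteNormedModule)) by apply ex_RInt_exp_sq.
    replace (RInt (fun u => exp (- (A * u ^ 2))) 0 (- M))
      with (RInt (fun u => exp (- (A * u ^ 2))) (-1 * 0 + 0) (-1 * M + 0))
      by (f_equal; ring).
    rewrite <- (RInt_comp_lin (V := R_CompleteNormedModule)) by apply ex_RInt_exp_sq.
    rewrite <- (RInt_opp (V := R_CompleteNormedModule)).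
    - apply RInt_ext; intros u _; unfold opp, scal; simpl; unfold mult; simpl.
      replace ((-1 * u + 0) * ((-1 * u + 0) * 1)) with (u * (u * 1)) by ring; ring.
    - apply (ex_RInt_continuous (V := R_CompleteNormedModule)); intros v _.
      apply (ex_derive_continuous (V := R_NormedModule)).
      unfold scal; simpl; unfold mult; simpl; auto_derive; easy. }
  rewrite <- (RInt_Chasles (V := R_CompleteNormedModule) _ (- M) 0 M)
    by apply ex_RInt_exp_sq.
  rewrite E2, E1; unfold plus; simpl; field; lra. }
rewrite E, sqrt_div_alt by lra; fold k.
replace (2 * F / k - sqrt PI / k) with (2 / k * (F - sqrt PI / 2)) by (field; lra).
rewrite Rabs_mult, Rabs_pos_eq by (apply Rdiv_le_0_compat; lra).
assert (HkM : 0 < k * M) by nra.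
generalize (gauss_half_bound (k * M) HkM); fold F; intros HF.
apply Rle_trans with (2 * (2 / (k * M) ^ 2)).
- apply Rmult_le_compat; [apply Rdiv_le_0_compat; lra | apply Rabs_pos | | exact HF].
  apply Rle_div_l; lra.
- replace (2 * (2 / (k * M) ^ 2)) with (4 * / (k * M) ^ 2) by (field; nra).
  apply Rmult_le_compat_l; [lra |].
  apply Rinv_le_contravar; [apply pow_lt; exact HM |].
  apply pow_incr; nra.
Qed.

(** * Mean and variance *)

Lemma fermi_tangents (x y : R) : 0 <= x <= y ->
  fermi_var y * (y - x) <= fermi x - fermi y <= fermi_var x * (y - x).
Proof.
intros Hxy.
assert (H := deriv_bounds fermi (fun x => - fermi_var x) x y (proj2 Hxy)
  (fun z _ => is_derive_fermi z)).
assert (H' : forall u v, x <= u -> u <= v -> v <= y -> - fermi_var u <= - fermi_var v)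
  by (intros u v Hu Huv _; apply Ropp_le_contravar, fermi_var_decr; lra).
specialize (H H'); lra.
Qed.

Section Moments.

Variable e : nat -> nat.
Hypothesis He : distinct_exponents e.

(* Convexity in [t] of each summand gives [mean] and [variance] from difference
   quotients of [log_prod] and [mean], without differentiating a series. *)
Lemma log_prod_tangents (s t : R) : 0 < s <= t ->
  mean e t * (t - s) <= log_prod e s - log_prod e t <= mean e s * (t - s).
Proof.
intros Hst.
assert (Hg : forall u, 0 < u -> ex_series (fun k => softplus (INR (e (S k)) * u)))
  by (intros u Hu; now apply ex_series_log_prod).
assert (Hf : forall u, 0 < u -> ex_series (fun k => INR (e (S k)) * fermi (INR (e (S k)) * u)))
  by (intros u Hu; now apply ex_series_mean).
assert (Hterm : forall k, fermi (INR (e (S k)) * t) * (INR (e (S k)) * t - INR (e (S k)) * s)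
  <= softplus (INR (e (S k)) * s) - softplus (INR (e (S k)) * t)
  <= fermi (INR (e (S k)) * s) * (INR (e (S k)) * t - INR (e (S k)) * s)).
{ intros k; apply softplus_tangents.
  apply Rmult_le_compat_l; [apply pos_INR | lra]. }
assert (Hd : ex_series (fun k => softplus (INR (e (S k)) * s) - softplus (INR (e (S k)) * t)))
  by (apply (ex_series_minus (V := R_NormedModule)); apply Hg; lra).
unfold mean, log_prod; rewrite <- Series_minus, <- !Series_scal_r by (apply Hg; lra).
assert (Hpos : forall k u, 0 <= INR (e (S k)) * fermi (INR (e (S k)) * u))
  by (intros k u; apply Rmult_le_pos; [apply pos_INR | apply fermi_bounds]).
split; apply Series_le.
- intros k; specialize (Hterm k); split; [apply Rmult_le_pos; [apply Hpos | lra] | lra].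
- exact Hd.
- intros k; specialize (Hterm k); specialize (Hpos k t); split; [nra | lra].
- apply (ex_series_scal_r (t - s)), Hf; lra.
Qed.

Lemma mean_tangents (s t : R) : 0 < s <= t ->
  variance e t * (t - s) <= mean e s - mean e t <= variance e s * (t - s).
Proof.
intros Hst.
assert (Hg : forall u, 0 < u -> ex_series (fun k => INR (e (S k)) * fermi (INR (e (S k)) * u)))
  by (intros u Hu; now apply ex_series_mean).
assert (Hf : forall u, 0 < u -> ex_series (fun k => INR (e (S k)) ^ 2 * fermi_var (INR (e (S k)) * u)))
  by (intros u Hu; now apply ex_series_variance).
assert (Hterm : forall k,
  INR (e (S k)) ^ 2 * fermi_var (INR (e (S k)) * t) * (t - s)
  <= INR (e (S k)) * fermi (INR (e (S k)) * s) - INR (e (S k)) * fermi (INR (e (S k)) * t)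
  <= INR (e (S k)) ^ 2 * fermi_var (INR (e (S k)) * s) * (t - s)).
{ intros k; assert (Hm := pos_INR (e (S k))).
  generalize (fermi_tangents (INR (e (S k)) * s) (INR (e (S k)) * t) ltac:(split; nra)).
  set (m := INR (e (S k))) in *; intros [H1 H2].
  apply (Rmult_le_compat_l m) in H1; [| exact Hm].
  apply (Rmult_le_compat_l m) in H2; [| exact Hm].
  split; lra. }
assert (Hd : ex_series (fun k => INR (e (S k)) * fermi (INR (e (S k)) * s)
  - INR (e (S k)) * fermi (INR (e (S k)) * t)))
  by (apply (ex_series_minus (V := R_NormedModule)); apply Hg; lra).
unfold mean, variance; rewrite <- Series_minus, <- !Series_scal_r by (apply Hg; lra).
assert (Hpos : forall k u, 0 <= INR (e (S k)) ^ 2 * fermi_var (INR (e (S k)) * u))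
  by (intros k u; apply Rmult_le_pos; [apply pow2_ge_0 | apply fermi_var_bounds]).
split; apply Series_le.
- intros k; specialize (Hterm k); split; [apply Rmult_le_pos; [apply Hpos | lra] | lra].
- exact Hd.
- intros k; specialize (Hterm k); specialize (Hpos k t); split; [nra | lra].
- apply (ex_series_scal_r (t - s)), Hf; lra.
Qed.

Variables (a c B : R).
Hypothesis Ha : 0 < a.
Hypothesis HB : 0 <= B.
Hypothesis Hlog : log_prod_asymp e a c B.

Lemma mean_bound (t : R) : 0 < t <= 1 ->
  Rabs (mean e t - a / t ^ 2) <= (a + 5 * B) / t.
Proof.
(* This step size balances the two errors of the difference quotient: [B t / h] from the expansion
   and [a h / t^3] from curvature are both of order [1 / t]. *)
intros Ht; set (h := t ^ 2 / 2).
assert (Hh : 0 < h <= t / 2) by (unfold h; nra).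
assert (E0 := Hlog t ltac:(lra)); apply Rabs_le_between in E0.
assert (E1 := Hlog (t + h) ltac:(lra)); apply Rabs_le_between in E1.
assert (E2 := Hlog (t - h) ltac:(lra)); apply Rabs_le_between in E2.
assert (T1 := proj2 (log_prod_tangents t (t + h) ltac:(lra))).
assert (T2 := proj1 (log_prod_tangents (t - h) t ltac:(lra))).
replace (t + h - t) with h in T1 by ring; replace (t - (t - h)) with h in T2 by ring.
assert (F1 : a / t - a / (t + h) >= h * (a / t ^ 2 - a / (2 * t))).
{ replace (a / (2 * t)) with (a * h / t ^ 3) by (unfold h; field; lra).
  apply Rle_ge, Rminus_le_0.
  replace (a / t - a / (t + h) - h * (a / t ^ 2 - a * h / t ^ 3))
    with (a * h ^ 3 / (t ^ 3 * (t + h))) by (field; lra).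
  apply Rdiv_le_0_compat; [| apply Rmult_lt_0_compat; [apply pow_lt |]; lra].
  apply Rmult_le_pos; [lra | apply pow_le; lra]. }
assert (F2 : a / (t - h) - a / t <= h * (a / t ^ 2 + a / t)).
{ replace (a / t ^ 2 + a / t) with (a / t ^ 2 + 2 * a * h / t ^ 3)
    by (unfold h; field; lra).
  apply Rminus_le_0.
  replace (h * (a / t ^ 2 + 2 * a * h / t ^ 3) - (a / (t - h) - a / t))
    with (a * h ^ 2 * (t - 2 * h) / (t ^ 3 * (t - h))) by (field; lra).
  apply Rdiv_le_0_compat; [| apply Rmult_lt_0_compat; [apply pow_lt |]; lra].
  apply Rmult_le_pos; [apply Rmult_le_pos; [lra | apply pow2_ge_0] | lra]. }
assert (F3 : B * (5 / 2 * t) = h * (5 * B / t)) by (unfold h; field; lra).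
assert (F4 : B * h <= B * (t / 2)) by nra.
assert (Hat : 0 < a / t) by (apply Rdiv_lt_0_compat; lra).
assert (Hat2 : a / (2 * t) = a / t / 2) by (field; lra).
replace ((a + 5 * B) / t) with (a / t + 5 * B / t) by (field; lra).
apply Rabs_le; split; apply Rmult_le_reg_l with h; try lra; nra.
Qed.

Lemma variance_bound (t : R) : 0 < t <= 1 / 16 ->
  Rabs (variance e t * t ^ 3 - 2 * a) <= (8 * a + 3 * (a + 5 * B)) * sqrt t.
Proof.
intros Ht; set (B1 := a + 5 * B); set (d := sqrt t).
assert (Hd : d * d = t) by (apply sqrt_sqrt; lra).
assert (Hd0 : 0 < d) by (apply sqrt_lt_R0; lra).
assert (Hd1 : d <= 1 / 4) by nra.
assert (HB1 : 0 <= B1) by (unfold B1; lra).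
(* The step [t^(3/2)] balances [B1 / (t h)], from the error of the mean, against the curvature term
   [a h / t^4]; multiplied by [t^3], both are of order [sqrt t]. *)
set (h := d * t).
assert (Hh : 0 < h <= t / 4) by (unfold h; nra).
assert (E0 := mean_bound t ltac:(lra)); apply Rabs_le_between in E0.
assert (E1 := mean_bound (t + h) ltac:(lra)); apply Rabs_le_between in E1.
assert (E2 := mean_bound (t - h) ltac:(lra)); apply Rabs_le_between in E2.
fold B1 in E0, E1, E2.
assert (T1 := proj2 (mean_tangents t (t + h) ltac:(lra))).
assert (T2 := proj1 (mean_tangents (t - h) t ltac:(lra))).
replace (t + h - t) with h in T1 by ring; replace (t - (t - h)) with h in T2 by ring.
assert (Ht2 : 0 < t ^ 2) by (apply pow_lt; lra).
assert (G0 : t ^ 2 * (B1 / t) = B1 * t) by (field; lra).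
assert (G1 : t ^ 2 * (B1 / (t + h)) <= B1 * t).
{ replace (t ^ 2 * (B1 / (t + h))) with (B1 * t * (t / (t + h))) by (field; lra).
  rewrite <- (Rmult_1_r (B1 * t)) at 2; apply Rmult_le_compat_l; [nra |].
  apply Rle_div_l; lra. }
assert (G2 : t ^ 2 * (B1 / (t - h)) <= 2 * (B1 * t)).
{ replace (t ^ 2 * (B1 / (t - h))) with (B1 * t * (t / (t - h))) by (field; lra).
  rewrite (Rmult_comm 2); apply Rmult_le_compat_l; [nra |].
  apply Rle_div_l; lra. }
assert (G3 : t ^ 2 * (a / t ^ 2) = a) by (field; lra).
assert (G4 : a - t ^ 2 * (a / (t + h) ^ 2) >= a * d * (2 - 3 * d)).
{ replace (t ^ 2 * (a / (t + h) ^ 2)) with (a / (1 + d) ^ 2)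
    by (unfold h; field; split; nra).
  apply Rle_ge, Rminus_le_0.
  replace (a - a / (1 + d) ^ 2 - a * d * (2 - 3 * d))
    with (a * d ^ 3 * (4 + 3 * d) / (1 + d) ^ 2) by (field; lra).
  apply Rdiv_le_0_compat; [| apply pow_lt; lra].
  apply Rmult_le_pos; [apply Rmult_le_pos; [lra | apply pow_le; lra] | lra]. }
assert (G5 : t ^ 2 * (a / (t - h) ^ 2) - a <= a * d * (2 + 8 * d)).
{ replace (t ^ 2 * (a / (t - h) ^ 2)) with (a / (1 - d) ^ 2)
    by (unfold h; field; split; nra).
  apply Rminus_le_0.
  replace (a * d * (2 + 8 * d) - (a / (1 - d) ^ 2 - a))
    with (a * d ^ 2 * (5 - 14 * d + 8 * d ^ 2) / (1 - d) ^ 2) by (field; lra).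
  apply Rdiv_le_0_compat; [| apply pow_lt; lra].
  apply Rmult_le_pos; [apply Rmult_le_pos; [lra | apply pow2_ge_0] | nra]. }
assert (V : variance e t * h * t ^ 2 = d * (variance e t * t ^ 3)) by (unfold h; ring).
assert (U1 : (mean e t - mean e (t + h)) * t ^ 2 <= d * (variance e t * t ^ 3))
  by (rewrite <- V; apply Rmult_le_compat_r; lra).
assert (U2 : d * (variance e t * t ^ 3) <= (mean e (t - h) - mean e t) * t ^ 2)
  by (rewrite <- V; apply Rmult_le_compat_r; lra).
assert (L1 : (a / t ^ 2 - B1 / t - (a / (t + h) ^ 2 + B1 / (t + h))) * t ^ 2
  <= (mean e t - mean e (t + h)) * t ^ 2) by (apply Rmult_le_compat_r; lra).
assert (L2 : (mean e (t - h) - mean e t) * t ^ 2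
  <= (a / (t - h) ^ 2 + B1 / (t - h) - (a / t ^ 2 - B1 / t)) * t ^ 2)
  by (apply Rmult_le_compat_r; lra).
assert (Hbt : B1 * t = d * (B1 * d)) by (rewrite <- Hd; ring).
assert (Hbd : 0 <= B1 * d) by nra.
assert (Had : 0 <= a * d) by nra.
apply Rabs_le; split; apply Rmult_le_reg_l with d; try lra; nra.
Qed.

End Moments.

(** * Decay away from the positive axis *)

(** The real form of a finite geometric sum in [r^2 exp (2 i x)], whose denominator has been
    multiplied by its conjugate. *)
Lemma odd_cos_sum (r x : R) (N : nat) :
  (1 - 2 * r ^ 2 * cos (2 * x) + r ^ 4)
  * sum_n (fun k => r ^ (2 * S k - 1) * cos (INR (2 * S k - 1) * x)) N
  = r * (1 - r ^ 2) * cos x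
    - r ^ (2 * N + 3) * (cos ((2 * INR N + 3) * x) - r ^ 2 * cos ((2 * INR N + 1) * x)).
Proof.
assert (Hc : forall y, cos (y + 2 * x) + cos (y - 2 * x) = 2 * cos (2 * x) * cos y)
  by (intros y; rewrite cos_plus, cos_minus; ring).
induction N as [|N IH].
- rewrite sum_O; simpl INR.
  replace (2 * 1 - 1)%nat with 1%nat by lia; simpl INR; rewrite Rmult_1_l.
  generalize (Hc x).
  replace (x + 2 * x) with ((2 * 0 + 3) * x) by ring.
  replace (x - 2 * x) with (- x) by ring; rewrite cos_neg.
  replace ((2 * 0 + 1) * x) with x by ring; simpl; intros E; nra.
- rewrite Rsum_n_Sn, Rmult_plus_distr_l, IH.
  replace (2 * S (S N) - 1)%nat with (2 * N + 3)%nat by lia.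
  replace (2 * S N + 3)%nat with (2 + (2 * N + 3))%nat by lia.
  rewrite (pow_add r 2).
  replace (INR (2 * N + 3)) with (2 * INR N + 3) by (rewrite plus_INR, mult_INR; simpl; ring).
  rewrite S_INR.
  generalize (Hc ((2 * INR N + 3) * x)).
  replace ((2 * INR N + 3) * x + 2 * x) with ((2 * (INR N + 1) + 3) * x) by ring.
  replace ((2 * INR N + 3) * x - 2 * x) with ((2 * INR N + 1) * x) by ring.
  replace ((2 * (INR N + 1) + 1) * x) with ((2 * INR N + 3) * x) by ring.
  intros E.
  replace (cos ((2 * (INR N + 1) + 3) * x))
    with (2 * cos (2 * x) * cos ((2 * INR N + 3) * x) - cos ((2 * INR N + 1) * x)) by lra.
  ring.
Qed.

Lemma odd_cos_series (r x : R) : 0 < r < 1 ->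
  is_lim_seq (fun N => (1 - 2 * r ^ 2 * cos (2 * x) + r ^ 4)
    * sum_n (fun k => r ^ (2 * S k - 1) * cos (INR (2 * S k - 1) * x)) N)
  (r * (1 - r ^ 2) * cos x).
Proof.
intros Hr; set (l := r * (1 - r ^ 2) * cos x).
apply is_lim_seq_le_le with (fun N => l - 2 * r ^ S N) (fun N => l + 2 * r ^ S N).
- intros N; rewrite odd_cos_sum; fold l.
  assert (H1 := COS_bound ((2 * INR N + 3) * x)).
  assert (H2 := COS_bound ((2 * INR N + 1) * x)).
  assert (Hp : 0 < r ^ (2 * N + 3) <= r ^ S N)
    by (split; [apply pow_lt | apply pow_le_pow; [| lia]]; lra).
  assert (Hr2 : 0 < r ^ 2 < 1) by (simpl; nra).
  revert H1 H2 Hp Hr2; generalize (cos ((2 * INR N + 3) * x)) (cos ((2 * INR N + 1) * x))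
    (r ^ (2 * N + 3)) (r ^ S N) (r ^ 2); intros u v p p' s H1 H2 Hp Hs.
  assert (Hv : -1 <= s * v <= 1) by (split; nra).
  assert (Hb : - (2 * p) <= p * (u - s * v) <= 2 * p) by (split; nra); lra.
- replace (Finite l) with (Finite (l - 2 * 0)) by (f_equal; ring).
  apply is_lim_seq_minus'; [apply is_lim_seq_const |].
  apply (is_lim_seq_scal_l _ 2 0), (is_lim_seq_incr_1 (fun n => r ^ n)), is_lim_seq_geom.
  rewrite Rabs_pos_eq; lra.
- replace (Finite l) with (Finite (l + 2 * 0)) by (f_equal; ring).
  apply is_lim_seq_plus'; [apply is_lim_seq_const |].
  apply (is_lim_seq_scal_l _ 2 0), (is_lim_seq_incr_1 (fun n => r ^ n)), is_lim_seq_geom.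
  rewrite Rabs_pos_eq; lra.
Qed.

Lemma exp_mult_INR (n : nat) (t : R) : exp (- (INR n * t)) = exp (- t) ^ n.
Proof.
rewrite <- Rpower_pow by apply exp_pos; unfold Rpower; rewrite ln_exp; f_equal; ring.
Qed.

Lemma dispersion_odd (t x : R) : 0 < t ->
  let r := exp (- t) in
  dispersion (fun n => 2 * n - 1)%nat t x
  = r / (1 - r ^ 2)
    - r * (1 - r ^ 2) * cos x / (1 - 2 * r ^ 2 * cos (2 * x) + r ^ 4).
Proof.
intros Ht r.
assert (Hr : 0 < r < 1).
{ split; [apply exp_pos | unfold r; rewrite <- exp_0; apply exp_increasing; lra]. }
assert (Hr2 : 0 < r ^ 2 < 1) by (simpl; nra).
assert (HD : forall y, 0 < 1 - 2 * r ^ 2 * cos (2 * y) + r ^ 4).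
{ intros y; assert (Hc := COS_bound (2 * y)).
  replace (r ^ 4) with (r ^ 2 * r ^ 2) by ring; nra. }
assert (HL : forall y, is_lim_seq
  (fun N => sum_n (fun k => r ^ (2 * S k - 1) * cos (INR (2 * S k - 1) * y)) N)
  (/ (1 - 2 * r ^ 2 * cos (2 * y) + r ^ 4) * (r * (1 - r ^ 2) * cos y))).
{ intros y; specialize (HD y).
  apply is_lim_seq_ext with (2 := is_lim_seq_scal_l _ (/ _) _ (odd_cos_series r y Hr)).
  intros N; rewrite <- Rmult_assoc, Rinv_l, Rmult_1_l; [reflexivity | lra]. }
apply is_series_unique.
assert (H := is_lim_seq_minus' _ _ _ _ (HL 0) (HL x)).
replace (/ (1 - 2 * r ^ 2 * cos (2 * 0) + r ^ 4) * (r * (1 - r ^ 2) * cos 0)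
  - / (1 - 2 * r ^ 2 * cos (2 * x) + r ^ 4) * (r * (1 - r ^ 2) * cos x))
  with (r / (1 - r ^ 2)
    - r * (1 - r ^ 2) * cos x / (1 - 2 * r ^ 2 * cos (2 * x) + r ^ 4)) in H.
- apply is_lim_seq_ext with (2 := H); intros N; clear H.
  assert (E : sum_n (fun k => r ^ (2 * S k - 1) * cos (INR (2 * S k - 1) * 0)) N
    - sum_n (fun k => r ^ (2 * S k - 1) * cos (INR (2 * S k - 1) * x)) N
    = sum_n (fun k => exp (- (INR (2 * S k - 1) * t)) * (1 - cos (INR (2 * S k - 1) * x))) N);
    [| exact E].
  assert (Hk : forall k, exp (- (INR (2 * S k - 1) * t)) * (1 - cos (INR (2 * S k - 1) * x))
    = r ^ (2 * S k - 1) * cos (INR (2 * S k - 1) * 0)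
      - r ^ (2 * S k - 1) * cos (INR (2 * S k - 1) * x)).
  { intros k; rewrite exp_mult_INR, Rmult_0_r, cos_0; unfold r; ring. }
  induction N as [|N IH].
  + rewrite !sum_O, Hk; reflexivity.
  + rewrite !Rsum_n_Sn, <- IH, Hk; ring.
- assert (HD0 : 0 < 1 - 2 * r ^ 2 + r ^ 4)
    by (replace (1 - 2 * r ^ 2 + r ^ 4) with ((1 - r ^ 2) ^ 2) by ring; apply pow_lt; lra).
  specialize (HD x); rewrite Rmult_0_r, cos_0; field; repeat split; lra.
Qed.

Lemma one_minus_cos_lower (x : R) : Rabs x <= PI -> x ^ 2 / 18 <= 1 - cos x.
Proof.
intros Hx; set (y := Rabs x / 2).
assert (Hy : 0 <= y <= PI / 2) by (assert (H := Rabs_pos x); unfold y; lra).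
assert (E : 1 - cos x = 2 * sin y ^ 2).
{ replace (cos x) with (cos (2 * y)).
  - rewrite cos_2a_sin; ring.
  - replace (2 * y) with (Rabs x) by (unfold y; field).
    unfold Rabs; destruct (Rcase_abs x); [apply cos_neg | reflexivity]. }
(* [sin y >= y - y^3 / 6 >= y / 3] as soon as [y <= 2], which covers [y <= PI / 2]. *)
rewrite E, <- (pow2_abs x); replace (Rabs x) with (2 * y) by (unfold y; field).
assert (Hs := proj1 (sin_Taylor_pos y (proj1 Hy))).
assert (Hsy : y / 3 <= sin y).
{ apply Rle_trans with (2 := Hs).
  assert (y <= 2) by (generalize PI_4; lra).
  simpl; nra. }
assert ((y / 3) ^ 2 <= sin y ^ 2) by (apply pow_incr; lra); lra.
Qed.

(** The bound is of order [x^2 / t^3] for [|x| <= t], as the variance dictates, and of order [1 / t]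
    beyond. *)
Definition dispersion_lower (e : nat -> nat) : Prop :=
  forall t x, 0 < t <= 1 / 2 -> Rabs x <= PI ->
  x ^ 2 / (4 * t * (72 * t ^ 2 + x ^ 2)) <= dispersion e t x.

Lemma dispersion_lower_odd : dispersion_lower (fun n => 2 * n - 1)%nat.
Proof.
intros t x Ht Hx; rewrite dispersion_odd by lra; set (r := exp (- t)).
assert (Hr1 : 1 - t <= r) by (generalize (exp_ineq1_le (- t)); fold r; lra).
assert (Hr2 : r < 1) by (unfold r; rewrite <- exp_0; apply exp_increasing; lra).
set (al := 1 - r ^ 2); set (y := 1 - cos x).
assert (Hal : 0 < al <= 2 * t) by (unfold al; simpl; nra).
assert (Hy : 0 <= y <= 2) by (unfold y; generalize (COS_bound x); lra).
assert (ED : 1 - 2 * r ^ 2 * cos (2 * x) + r ^ 4 = al ^ 2 + 4 * r ^ 2 * (y * (2 - y))).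
{ rewrite cos_2a_cos; unfold al, y; ring. }
rewrite ED; replace (cos x) with (1 - y) by (unfold y; ring).
set (s := r ^ 2) in *.
assert (Hs : 1 / 4 <= s <= 1) by (unfold s; simpl; nra).
set (D := al ^ 2 + 4 * s * (y * (2 - y))).
assert (HD : 0 < D).
{ unfold D; assert (0 < al ^ 2) by (apply pow_lt; lra).
  assert (0 <= y * (2 - y)) by nra; nra. }
replace (r / al - r * al * (1 - y) / D)
  with (r / al * (y * (al ^ 2 + 4 * s * (2 - y)) / D)) by (unfold D in *; field; split; lra).
assert (HyL := one_minus_cos_lower x Hx); fold y in HyL.
(* The quotient increases with [y], and [y >= x^2 / 18]; this is where [72 = 4 * 18] comes from.
   Conversely [al <= 2 t] and [r >= 1 / 2] give [r / al >= 1 / (4 t)]. *)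
apply Rle_trans with (1 / (4 * t) * (y / (4 * t ^ 2 + y))).
- assert (Ht2 : 0 < t ^ 2) by (apply pow_lt; lra).
  assert (Hx2 := pow2_ge_0 x).
  replace (x ^ 2 / (4 * t * (72 * t ^ 2 + x ^ 2)))
    with (1 / (4 * t) * (x ^ 2 / (72 * t ^ 2 + x ^ 2))) by (field; split; lra).
  apply Rmult_le_compat_l; [apply Rdiv_le_0_compat; lra |].
  apply Rle_div_l; [lra |].
  replace (y / (4 * t ^ 2 + y) * (72 * t ^ 2 + x ^ 2))
    with (y * (72 * t ^ 2 + x ^ 2) / (4 * t ^ 2 + y)) by (field; lra).
  assert (t ^ 2 * (x ^ 2 / 18) <= t ^ 2 * y) by (apply Rmult_le_compat_l; lra).
  apply -> Rle_div_r; lra.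
- apply Rmult_le_compat.
  + apply Rdiv_le_0_compat; lra.
  + apply Rdiv_le_0_compat; [lra |]; assert (0 < t ^ 2) by (apply pow_lt; lra); lra.
  + apply -> Rle_div_r; [| lra].
    replace (1 / (4 * t) * al) with (al / (4 * t)) by (field; lra).
    apply Rle_div_l; nra.
  + assert (Hal2 : 0 < al ^ 2 <= 4 * t ^ 2)
      by (split; [apply pow_lt; lra | replace (4 * t ^ 2) with ((2 * t) ^ 2) by ring;
          apply pow_incr; lra]).
    apply Rle_trans with (y / (al ^ 2 + y)).
    { apply Rmult_le_compat_l; [lra |]; apply Rinv_le_contravar; lra. }
    unfold Rdiv; rewrite Rmult_assoc; apply Rmult_le_compat_l; [lra |].
    change (/ (al ^ 2 + y) <= (al ^ 2 + 4 * s * (2 - y)) / D).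
    apply -> Rle_div_r; [| exact HD].
    replace (/ (al ^ 2 + y) * D) with (D / (al ^ 2 + y)) by (field; lra).
    apply <- Rle_div_l; [| lra].
    set (b := al ^ 2) in *; unfold D; fold b.
    assert (0 <= y * (2 - y)) by nra.
    assert (0 <= b * (s * (2 - y))) by (apply Rmult_le_pos; nra).
    (* Since [4 s >= 1], [y + 4 s (2 - y) >= 2]. *)
    assert (0 <= b * (y + (4 * s * (2 - y)) - 1 + b)); [| nra].
    apply Rmult_le_pos; nra.
Qed.

(** All terms are nonnegative, so adding the even exponents can only increase the dispersion. *)
Lemma dispersion_lower_id : dispersion_lower (fun n => n).
Proof.
intros t x Ht Hx; apply Rle_trans with (1 := dispersion_lower_odd t x Ht Hx).
set (a := fun n => exp (- (INR n * t)) * (1 - cos (INR n * x))).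
assert (Ha : forall n, 0 <= a n).
{ intros n; apply Rmult_le_pos; [left; apply exp_pos |].
  generalize (COS_bound (INR n * x)); lra. }
assert (H1 := Series_correct _ (ex_series_dispersion _ t distinct_exponents_id ltac:(lra) x)).
assert (H2 := Series_correct _ (ex_series_dispersion _ t distinct_exponents_odd ltac:(lra) x)).
apply (is_lim_seq_le (sum_n (fun k => a (2 * S k - 1)%nat))
  (fun N => sum_n (fun k => a (S k)) (2 * N))
  (dispersion (fun n => 2 * n - 1)%nat t x) (dispersion (fun n => n) t x)).
- intros N; induction N as [|N IH].
  + change (2 * 0)%nat with 0%nat; rewrite !sum_O; apply Rle_refl.
  + replace (2 * S N)%nat with (S (S (2 * N))) by lia.
    rewrite !(Rsum_n_Sn _ (S (2 * N))), !(Rsum_n_Sn _ (2 * N)), !(Rsum_n_Sn _ N).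
    replace (2 * S (S N) - 1)%nat with (S (S (S (2 * N)))) by lia.
    specialize (Ha (S (S (2 * N)))); lra.
- exact H2.
- apply (is_lim_seq_subseq (sum_n (fun k => a (S k))) _ (fun N => (2 * N)%nat));
    [apply eventually_double | exact H1].
Qed.

(** * The circle integral *)

Lemma Cpow_diff_le (u v : C) (k : nat) : Cmod u <= 1 -> Cmod v <= 1 ->
  Cmod (Cpow u k - Cpow v k) <= INR k * Cmod (u - v).
Proof.
intros Hu Hv; induction k as [|k IH].
- change (Cmod (1 - 1) <= 0 * Cmod (u - v)).
  replace (1 - 1)%C with (RtoC 0) by ring; rewrite Cmod_0; lra.
- rewrite !Cpow_S, S_INR.
  replace (u * Cpow u k - v * Cpow v k)%C
    with (u * (Cpow u k - Cpow v k) + (u - v) * Cpow v k)%C by ring.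
  apply Rle_trans with (1 := Cmod_triangle _ _); rewrite !Cmod_mult, Cmod_pow.
  assert (H1 : Cmod v ^ k <= 1)
    by (rewrite <- (pow1 k); apply pow_incr; split; [apply Cmod_ge_0 | exact Hv]).
  assert (H2 := Cmod_ge_0 (u - v)); assert (H3 := Cmod_ge_0 (Cpow u k - Cpow v k)).
  assert (H4 : 0 <= Cmod v ^ k) by (apply pow_le, Cmod_ge_0).
  assert (H5 := Cmod_ge_0 u); nra.
Qed.

Lemma expi_Cpow_neg (y : R) (k : nat) : Cpow (expi (- y)) k = expi (- (INR k * y)).
Proof. rewrite expi_pow; f_equal; ring. Qed.

Lemma Series_nonneg (a : nat -> R) :
  (forall k, 0 <= a k) -> ex_series a -> 0 <= Series a.
Proof.
intros Ha Hs; apply Rle_trans with (sum_n a 0); [rewrite sum_O; apply Ha |].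
now apply sum_n_le_Series.
Qed.

(** The characteristic function [F (exp (- t + i x)) / F (exp (- t))], normalised so that the
    exponentially large size of [F] disappears from the estimates. *)
Definition unit_prod (e : nat -> nat) (t x : R) : C :=
  (RtoC (exp (- (24 * log_prod e t)))
   * Cpow (Cprod1_inf (fun n => 1 + Cpow (polar (exp (- t)) x) (e n))%C) 24)%C.

Section Circle.

Variables (e : nat -> nat) (c : nat -> R).
Hypothesis He : distinct_exponents e.
Hypothesis Hc : prod_coeffs e c.

Lemma exp_neg_bounds (t : R) : 0 < t -> 0 < exp (- t) < 1.
Proof.
intros Ht; split; [apply exp_pos | rewrite <- exp_0; apply exp_increasing; lra].
Qed.

(** The 24th power of [exp_prod_CLT]: [6 = 24 / 4], [12 = 24 / 2] and [20736 = 24 * 864], the last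
    by [Cpow_diff_le] in the unit disc. *)
Lemma unit_prod_CLT (t x : R) : 0 < t ->
  Cmod (unit_prod e t x) <= exp (- (6 * dispersion e t x)) /\
  Cmod (unit_prod e t x * expi (- (x * (24 * mean e t)))
        - RtoC (exp (- (12 * x ^ 2 * variance e t)))) <= 20736 * (Rabs x ^ 3 / t ^ 4).
Proof.
intros Ht; destruct (Hc (exp (- t)) x (exp_neg_bounds t Ht)) as [l [Hl _]].
destruct (exp_prod_CLT e t He Ht x l Hl) as [D [E [H1 H2]]].
assert (EN : unit_prod e t x = Cpow D 24).
{ unfold unit_prod; rewrite (Cprod1_inf_eq _ l Hl), E, Cpow_mult_l, <- RtoC_pow.
  rewrite Cmult_assoc, <- RtoC_mult.
  rewrite <- (Rpower_pow 24) by apply exp_pos; unfold Rpower; rewrite ln_exp, <- exp_plus.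
  replace (- (24 * log_prod e t) + INR 24 * log_prod e t) with 0 by (simpl; ring).
  rewrite exp_0; apply Cmult_1_l. }
assert (HS : 0 <= dispersion e t x).
{ apply Series_nonneg; [| now apply ex_series_dispersion].
  intros k; apply Rmult_le_pos; [left; apply exp_pos |].
  generalize (COS_bound (INR (e (S k)) * x)); lra. }
assert (HV : 0 <= variance e t).
{ apply Series_nonneg; [| now apply ex_series_variance].
  intros k; apply Rmult_le_pos; [apply pow2_ge_0 | apply fermi_var_bounds]. }
rewrite EN; split.
- rewrite Cmod_pow.
  apply Rle_trans with (exp (- (dispersion e t x / 4)) ^ 24).
  + apply pow_incr; split; [apply Cmod_ge_0 | exact H1].
  + right; rewrite <- exp_mult_INR; f_equal; simpl; field.
- set (v := RtoC (exp (- (x ^ 2 / 2 * variance e t)))) in *.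
  replace (RtoC (exp (- (12 * x ^ 2 * variance e t)))) with (Cpow v 24).
  + replace (- (x * (24 * mean e t))) with (- (INR 24 * (x * mean e t))) by (simpl; ring).
    rewrite <- expi_Cpow_neg, <- Cpow_mult_l.
    apply Rle_trans with (INR 24 * (864 * (Rabs x ^ 3 / t ^ 4))); [| simpl; lra].
    eapply Rle_trans; [apply Cpow_diff_le |].
    * rewrite Cmod_mult, Cmod_expi, Rmult_1_r.
      apply Rle_trans with (1 := H1), exp_neg_le_1; lra.
    * unfold v; rewrite Cmod_R, Rabs_pos_eq by (left; apply exp_pos).
      apply exp_neg_le_1, Rmult_le_pos; [assert (H := pow2_ge_0 x); lra | exact HV].
    * apply Rmult_le_compat_l; [apply pos_INR | exact H2].
  + unfold v; rewrite <- RtoC_pow, <- exp_mult_INR; do 2 f_equal; simpl; field.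
Qed.

Lemma coefficient_integral (t : R) (N : nat) : 0 < t ->
  is_RInt (fun x => Re (unit_prod e t x * expi (- (INR N * x)))) (- PI) PI
    (2 * PI * (c N * exp (- t) ^ N) * exp (- (24 * log_prod e t))).
Proof.
intros Ht; assert (Hr := exp_neg_bounds t Ht).
set (F := fun x => Cpow (Cprod1_inf (fun n => 1 + Cpow (polar (exp (- t)) x) (e n))%C) 24).
assert (HF : forall x, is_Cpseries c (polar (exp (- t)) x) (F x)).
{ intros x; destruct (Hc (exp (- t)) x Hr) as [l [Hl Hs]].
  unfold F; rewrite (Cprod1_inf_eq _ l Hl); exact Hs. }
assert (Habs : ex_series (fun n => Rabs (c n) * exp (- t) ^ n)).
{ apply Cpseries_abs_conv; [| exact Hr].
  intros r Hr'; destruct (Hc r 0 Hr') as [l [_ Hs]]; now exists (Cpow l 24). }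
assert (H := Cauchy_coefficient c F (exp (- t)) N ltac:(lra) Habs HF).
apply (is_RInt_scal (V := R_NormedModule) _ _ _ (exp (- (24 * log_prod e t)))) in H.
replace (2 * PI * (c N * exp (- t) ^ N) * exp (- (24 * log_prod e t)))
  with (scal (exp (- (24 * log_prod e t))) (2 * PI * (c N * exp (- t) ^ N)))
  by (unfold scal; simpl; unfold mult; simpl; ring).
apply is_RInt_ext with (2 := H); intros x _; unfold unit_prod; fold (F x).
set (k := exp (- (24 * log_prod e t))).
rewrite <- Cmult_assoc; generalize (F x * expi (- (INR N * x)))%C; intros [u v].
unfold scal; simpl; unfold mult; simpl; ring.
Qed.

Hypothesis Hdisp : dispersion_lower e.

Lemma unit_prod_decay (t x : R) : 0 < t <= 1 / 2 -> 0 < Rabs x <= PI ->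
  Cmod (unit_prod e t x) <= 100000000 * (t ^ 3 / x ^ 2).
Proof.
intros Ht Hx; apply Rle_trans with (1 := proj1 (unit_prod_CLT t x (proj1 Ht))).
assert (HD := Hdisp t x Ht (proj2 Hx)).
assert (Hx0 : x <> 0) by (intros E; rewrite E, Rabs_R0 in Hx; lra).
assert (Hx2 : 0 < x ^ 2) by (rewrite <- pow2_abs; apply pow_lt; lra).
assert (Hx16 : x ^ 2 <= 16).
{ rewrite <- pow2_abs; replace 16 with (4 ^ 2) by ring; apply pow_incr.
  generalize PI_4; lra. }
assert (Ht2 : 0 < t ^ 2) by (apply pow_lt; lra).
assert (Ht3 : 0 < t ^ 3) by (apply pow_lt; lra).
assert (Hq : 0 < t ^ 3 / x ^ 2) by (apply Rdiv_lt_0_compat; lra).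
(* In both cases [49 >= 4 * (72 + 1) / 6]. For [|x| <= t], [exp (- y) <= 1 / y] suffices. For
   [|x| > t], the exponent is of order [1 / t]; [exp (- y) <= 27 / y^3] and [x^2 <= 16] give a
   constant [27 * 49^3 * 16], below [10^8]. *)
destruct (Rle_dec (x ^ 2) (t ^ 2)) as [Hxt | Hxt].
- set (y := x ^ 2 / (49 * t ^ 3)).
  assert (Hy : 0 < y) by (apply Rdiv_lt_0_compat; lra).
  assert (Hy6 : y <= 6 * dispersion e t x).
  { apply Rle_trans with (6 * (x ^ 2 / (4 * t * (72 * t ^ 2 + x ^ 2)))); [| lra].
    replace (6 * (x ^ 2 / (4 * t * (72 * t ^ 2 + x ^ 2))))
      with (x ^ 2 / (2 / 3 * t * (72 * t ^ 2 + x ^ 2))) by (field; lra).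
    apply Rmult_le_compat_l; [lra |]; apply Rinv_le_contravar.
    - apply Rmult_lt_0_compat; lra.
    - replace (49 * t ^ 3) with (49 * (t * t ^ 2)) by ring; nra. }
  apply Rle_trans with (exp (- y)); [apply exp_le; lra |].
  apply Rle_trans with (1 := exp_neg_le_inv y Hy).
  replace (/ y) with (49 * (t ^ 3 / x ^ 2)) by (unfold y; field; split; [lra | exact Hx0]); lra.
- set (y := / (49 * t)).
  assert (Hy : 0 < y) by (apply Rinv_0_lt_compat; lra).
  assert (Hy6 : y <= 6 * dispersion e t x).
  { apply Rle_trans with (6 * (x ^ 2 / (4 * t * (72 * t ^ 2 + x ^ 2)))); [| lra].
    replace (6 * (x ^ 2 / (4 * t * (72 * t ^ 2 + x ^ 2))))
      with (/ (49 * t) * (147 / 2 * x ^ 2 / (72 * t ^ 2 + x ^ 2))) by (field; lra).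
    fold y; rewrite <- (Rmult_1_r y) at 1; apply Rmult_le_compat_l; [lra |].
    apply -> Rle_div_r; lra. }
  apply Rle_trans with (exp (- y)); [apply exp_le; lra |].
  assert (Hcub := cube_exp_le y (Rlt_le _ _ Hy)).
  apply Rle_trans with (27 * (49 * t) ^ 3).
  + apply Rmult_le_reg_l with (y ^ 3); [now apply pow_lt |].
    replace (y ^ 3 * (27 * (49 * t) ^ 3)) with 27; [exact Hcub | unfold y; field; lra].
  + replace ((49 * t) ^ 3) with (117649 * t ^ 3) by ring.
    apply Rmult_le_reg_r with (x ^ 2); [exact Hx2 |].
    replace (100000000 * (t ^ 3 / x ^ 2) * x ^ 2) with (100000000 * t ^ 3) by (field; exact Hx0).
    nra.
Qed.

End Circle.

Lemma exp_neg_Lipschitz (u v : R) : 0 <= u -> 0 <= v ->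
  Rabs (exp (- u) - exp (- v)) <= Rabs (u - v).
Proof.
assert (H : forall u v, 0 <= u -> u <= v -> 0 <= exp (- u) - exp (- v) <= v - u).
{ intros u' v' Hu Huv; split.
  - assert (exp (- v') <= exp (- u')) by (apply exp_le; lra); lra.
  - replace (exp (- v')) with (exp (- u') * exp (- (v' - u')))
      by (rewrite <- exp_plus; f_equal; ring).
    assert (H1 := exp_ineq1_le (- (v' - u'))); assert (H2 := exp_neg_le_1 u' Hu).
    assert (H3 := exp_pos (- u')); assert (H4 := exp_neg_le_1 (v' - u') ltac:(lra)); nra. }
intros Hu Hv; destruct (Rle_dec u v) as [Huv | Huv].
- specialize (H u v Hu Huv); rewrite Rabs_pos_eq, Rabs_left1 by lra; lra.
- assert (Hvu : v <= u) by lra; specialize (H v u Hv Hvu).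
  rewrite Rabs_left1, Rabs_pos_eq by lra; lra.
Qed.

Lemma is_RInt_inv_sq (K u v : R) : u <= v -> 0 < u \/ v < 0 ->
  is_RInt (fun x => K * / x ^ 2) u v (K * (/ u - / v)).
Proof.
intros Huv H0; assert (Hx0 : forall x, Rmin u v <= x <= Rmax u v -> x <> 0).
{ intros x; rewrite Rmin_left, Rmax_right by lra; destruct H0; lra. }
replace (K * (/ u - / v)) with (minus (- K * / v) (- K * / u))
  by (unfold minus, plus, opp; simpl; ring).
apply (is_RInt_derive (V := R_CompleteNormedModule) (fun x => - K * / x)).
- intros x Hx; specialize (Hx0 x Hx); auto_derive; [exact Hx0 | field; exact Hx0].
- intros x Hx; specialize (Hx0 x Hx); apply (ex_derive_continuous (V := R_NormedModule)).
  auto_derive; nra.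
Qed.

Lemma RInt_tail_le (f : R -> R) (K u v : R) : u <= v -> 0 < u \/ v < 0 ->
  ex_RInt f u v -> (forall x, u <= x <= v -> Rabs (f x) <= K * / x ^ 2) ->
  Rabs (RInt f u v) <= K * (/ u - / v).
Proof.
intros Huv H0 Hf Hb.
apply (norm_RInt_le (V := R_NormedModule) f (fun x => K * / x ^ 2) u v _ _ Huv Hb).
- now apply (RInt_correct (V := R_CompleteNormedModule)).
- now apply is_RInt_inv_sq.
Qed.

Section SaddlePoint.

Variables (e : nat -> nat) (c : nat -> R) (a c0 B : R).
Hypothesis He : distinct_exponents e.
Hypothesis Hc : prod_coeffs e c.
Hypothesis Ha : 1 <= 24 * a.
Hypothesis HB : 0 <= B.
Hypothesis Hlog : log_prod_asymp e a c0 B.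
Hypothesis Hdisp : dispersion_lower e.

(** The three summands are the errors of the Gaussian approximation, of the mean (as a phase) and of
    the variance, on the window [|x| <= M t^(3/2)]. *)
Definition saddle_const (M : R) : R :=
  20736 * M ^ 3 + 2 * ((24 * (a + 5 * B) + 1) * M)
  + 12 * (M ^ 2 * (8 * a + 3 * (a + 5 * B))).

(** The true mean and variance are replaced by [nu] and [2 a / t^3]. The mean is off by [O(1 / t)],
    harmless against [|x| <= M t^(3/2)]; the relative error of the variance is [O(sqrt t)]. *)
Lemma unit_prod_gauss (M t x nu : R) : 0 <= M -> 0 < t <= 1 / 16 ->
  Rabs (nu - 24 * a / t ^ 2) <= 1 -> Rabs x <= M * (t * sqrt t) ->
  Cmod (unit_prod e t x * expi (- (nu * x)) - RtoC (exp (- (24 * a * x ^ 2 / t ^ 3))))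
  <= saddle_const M * sqrt t.
Proof.
intros HM Ht Hnu Hx; set (d := sqrt t) in *.
assert (Hd : d * d = t) by (apply sqrt_sqrt; lra).
assert (Hd0 : 0 < d) by (apply sqrt_lt_R0; lra).
assert (Ht2 : 0 < t ^ 2) by (apply pow_lt; lra).
assert (Ht3 : 0 < t ^ 3) by (apply pow_lt; lra).
set (m := 24 * mean e t); set (V := variance e t).
assert (H1 : Cmod (unit_prod e t x * expi (- (x * m)) - RtoC (exp (- (12 * x ^ 2 * V))))
  <= 20736 * M ^ 3 * d).
{ apply Rle_trans with (1 := proj2 (unit_prod_CLT e c He Hc t x (proj1 Ht))).
  rewrite Rmult_assoc; apply Rmult_le_compat_l; [lra |].
  apply Rle_div_l; [apply pow_lt; lra |].
  apply Rle_trans with ((M * (t * d)) ^ 3);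
    [apply pow_incr; split; [apply Rabs_pos | exact Hx] |].
  right; rewrite <- Hd; ring. }
assert (H2 : Cmod (expi ((m - nu) * x) - 1) <= 2 * ((24 * (a + 5 * B) + 1) * M) * d).
{ apply Rle_trans with (1 := Cmod_expi_minus_1 _).
  rewrite Rmult_assoc; apply Rmult_le_compat_l; [lra |].
  rewrite Rabs_mult.
  assert (Hm := mean_bound e He a c0 B ltac:(lra) HB Hlog t ltac:(lra)).
  assert (Hmn : Rabs (m - nu) <= (24 * (a + 5 * B) + 1) / t).
  { replace (m - nu) with (24 * (mean e t - a / t ^ 2) + - (nu - 24 * a / t ^ 2))
      by (unfold m; field; lra).
    apply Rle_trans with (1 := Rabs_triang _ _).
    rewrite Rabs_Ropp, Rabs_mult, (Rabs_pos_eq 24) by lra.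
    assert (1 <= / t) by (rewrite <- Rinv_1; apply Rinv_le_contravar; lra).
    unfold Rdiv in *; lra. }
  apply Rle_trans with ((24 * (a + 5 * B) + 1) / t * (M * (t * d))).
  - apply Rmult_le_compat; auto using Rabs_pos.
  - right; field; lra. }
assert (HV0 : 0 <= V).
{ apply Series_nonneg; [| now apply ex_series_variance].
  intros k; apply Rmult_le_pos; [apply pow2_ge_0 | apply fermi_var_bounds]. }
assert (Hx2 := pow2_ge_0 x).
assert (H3 : Rabs (exp (- (12 * x ^ 2 * V)) - exp (- (24 * a * x ^ 2 / t ^ 3)))
  <= 12 * (M ^ 2 * (8 * a + 3 * (a + 5 * B))) * d).
{ apply Rle_trans with (1 := exp_neg_Lipschitz (12 * x ^ 2 * V) (24 * a * x ^ 2 / t ^ 3)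
    ltac:(apply Rmult_le_pos; lra)
    ltac:(apply Rdiv_le_0_compat; [apply Rmult_le_pos |]; lra)).
  replace (12 * x ^ 2 * V - 24 * a * x ^ 2 / t ^ 3)
    with (12 * (x ^ 2 / t ^ 3 * (V * t ^ 3 - 2 * a))) by (field; lra).
  assert (Hv := variance_bound e He a c0 B ltac:(lra) HB Hlog t Ht).
  fold V d in Hv.
  rewrite !Rabs_mult, (Rabs_pos_eq 12), (Rabs_pos_eq (x ^ 2 / t ^ 3))
    by (try apply Rdiv_le_0_compat; lra).
  rewrite !Rmult_assoc; apply Rmult_le_compat_l; [lra |].
  apply Rmult_le_compat; [apply Rdiv_le_0_compat; lra | apply Rabs_pos | | exact Hv].
  apply Rle_div_l; [lra |]; rewrite <- pow2_abs.
  apply Rle_trans with ((M * (t * d)) ^ 2);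
    [apply pow_incr; split; [apply Rabs_pos | exact Hx] |].
  right; rewrite <- Hd; ring. }
replace (- (nu * x)) with (- (x * m) + (m - nu) * x) by ring.
rewrite expi_plus.
set (G := RtoC (exp (- (12 * x ^ 2 * V)))) in *.
set (W := (unit_prod e t x * expi (- (x * m)))%C) in *.
replace (unit_prod e t x * (expi (- (x * m)) * expi ((m - nu) * x))
    - RtoC (exp (- (24 * a * x ^ 2 / t ^ 3))))%C
  with ((W - G) * expi ((m - nu) * x) + (G * (expi ((m - nu) * x) - 1)
    + (G - RtoC (exp (- (24 * a * x ^ 2 / t ^ 3))))))%C by (unfold W; ring).
apply Rle_trans with (1 := Cmod_triangle _ _).
rewrite Cmod_mult, Cmod_expi, Rmult_1_r.
assert (HG : Cmod G <= 1).
{ unfold G; rewrite Cmod_R, Rabs_pos_eq by (left; apply exp_pos).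
  apply exp_neg_le_1, Rmult_le_pos; lra. }
assert (H4 : Cmod (G * (expi ((m - nu) * x) - 1)) <= 2 * ((24 * (a + 5 * B) + 1) * M) * d).
{ rewrite Cmod_mult; apply Rle_trans with (2 := H2).
  rewrite <- (Rmult_1_l (Cmod (_ - _))) at 2.
  apply Rmult_le_compat_r; [apply Cmod_ge_0 | exact HG]. }
assert (H5 : Cmod (G - RtoC (exp (- (24 * a * x ^ 2 / t ^ 3))))
  <= 12 * (M ^ 2 * (8 * a + 3 * (a + 5 * B))) * d)
  by (unfold G; rewrite <- RtoC_minus, Cmod_R; exact H3).
assert (H6 := Cmod_triangle (G * (expi ((m - nu) * x) - 1))
  (G - RtoC (exp (- (24 * a * x ^ 2 / t ^ 3))))).
unfold saddle_const; lra.
Qed.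

(** The circle is cut at [p = M t^(3/2)] and its negative. Each tail costs
    [10^8 t^3 / p = 10^8 w / M]; on the window, [x = w u] turns the integral into a Gaussian over
    [[-M, M]]. Dividing by [w] gives the three errors. *)
Lemma circle_integral_estimate (M t : R) (N : nat) (I : R) :
  0 < M -> 0 < t <= 1 / 16 -> M * (t * sqrt t) <= PI ->
  Rabs (INR N - 24 * a / t ^ 2) <= 1 ->
  is_RInt (fun x => Re (unit_prod e t x * expi (- (INR N * x)))) (- PI) PI I ->
  Rabs (I / (t * sqrt t) - sqrt (PI / (24 * a)))
  <= 200000000 / M + 2 * M * (saddle_const M * sqrt t) + 4 / M ^ 2.
Proof.
intros HM Ht HMt HN HI.
set (f := fun x => Re (unit_prod e t x * expi (- (INR N * x)))) in *.
set (K := saddle_const M * sqrt t).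
assert (Hd : sqrt t * sqrt t = t) by (apply sqrt_sqrt; lra).
assert (Hd0 : 0 < sqrt t) by (apply sqrt_lt_R0; lra).
set (w := t * sqrt t) in *.
assert (Hw : 0 < w) by (apply Rmult_lt_0_compat; lra).
assert (Hw2 : w * w = t ^ 3) by (transitivity (t * t * (sqrt t * sqrt t)); [unfold w | rewrite Hd]; ring).
set (p := M * w) in *.
assert (Hp : 0 < p) by (unfold p; nra).
assert (Hex : ex_RInt f (- PI) PI) by (now exists I).
assert (Hex1 : ex_RInt f (- PI) (- p)) by (apply (ex_RInt_Chasles_1 f _ _ PI); [lra | easy]).
assert (Hex23 : ex_RInt f (- p) PI) by (apply (ex_RInt_Chasles_2 f (- PI)); [lra | easy]).
assert (Hex2 : ex_RInt f (- p) p) by (apply (ex_RInt_Chasles_1 f _ _ PI); [lra | easy]).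
assert (Hex3 : ex_RInt f p PI) by (apply (ex_RInt_Chasles_2 f (- p)); [lra | easy]).
assert (EI : I = RInt f (- PI) (- p) + RInt f (- p) p + RInt f p PI).
{ rewrite <- (is_RInt_unique _ _ _ _ HI).
  rewrite <- (RInt_Chasles (V := R_CompleteNormedModule) f (- PI) (- p) PI) by easy.
  rewrite <- (RInt_Chasles (V := R_CompleteNormedModule) f (- p) p PI) by easy.
  unfold plus; simpl; ring. }
assert (Hdec : forall x, 0 < Rabs x <= PI ->
  Rabs (f x) <= 100000000 * t ^ 3 * / x ^ 2).
{ intros x Hx; unfold f; apply Rle_trans with (1 := re_le_Cmod _).
  rewrite Cmod_mult, Cmod_expi, Rmult_1_r.
  generalize (unit_prod_decay e c He Hc Hdisp t x ltac:(lra) Hx); unfold Rdiv; lra. }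
assert (Htail : 100000000 * t ^ 3 * (/ p - / PI) <= 100000000 / M * w).
{ assert (0 < / PI) by apply Rinv_0_lt_compat, PI_RGT_0.
  apply Rle_trans with (100000000 * t ^ 3 * / p).
  - apply Rmult_le_compat_l; [| lra].
    apply Rmult_le_pos; [lra | apply pow_le; lra].
  - right; rewrite <- Hw2; unfold p; field; lra. }
assert (T1 : Rabs (RInt f (- PI) (- p)) <= 100000000 / M * w).
{ apply Rle_trans with (2 := Htail).
  replace (/ p - / PI) with (/ - PI - / - p) by (rewrite !Rinv_opp; ring).
  apply RInt_tail_le; [lra | right; lra | exact Hex1 |].
  intros x Hx; apply Hdec; rewrite Rabs_left1; lra. }
assert (T3 : Rabs (RInt f p PI) <= 100000000 / M * w).
{ apply Rle_trans with (2 := Htail).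
  apply RInt_tail_le; [lra | left; lra | exact Hex3 |].
  intros x Hx; apply Hdec; rewrite Rabs_pos_eq; lra. }
set (g := fun x => exp (- (24 * a * x ^ 2 / t ^ 3))).
assert (Hg : forall u v, ex_RInt g u v).
{ intros u v; apply ex_RInt_derivable; intros x; unfold g; auto_derive; easy. }
assert (T2 : Rabs (RInt f (- p) p - RInt g (- p) p) <= 2 * p * K).
{ replace (2 * p) with (p - - p) by ring.
  apply (norm_RInt_le_const (V := R_NormedModule) (fun x => minus (f x) (g x)) (- p) p).
  - lra.
  - intros x Hx; change (Rabs (f x - g x) <= K).
    assert (Hx' : Rabs x <= M * (t * sqrt t)) by (apply Rabs_le; fold w; fold p; lra).
    apply Rle_trans with (2 := unit_prod_gauss M t x (INR N) (Rlt_le _ _ HM) Ht HN Hx').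
    apply Rle_trans with (2 := re_le_Cmod _); apply Req_le; unfold f, g.
    apply (f_equal Rabs).
    destruct (unit_prod e t x * expi (- (INR N * x)))%C as [u v]; simpl; ring.
  - apply (is_RInt_minus (V := R_NormedModule));
      apply (RInt_correct (V := R_CompleteNormedModule)); easy. }
assert (Eg : RInt g (- p) p = w * RInt (fun u => exp (- (24 * a * u ^ 2))) (- M) M).
{ replace (RInt g (- p) p) with (RInt g (w * - M + 0) (w * M + 0))
    by (f_equal; unfold p; ring).
  rewrite <- (RInt_comp_lin (V := R_CompleteNormedModule)) by apply Hg.
  rewrite (RInt_scal (V := R_CompleteNormedModule) (fun u => g (w * u + 0)))
    by (apply ex_RInt_derivable; intros x; unfold g; auto_derive; easy).
  change (w * RInt (fun u => g (w * u + 0)) (- M) M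
    = w * RInt (fun u => exp (- (24 * a * u ^ 2))) (- M) M).
  f_equal; apply RInt_ext; intros u _; unfold g; do 2 f_equal.
  rewrite <- Hw2; field; lra. }
rewrite Eg in T2.
assert (HG := gauss_bound (24 * a) M Ha HM).
set (J := RInt (fun u => exp (- (24 * a * u ^ 2))) (- M) M) in *.
set (I1 := RInt f (- PI) (- p)) in *; set (I2 := RInt f (- p) p) in *;
  set (I3 := RInt f p PI) in *.
apply Rabs_le_between in T1; apply Rabs_le_between in T2; apply Rabs_le_between in T3.
apply Rabs_le_between in HG.
assert (HIJ : - ((200000000 / M + 2 * M * K) * w) <= I - J * w
  <= (200000000 / M + 2 * M * K) * w).
{ replace ((200000000 / M + 2 * M * K) * w)
    with (100000000 / M * w + 100000000 / M * w + 2 * p * K) by (unfold p; field; lra).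
  rewrite EI; lra. }
assert (HIJ' : - (200000000 / M + 2 * M * K) <= I / w - J <= 200000000 / M + 2 * M * K).
{ replace (I / w - J) with ((I - J * w) / w) by (field; lra); split.
  - apply -> Rle_div_r; lra.
  - apply <- Rle_div_l; lra. }
apply Rabs_le; lra.
Qed.

End SaddlePoint.

(** * Coefficient asymptotics *)

Lemma is_lim_seq_sqrt_0 (u : nat -> R) : is_lim_seq u 0 -> is_lim_seq (fun n => sqrt (u n)) 0.
Proof.
intros H; rewrite <- sqrt_0; apply (is_lim_seq_continuous sqrt u 0); [| exact H].
apply continuity_pt_sqrt; lra.
Qed.

Section Asymptotics.

Variables (e : nat -> nat) (c : nat -> R) (a c0 B : R) (N : nat -> nat).
Hypothesis He : distinct_exponents e.
Hypothesis Hc : prod_coeffs e c.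
Hypothesis Ha : 1 <= 24 * a.
Hypothesis HB : 0 <= B.
Hypothesis Hlog : log_prod_asymp e a c0 B.
Hypothesis Hdisp : dispersion_lower e.
(** [N n] is the index of the coefficient of the product: [S n] for [psi], [pred n] for [phi]. *)
Hypothesis HN : forall n, (0 < n)%nat -> Rabs (INR (N n) - INR n) <= 1.

Let A : R := 24 * a.
Let t (n : nat) : R := sqrt (A / INR n).
Let I (n : nat) : R :=
  RInt (fun x => Re (unit_prod e (t n) x * expi (- (INR (N n) * x)))) (- PI) PI.

Lemma saddle_pos (n : nat) : (0 < n)%nat -> 0 < t n.
Proof.
intros Hn; apply sqrt_lt_R0, Rdiv_lt_0_compat; [unfold A; lra | now apply lt_0_INR].
Qed.

Lemma saddle_sqr (n : nat) : (0 < n)%nat -> t n * t n = A / INR n.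
Proof.
intros Hn; apply sqrt_sqrt, Rdiv_le_0_compat; [unfold A; lra | now apply lt_0_INR].
Qed.

Lemma saddle_lim : is_lim_seq t 0.
Proof.
apply is_lim_seq_sqrt_0.
replace (Finite 0) with (Rbar_mult A (Rbar_inv p_infty)) by (simpl; f_equal; ring).
apply is_lim_seq_scal_l, is_lim_seq_inv; [apply is_lim_seq_INR | easy].
Qed.

Lemma circle_integral_lim :
  is_lim_seq (fun n => I n / (t n * sqrt (t n))) (sqrt (PI / A)).
Proof.
apply is_lim_seq_Reals; intros eps Heps.
(* Chosen before [t], so that the two errors free of [t] stay below [eps / 2]; [4 / M^2] is absorbed
   as [4 / M]. *)
set (M := 1 + 2 * 200000004 / eps).
assert (HM : 1 < M) by (assert (0 < 2 * 200000004 / eps) by (apply Rdiv_lt_0_compat; lra);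
  unfold M; lra).
assert (HM1 : 200000000 / M + 4 / M ^ 2 < eps / 2).
{ apply Rle_lt_trans with (200000004 / M).
  - replace (200000004 / M) with (200000000 / M + 4 / M) by (field; lra).
    apply Rplus_le_compat_l, Rmult_le_compat_l; [lra |].
    apply Rinv_le_contravar; simpl; nra.
  - apply <- Rlt_div_l; [| lra].
    replace (eps / 2 * M) with (eps / 2 + 200000004) by (unfold M; field; lra); lra. }
set (K := saddle_const a B M).
assert (HK : 0 <= K).
{ unfold K, saddle_const; assert (0 <= M ^ 3) by (apply pow_le; lra).
  assert (0 <= M ^ 2) by (apply pow_le; lra).
  assert (0 <= (24 * (a + 5 * B) + 1) * M) by (apply Rmult_le_pos; lra).
  assert (0 <= M ^ 2 * (8 * a + 3 * (a + 5 * B))) by (apply Rmult_le_pos; lra).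
  lra. }
(* Bounds on [sqrt (t n)]: [1 / 4] ensures [t n <= 1 / 16], [1 / M] keeps the window inside the
   circle, and the last one makes the window error less than [eps / 2]. *)
set (eta := Rmin (1 / 4) (Rmin (/ M) (eps / (4 * M * K + 1)))).
assert (HMK : 0 <= M * K) by (apply Rmult_le_pos; lra).
assert (Heta : 0 < eta).
{ apply Rmin_glb_lt; [lra |]; apply Rmin_glb_lt;
    [apply Rinv_0_lt_compat; lra | apply Rdiv_lt_0_compat; lra]. }
destruct (proj1 (is_lim_seq_Reals _ _) (is_lim_seq_sqrt_0 _ saddle_lim) eta Heta)
  as [n0 Hn0].
exists (S n0); intros n Hn; assert (Hn1 : (0 < n)%nat) by lia.
specialize (Hn0 n ltac:(lia)); unfold R_dist in Hn0 |- *.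
rewrite Rminus_0_r, Rabs_pos_eq in Hn0 by apply sqrt_pos.
assert (Ht0 := saddle_pos n Hn1).
assert (Hs0 : 0 < sqrt (t n)) by (apply sqrt_lt_R0, Ht0).
assert (Hss : sqrt (t n) * sqrt (t n) = t n) by (apply sqrt_sqrt; lra).
assert (E1 : sqrt (t n) < 1 / 4) by (apply Rlt_le_trans with (1 := Hn0), Rmin_l).
assert (E2 : sqrt (t n) < / M)
  by (apply Rlt_le_trans with (1 := Hn0), Rle_trans with (1 := Rmin_r _ _), Rmin_l).
assert (E3 : sqrt (t n) < eps / (4 * M * K + 1))
  by (apply Rlt_le_trans with (1 := Hn0), Rle_trans with (1 := Rmin_r _ _), Rmin_r).
assert (Ht16 : t n <= 1 / 16) by nra.
assert (HMt : M * (t n * sqrt (t n)) <= PI).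
{ assert (M * sqrt (t n) < 1).
  { apply Rmult_lt_reg_l with (/ M); [apply Rinv_0_lt_compat; lra |].
    rewrite <- Rmult_assoc, Rinv_l, Rmult_1_r by lra; lra. }
  generalize PI2_1; intros; nra. }
assert (HNt : Rabs (INR (N n) - 24 * a / t n ^ 2) <= 1).
{ replace (24 * a / t n ^ 2) with (INR n); [now apply HN |].
  replace (t n ^ 2) with (t n * t n) by ring; rewrite saddle_sqr by exact Hn1.
  assert (0 < INR n) by now apply lt_0_INR.
  unfold A; field; lra. }
apply Rle_lt_trans with (1 := circle_integral_estimate e c a c0 B He Hc Ha HB Hlog Hdisp
  M (t n) (N n) (I n) ltac:(lra) (conj Ht0 Ht16) HMt HNt
  (RInt_correct (V := R_CompleteNormedModule) _ _ _
    (ex_intro _ _ (coefficient_integral e c Hc (t n) (N n) Ht0)))).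
fold K.
assert (HE : 2 * M * (K * sqrt (t n)) < eps / 2); [| lra].
apply Rlt_div_r in E3; [| lra]; nra.
Qed.

(** An exact identity: at the saddle [n t = A / t = sqrt (A n)], and [t^(3/2) = A^(3/4) / n^(3/4)].
    What remains is an exponential of quantities tending to 0 times the normalised circle
    integral. *)
Lemma coefficient_ratio (n : nat) : (0 < n)%nat ->
  c (N n) / (exp (24 * c0) * (Rpower A (1 / 4) / (2 * sqrt PI))
             * (1 / Rpower (INR n) (3 / 4)) * exp (2 * sqrt (A * INR n)))
  = exp (24 * (log_prod e (t n) - (a / t n + c0)) + t n * (INR (N n) - INR n))
    * (I n / (t n * sqrt (t n)) * (sqrt A / sqrt PI)).
Proof.
intros Hn; assert (Ht := saddle_pos n Hn); assert (Hx := lt_0_INR n Hn).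
assert (HA : 0 < A) by (unfold A; lra).
assert (EI : I n = 2 * PI * (c (N n) * exp (- t n) ^ N n) * exp (- (24 * log_prod e (t n))))
  by exact (is_RInt_unique _ _ _ _ (coefficient_integral e c Hc (t n) (N n) Ht)).
assert (Hsq := saddle_sqr n Hn).
assert (ES : sqrt (A * INR n) = INR n * t n).
{ replace (A * INR n) with ((INR n * t n) * (INR n * t n)).
  - apply sqrt_square; nra.
  - transitivity (INR n * INR n * (t n * t n)); [ring | rewrite Hsq; field; lra]. }
assert (ES' : 24 * (a / t n) = INR n * t n).
{ replace (24 * (a / t n)) with (A / INR n * INR n / t n) by (unfold A; field; lra).
  rewrite <- Hsq; field; lra. }
assert (Ew : Rpower A (1 / 4) * sqrt A = t n * sqrt (t n) * Rpower (INR n) (3 / 4)).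
{ rewrite <- (Rpower_sqrt (t n)), <- (Rpower_sqrt A) by easy.
  unfold t at 1 2; rewrite <- Rpower_sqrt by (apply Rdiv_lt_0_compat; easy).
  rewrite Rpower_mult, <- !Rpower_plus.
  replace (1 / 4 + / 2) with (3 / 4) by field.
  replace (/ 2 + / 2 * / 2) with (3 / 4) by field.
  rewrite Rpower_mult_distr; [f_equal; field; lra | | exact Hx].
  apply Rdiv_lt_0_compat; easy. }
assert (Ec : c (N n) = I n / (2 * PI) * (exp (t n * INR (N n)) * exp (24 * log_prod e (t n)))).
{ rewrite EI, <- exp_mult_INR, !exp_Ropp.
  replace (INR (N n) * t n) with (t n * INR (N n)) by ring.
  assert (H1 := exp_pos (t n * INR (N n))); assert (H2 := exp_pos (24 * log_prod e (t n))).
  assert (H3 := PI_RGT_0); field; lra. }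
rewrite Ec, ES.
assert (EE : exp (t n * INR (N n)) * exp (24 * log_prod e (t n))
  = exp (24 * c0) * exp (2 * (INR n * t n))
    * exp (24 * (log_prod e (t n) - (a / t n + c0)) + t n * (INR (N n) - INR n))).
{ rewrite <- !exp_plus; f_equal; lra. }
rewrite EE.
set (X := exp (24 * (log_prod e (t n) - (a / t n + c0)) + t n * (INR (N n) - INR n))).
assert (Hp : 0 < Rpower (INR n) (3 / 4)) by apply exp_pos.
assert (Hp' : 0 < Rpower A (1 / 4)) by apply exp_pos.
assert (Hs0 : 0 < sqrt (t n)) by now apply sqrt_lt_R0.
assert (Hs1 : 0 < sqrt PI) by (apply sqrt_lt_R0, PI_RGT_0).
assert (Hs2 : sqrt PI * sqrt PI = PI) by (apply sqrt_sqrt; left; apply PI_RGT_0).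
assert (H1 := exp_pos (24 * c0)); assert (H2 := exp_pos (2 * (INR n * t n))).
replace (sqrt A) with (t n * sqrt (t n) * Rpower (INR n) (3 / 4) / Rpower A (1 / 4))
  by (rewrite <- Ew; field; lra).
set (sp := sqrt PI) in *; rewrite <- Hs2; field; repeat split; lra.
Qed.

Lemma coefficient_asymptotics :
  is_lim_seq (fun n => c (N n) / (exp (24 * c0) * (Rpower A (1 / 4) / (2 * sqrt PI))
             * (1 / Rpower (INR n) (3 / 4)) * exp (2 * sqrt (A * INR n)))) 1.
Proof.
apply is_lim_seq_ext_loc with
  (fun n => exp (24 * (log_prod e (t n) - (a / t n + c0)) + t n * (INR (N n) - INR n))
    * (I n / (t n * sqrt (t n)) * (sqrt A / sqrt PI))).
{ exists 1%nat; intros n Hn; symmetry; apply coefficient_ratio; lia. }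
assert (HA : 0 < A) by (unfold A; lra).
assert (HPI := PI_RGT_0).
assert (HsA : 0 < sqrt A) by now apply sqrt_lt_R0.
assert (HsP : 0 < sqrt PI) by now apply sqrt_lt_R0.
replace (Finite 1) with (Finite (exp 0 * (sqrt (PI / A) * (sqrt A / sqrt PI)))).
- apply is_lim_seq_mult'.
  + apply is_lim_seq_exp, is_lim_seq_abs_0.
    apply is_lim_seq_le_le_loc with (fun _ => 0) (fun n => (24 * B + 1) * t n).
    * exists 1%nat; intros n Hn; split; [apply Rabs_pos |].
      assert (Ht := saddle_pos n Hn).
      apply Rle_trans with (1 := Rabs_triang _ _).
      rewrite !Rabs_mult, (Rabs_pos_eq 24), (Rabs_pos_eq (t n)) by lra.
      specialize (Hlog (t n) Ht); specialize (HN n Hn); nra.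
    * apply is_lim_seq_const.
    * replace (Finite 0) with (Rbar_mult (24 * B + 1) 0) by (simpl; f_equal; ring).
      apply is_lim_seq_scal_l, saddle_lim.
  + apply is_lim_seq_mult'; [apply circle_integral_lim | apply is_lim_seq_const].
- rewrite exp_0, sqrt_div_alt by exact HA; f_equal; field; lra.
Qed.

End Asymptotics.

Theorem theorem1p2 (s b : nat -> Z)
  (hs : forall z : C, upper_half_plane z ->
    exists v : C, is_qseries s z v /\
      psi z = (/ q z - RtoC 24 + v)%C)
  (hb : forall z : C, upper_half_plane z -> is_qseries b z (phi z)) :
  asymp_equiv (fun n => IZR (Z.abs (s n)))
    (fun n => 1 / (2 * Rpower (INR n) (3 / 4)) * exp (2 * PI * sqrt (INR n)))
  /\
  asymp_equiv (fun n => IZR (b n))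
    (fun n => Rpower 2 (1 / 4) / 8192 * (1 / Rpower (INR n) (3 / 4))
              * exp (2 * PI * sqrt (2 * INR n))).
Proof.
assert (HPI := PI_RGT_0); assert (HPI1 := PI2_1).
assert (HPI4 : Rpower (PI ^ 2) (1 / 4) = sqrt PI).
{ rewrite <- (Rpower_pow 2), Rpower_mult, <- Rpower_sqrt by easy.
  f_equal; simpl; field. }
assert (Hs1 : 0 < sqrt PI) by now apply sqrt_lt_R0.
assert (HsP : sqrt (PI ^ 2) = PI) by (apply sqrt_pow2; lra).
split.
- assert (H := coefficient_asymptotics _ _ (PI ^ 2 / 24) 0 (3 / 8) S
    distinct_exponents_odd (psi_coeffs s hs) ltac:(nra) ltac:(lra)
    log_prod_asymp_odd dispersion_lower_odd
    ltac:(intros n _; rewrite S_INR; replace (INR n + 1 - INR n) with 1 by ring;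
          rewrite Rabs_R1; lra)).
  (* Absolute values remove the sign [(-1)^n] of [psi_sign_coeffs]. *)
  apply is_lim_seq_abs in H; simpl Rbar_abs in H; rewrite Rabs_R1 in H.
  apply is_lim_seq_ext_loc with (2 := H); exists 1%nat; intros [|n] Hn; [lia |].
  replace (24 * (PI ^ 2 / 24)) with (PI ^ 2) by field.
  rewrite Rmult_0_r, exp_0, HPI4, sqrt_mult_alt, HsP by nra.
  set (p := Rpower (INR (S n)) (3 / 4)).
  assert (Hp : 0 < p) by apply exp_pos.
  replace (1 * (sqrt PI / (2 * sqrt PI)) * (1 / p)) with (1 / (2 * p)) by (field; lra).
  rewrite <- (Rmult_assoc 2 PI).
  unfold Rdiv at 1; rewrite Rabs_mult.
  change (psi_sign_coeffs s (S (S n))) with ((-1) ^ n * IZR (s (S n))).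
  rewrite Rabs_mult, pow_1_abs, Rmult_1_l, abs_IZR.
  rewrite (Rabs_pos_eq (/ _)); [reflexivity |].
  left; apply Rinv_0_lt_compat, Rmult_lt_0_compat; [| apply exp_pos].
  apply Rdiv_lt_0_compat; lra.
- assert (H := coefficient_asymptotics _ _ (PI ^ 2 / 12) (- ln 2 / 2) (1 / 8) pred
    distinct_exponents_id (phi_coeffs b hb) ltac:(nra) ltac:(lra)
    log_prod_asymp_id dispersion_lower_id
    ltac:(intros [|n] Hn; [lia |]; simpl pred; rewrite S_INR;
          replace (INR n - (INR n + 1)) with (- (1)) by ring;
          rewrite Rabs_Ropp, Rabs_R1; lra)).
  apply is_lim_seq_ext_loc with (2 := H); exists 1%nat; intros [|n] Hn; [lia |].
  replace (24 * (PI ^ 2 / 12)) with (2 * PI ^ 2) by field.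
  simpl pred; f_equal; f_equal; [f_equal |].
  + rewrite <- Rpower_mult_distr, HPI4 by nra.
    (* [exp (24 c0) = 2^(-12)]; with [(2 PI^2)^(1/4) / (2 sqrt PI) = 2^(1/4) / 2] this gives
       [2^(1/4) / 8192]. *)
    replace (24 * (- ln 2 / 2)) with (- (INR 12 * ln 2)) by (simpl; field).
    rewrite exp_Ropp; change (exp (INR 12 * ln 2)) with (Rpower 2 (INR 12)).
    rewrite Rpower_pow by lra; field; lra.
  + f_equal; replace (2 * PI ^ 2 * INR (S n)) with (PI ^ 2 * (2 * INR (S n))) by ring.
    rewrite sqrt_mult_alt, HsP by nra; ring.
Qed.
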